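(* Let $f(z)=\sum_{m=0}^\infty a_m z^m$ be a power series with complex coefficients and $\limsup_{m\to\infty}|a_m|^{1/m}=1$. Let $\{m_k\}$ be a strictly increasing sequence of positive integers and $\{\beta_k\}$ a sequence of real numbers such that $$\lim_{k\to\infty}\left|\mathrm{Re}\,(e^{-i\beta_k}a_{m_k})\right|^{1/m_k}=1 .$$ Let $\Lambda_{k,+}=\{j\in\mathbb{Z}: m_k\le j\le 2m_k,\ a_j\ne0\}$ and $\Lambda_{k,-}=\{j\in\mathbb{Z}:0\le j\le m_k,\ a_j\neq0\}$, and let $\Lambda_\pm=\{\Lambda_{k,\pm}\}_k$. Put $\Delta=\min\{D_3(\Lambda_+),D_3(\Lambda_-)\}$, with the density $D_3$ defined in the context. Then $f$ has at least one singularity on each closed arc of the unit circle of length $2\pi\Delta$.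
   Context: Singularity on an arc: $f$ has a singularity on a closed arc $I$ of the unit circle if $f$ has no immediate analytic continuation from the unit disc to $I$, i.e. there is no function analytic in the union of the open unit disc and some open neighborhood of $I$ that coincides with $f$ in the unit disc. (A closed arc of length $0$ is a single point; the arc of length $2\pi$ is the whole circle.) Counting functions: for $r\in[0,1]$, $$n_{k,+}(r)=\frac1{m_k}\,\mathrm{card}\big(\Lambda_{k,+}\cap[m_k,(1+r)m_k]\big),\qquad n_{k,-}(r)=\frac1{m_k}\,\mathrm{card}\big(\Lambda_{k,-}\cap[(1-r)m_k,m_k]\big).$$ Limit functions: $\mathfrak{Fr}(\Lambda_\pm)$ is the set of all functions $n$ on $[0,1]$ that are pointwise limits of subsequences of $\{n_{k,\pm}\}_k$. Such $n$ are increasing (non-strictly) and $|n(x)-n(y)|\le|x-y|$ for all $x,y\in(0,1]$; since the count at the single point $r=0$ is at most $1/m_k$, also $n(0)=0$ and the inequality holds on $[0,1]$. Lower regularization: for an increasing function $n$ on $[0,\delta]$ satisfying $|n(x)-n(y)|\le|x-y|$, and $a\in[0,1]$, $$\underline{n}^a_\delta=\sup\{\phi\in C^1([0,\delta]):\ \phi\le n,\ a\le\phi'\le1\}$$ (pointwise supremum). A function on $[0,1]$ is first restricted to $[0,\delta]$. Density: $$D_3(\Lambda_\pm)=\inf_{n\in\mathfrak{Fr}(\Lambda_\pm)}\ \inf\left\{a\in[0,1]:\ \int_0^\delta\frac{n(r)-\underline{n}^a_\delta(r)}{r^2}\,dr=\infty\ \text{ for all }\delta\in(0,1)\right\},$$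 with the infimum of the empty subset of $[0,1]$ taken to be $1$. *)

(* Defs.v *)
From HB Require Import structures.
From mathcomp Require Import all_boot all_order all_algebra.
From mathcomp Require Import complex finmap.
From mathcomp Require Import all_classical all_reals all_analysis.
Set Implicit Arguments.
Unset Strict Implicit.
Unset Printing Implicit Defensive.
Import Order.TTheory GRing.Theory Num.Theory.
Import numFieldNormedType.Exports.
Local Open Scope classical_set_scope.
Local Open Scope ring_scope.

(* R[i] carries only its algebraic structure in mathcomp-real-closed; the
   topology used here is the one of the norm z |-> `|z|, as for any numeric
   field. *)
HB.instance Definition _ (R : realType) := NormedModule.copy R[i] R[i]^o.

Definition expi {R : realType} (t : R) : R[i] := Complex (cos t) (sin t).

Definition unit_disc (R : realType) : set R[i] := [set z | `|z| < 1].
Arguments unit_disc : clear implicits.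

(* Closed arc of length l, described counterclockwise from expi t. *)
Definition closed_arc {R : realType} (t l : R) : set R[i] :=
  [set expi s | s in `[t, t + l]].

Definition analytic_at {R : realType} (F : R[i] -> R[i]) (z : R[i]) : Prop :=
  exists b : nat -> R[i],
    \forall w \near z, [series b n * (w - z) ^+ n]_n @ \oo --> F w.

(* Only the values of f in the unit disc matter. *)
Definition has_singularity_on {R : realType} (f : R[i] -> R[i])
    (I : set R[i]) : Prop :=
  ~ exists (U : set R[i]) (F : R[i] -> R[i]),
      [/\ open U, I `<=` U,
          forall z, (unit_disc R `|` U) z -> analytic_at F z &
          forall z, unit_disc R z -> F z = f z].

Definition Lambda_plus {R : realType} (a : nat -> R[i]) (m : nat -> nat)
    (k : nat) : set nat :=
  [set j | (m k <= j <= 2 * m k)%N /\ a j != 0].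

Definition Lambda_minus {R : realType} (a : nat -> R[i]) (m : nat -> nat)
    (k : nat) : set nat :=
  [set j | (0 <= j <= m k)%N /\ a j != 0].

Definition count_plus (R : realType) (m : nat -> nat) (L : nat -> set nat)
    (k : nat) (r : R) : R :=
  #|` fset_set (L k `&`
        [set j | (m k)%:R <= j%:R :> R /\ j%:R <= (1 + r) * (m k)%:R])|%:R
  / (m k)%:R.

Definition count_minus (R : realType) (m : nat -> nat) (L : nat -> set nat)
    (k : nat) (r : R) : R :=
  #|` fset_set (L k `&`
        [set j | (1 - r) * (m k)%:R <= j%:R /\ j%:R <= (m k)%:R :> R])|%:R
  / (m k)%:R.

(* Functions on [0, 1] are represented by functions on R whose values outside
   [0, 1] are arbitrary. *)
Definition Fr {R : realType} (N : nat -> R -> R) : set (R -> R) :=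
  [set n | exists2 s : nat -> nat, {homo s : i j / (i < j)%N} &
     forall r : R, r \in `[0, 1] -> N (s k) r @[k --> \oo] --> n r].

(* g is the derivative of phi on the segment [0, d]; it is one-sided at the
   end points. *)
Definition segment_derivative {R : realType} (d : R) (phi g : R -> R) : Prop :=
  forall x : R, x \in `[0, d] ->
    (phi y - phi x) / (y - x) @[y --> within `[0, d] x^'] --> g x.

Definition lower_reg {R : realType} (a d : R) (n : R -> R) (x : R) : R :=
  sup [set phi x | phi in
    [set phi : R -> R | exists g : R -> R,
       [/\ segment_derivative d phi g,
           {within `[0, d], continuous g},
           forall y : R, y \in `[0, d] -> phi y <= n y &
           forall y : R, y \in `[0, d] -> a <= g y <= 1]]].

(* Infimum in [0, 1]: the library's inf set0 is 0. *)
Definition inf01 {R : realType} (A : set R) : R :=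
  if A == set0 then 1 else inf A.

Definition D3_of {R : realType} (n : R -> R) : R :=
  inf01 [set a | a \in `[0, 1] /\
    forall d : R, d \in `]0, 1[ ->
      (\int[lebesgue_measure]_(r in `]0%R, d])
         ((n r - lower_reg a d n r) / r ^+ 2)%:E = +oo)%E].

(* Argument: the counting functions of Lambda. *)
Definition D3 {R : realType} (N : nat -> R -> R) : R :=
  inf01 [set D3_of n | n in Fr N].

(* Main.v *)
(** Suppose that f continues across an arc of length 2 pi sg, Delta < sg < 1, and
    let m be one of the m_k. Averaging f over small circles, with binomial weights
    that peak at m, replaces the a_j by c_j (j < N = C m) with c_m = a_m, c_j = 0
    whenever a_j = 0, |c_j| subexponential, and sum_j c_j e^{ijs} exponentially
    small on the arc. Dropping these small values from a discrete Fourier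
    transform of length N leaves a polynomial Q of degree about (1 - sg) N with
    |Q (om^i)| close to |c_{m +- i}|, om = e^{2 pi i / N}; a Lagrange correction
    makes Q vanish at the om^i with small i > 0 and a_{m +- i} = 0.

    By the divergence of the integral that defines the density there are disjoint
    intervals (al, be), arbitrarily close to 0, on which the limit n of the
    counting functions has slope at most some a < sg and for which
    sum ((be - al) / be)^2 is as large as desired. On the corresponding arcs Q has
    more zeros than its degree accounts for on average. Herglotz's formula,
    applied with poles near these arcs, turns this excess into a bound
    |Q 1| <= e^{-s m}, up to subexponential factors, whereas |Q 1| is close to
    |a_m|, which is not exponentially small. *)

Require Import Defs.
From HB Require Import structures.
From mathcomp Require Import all_boot all_order all_algebra.
From mathcomp Require Import complex finmap.
From mathcomp Require Import all_classical all_reals all_analysis.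
From mathcomp Require Import measurable_realfun.
From mathcomp Require Import ring lra zify.
Set Implicit Arguments.
Unset Strict Implicit.
Unset Printing Implicit Defensive.
Import Order.TTheory GRing.Theory Num.Theory.
Import numFieldNormedType.Exports.
Local Open Scope classical_set_scope.
Local Open Scope ring_scope.

(** Why squares of relative lengths decide: up to constants, passing from the point 1 to an interior
    point [w] with [1 - w = t] costs [N t]. The Poisson kernel at [w] has size about [t / be^2] at
    distance [be] from 1, whereas the radial derivative of a Poisson kernel with pole at distance
    [eta] from the circle is at most of order [1 / eta^2]. It can therefore be subtracted with
    weight of order [t (eta / be)^2] without losing positivity. With [eta] proportional to [be - al]
    and an excess of Poisson mass proportional to [N], a block gains a multiple of
    [N t ((be - al) / be)^2]. The same square is what a drop of height [be - al] over a length
    [be - al] contributes to an integral against [dr / r^2].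

    The order of the choices matters. The decay rate of the exponential sums and the factor [C]
    depend on the arc only; they limit the range on which the Lagrange correction is harmless, hence
    how close to 0 the blocks must lie. The rate [s] is dictated by the leftmost block, and the
    subexponential rate is chosen after it, below [s]. *)

Local Notation normc := Normc.normc.
Local Notation trunc := Num.truncn.

(** * The modulus and the unit circle *)

Section Modulus.
Context {R : realType}.
Implicit Types (z w : R[i]) (s t : R).

Lemma normr_normc z : `|z| = (normc z)%:C%C.
Proof. by rewrite normc_def; case: z. Qed.

Lemma sqr_normcE z : normc z ^+ 2 = complex.Re z ^+ 2 + complex.Im z ^+ 2.
Proof. by case: z => x y /=; rewrite sqr_sqrtr // addr_ge0 ?sqr_ge0. Qed.

Lemma normc_ge0 z : 0 <= normc z.
Proof. by case: z => x y /=; rewrite sqrtr_ge0. Qed.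
Hint Resolve normc_ge0 : core.

Lemma normcD z w : normc (z + w) <= normc z + normc w.
Proof. exact: (@le_normcD R z w). Qed.

Lemma normcNE z : normc (- z) = normc z.
Proof. exact: (@normcN R z). Qed.

Lemma normcB z w : normc (z - w) <= normc z + normc w.
Proof. by apply: (le_trans (normcD _ _)); rewrite normcNE. Qed.

Lemma normc_distC z w : normc (z - w) = normc (w - z).
Proof. by rewrite -normcNE opprB. Qed.

Lemma normcBge z w : normc z - normc w <= normc (z - w).
Proof. by rewrite lerBlDr; apply: le_trans (normcD _ _); rewrite subrK. Qed.

Lemma normc_gt0 z : (0 < normc z) = (z != 0).
Proof.
rewrite lt_def normc_ge0 andbT; congr (~~ _); apply/eqP/eqP => [|->].
  exact: Normc.eq0_normc.
exact: Normc.normc0.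
Qed.

Lemma normcXn z n : normc (z ^+ n) = normc z ^+ n.
Proof.
elim: n => [|n IH]; first by rewrite !expr0 Normc.normc1.
by rewrite !exprS Normc.normcM IH.
Qed.

Lemma normc_div z w : normc (z / w) = normc z / normc w.
Proof. by rewrite Normc.normcM Normc.normcV. Qed.

Lemma normc_real t : normc t%:C%C = `|t|.
Proof. by rewrite /= expr0n addr0 sqrtr_sqr. Qed.

Lemma normc_nat n : normc n%:R = n%:R :> R.
Proof.
by have -> : n%:R = (n%:R : R)%:C%C; rewrite ?normc_real ?normr_nat // rmorph_nat.
Qed.

Lemma normc_prod (I : Type) (r : seq I) (P : pred I) (F : I -> R[i]) :
  normc (\prod_(i <- r | P i) F i) = \prod_(i <- r | P i) normc (F i).
Proof.
elim/big_rec2: _ => [|i y1 y2 Pi <-]; first by rewrite Normc.normc1.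
by rewrite Normc.normcM.
Qed.

Lemma normc_sum (I : Type) (r : seq I) (P : pred I) (F : I -> R[i]) :
  normc (\sum_(i <- r | P i) F i) <= \sum_(i <- r | P i) normc (F i).
Proof.
elim/big_ind2: _ => [|x1 x2 y1 y2 h1 h2|//]; first by rewrite Normc.normc0.
by apply: le_trans (normcD _ _) _; apply: lerD.
Qed.

Lemma normc_Re z : `|complex.Re z| <= normc z.
Proof.
by case: z => x y /=; rewrite -sqrtr_sqr; apply: ler_wsqrtr; rewrite lerDl sqr_ge0.
Qed.

Lemma Re_le_normc z : complex.Re z <= normc z.
Proof. exact: le_trans (ler_norm _) (normc_Re z). Qed.

Lemma normc_conj z : normc z^*%C = normc z.
Proof. by case: z => x y /=; rewrite sqrrN. Qed.

Lemma expiD s t : expi (s + t) = expi s * expi t.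
Proof.
rewrite /expi cosD sinD; apply/eqP; rewrite eq_complex /=; apply/andP; split=> //.
by rewrite addrC.
Qed.

Lemma expi0 : expi 0 = 1 :> R[i].
Proof. by rewrite /expi cos0 sin0. Qed.

Lemma normc_expi t : normc (expi t) = 1.
Proof. by rewrite /= cos2Dsin2 sqrtr1. Qed.

Lemma expiX t n : expi t ^+ n = expi (n%:R * t).
Proof.
elim: n => [|n IH]; first by rewrite expr0 mul0r expi0.
by rewrite exprS IH -expiD; congr expi; rewrite -[in RHS]natr1; ring.
Qed.

Lemma expi2pi : expi (2 * pi) = 1 :> R[i].
Proof. by rewrite /expi mulrC mulr_natr cos2pi sin2pi. Qed.

Lemma chord_expi t : normc (1 - expi t) = 2 * `|sin (t / 2)|.
Proof.
apply/eqP; rewrite -(@eqrXn2 _ 2) ?mulr_ge0 //; apply/eqP.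
rewrite sqr_normcE exprMn real_normK ?num_real // /expi /=.
have -> : t = (t / 2) *+ 2 by rewrite -mulr_natr divfK // pnatr_eq0.
rewrite cos_mulr2n sin_mulr2n; set u := _ / 2.
have -> : (u *+ 2) / 2 = u by rewrite -mulr_natr mulfK // pnatr_eq0.
have := cos2Dsin2 u; move: (cos u) (sin u) => c s; nra.
Qed.

Lemma chordE s t : normc (expi s - expi t) = 2 * `|sin ((s - t) / 2)|.
Proof.
have -> : expi s - expi t = expi s * (1 - expi (t - s)).
  by rewrite mulrBr mulr1 -expiD [s + (t - s)]addrC subrK.
rewrite Normc.normcM normc_expi mul1r chord_expi -opprB mulNr sinN normrN.
by [].
Qed.

End Modulus.
#[global] Hint Resolve normc_ge0 : core.

Section Sine.
Context {R : realType}.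
Implicit Types s t x : R.

Lemma sin_le_id x : 0 <= x -> sin x <= x.
Proof.
rewrite le_eqVlt => /predU1P[<-|x0]; first by rewrite sin0.
have d1 y : y \in `]0, x[ -> is_derive y 1 (fun y => y - sin y) (1 - cos y).
  by move=> _; apply: is_deriveB.
have c1 : {within `[0, x], continuous (fun y => y - sin y)}.
  apply: continuous_subspaceT => y.
  by apply: cvgB; [exact: cvg_id | exact: continuous_sin].
have [c _ h] := MVT x0 d1 c1.
rewrite -subr_ge0.
move: h; rewrite sin0 !subr0 => ->.
by rewrite mulr_ge0 ?subr_ge0 ?cos_le1 // ltW.
Qed.

Lemma normr_sin_le x : `|sin x| <= `|x|.
Proof.
wlog x0 : x / 0 <= x => [h|].
  case: (leP 0 x) => [/h//|x0].
  by rewrite -normrN -sinN -(normrN x) h // oppr_ge0 ltW.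
rewrite (ger0_norm x0) ler_norml sin_le_id // andbT.
have [xpi|xpi] := leP x pi.
  by apply: le_trans (sin_ge0_pi _); rewrite ?oppr_le0 // x0 xpi.
apply: le_trans (sin_geN1 x); rewrite lerN2.
by apply: le_trans (ltW xpi); apply: le_trans (pi_ge2 R); rewrite ler1n.
Qed.

Lemma chord_le s t : normc (expi s - expi t) <= `|s - t|.
Proof.
rewrite chordE; apply: (@le_trans _ _ (2 * `|(s - t) / 2|)).
  by rewrite ler_pM2l // normr_sin_le.
by rewrite normrM normfV normr_nat mulrCA divff ?mulr1 // pnatr_eq0.
Qed.

End Sine.

Section ChordLowerBound.
Context {R : realType}.
Implicit Types s t x : R.

(** With [y cos y <= sin y] at [y = x / 2], [sin x = 2 sin y cos y >= x cos^2 y], and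
    [cos^2 y >= cos^2 (pi / 4) = 1/2]. *)
Lemma sin_ge_half x : 0 <= x <= pi / 2 -> x / 2 <= sin x.
Proof.
(* [sin x - x cos x] is nondecreasing on [0, pi] *)
have key (y : R) : 0 <= y -> y <= pi -> y * cos y <= sin y.
  rewrite le_eqVlt => /predU1P[<-|y0]; first by rewrite sin0 mul0r.
  move=> ypi.
  pose g z : R := sin z - z * cos z.
  have dg (z : R) : z \in `]0, y[ -> is_derive z 1 g (z * sin z).
    move=> _; have : is_derive z 1 g (cos z - (z *: (- sin z) + cos z *: 1)).
      by apply: is_deriveB.
    by move/is_derive_eq; apply; rewrite /GRing.scale /=; ring.
  have cg : {within `[0, y], continuous g}.
    apply: continuous_subspaceT => z; apply: cvgB; first exact: continuous_sin.
    by apply: cvgM; [exact: cvg_id | exact: continuous_cos].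
  have [c /[!in_itv]/= /andP[c0 cy] h] := MVT y0 dg cg.
  rewrite -subr_ge0; move: h; rewrite /g sin0 mul0r !subr0 => ->.
  rewrite mulr_ge0 ?mulr_ge0 ?sin_ge0_pi ?(ltW y0) ?(ltW c0) //=.
  by apply: le_trans ypi; apply: ltW.
move=> /andP[x0 xpi].
have p0 := @pi_gt0 R.
have h0 : 0 <= x / 2 by rewrite divr_ge0.
have hc : x / 2 * cos (x / 2) <= sin (x / 2).
  by apply: key => //; lra.
have hcos : cos (pi / 4) <= cos (x / 2).
  by rewrite leNgt ltr_cos ?in_itv /= -?leNgt; lra.
have c4 : 0 <= cos (pi / 4) :> R by apply: cos_ge0_pihalf; lra.
have hs : cos (pi / 4) ^+ 2 = 2^-1 :> R.
  have := cos_pihalf R; have -> : pi / 2 = (pi / 4) *+ 2 :> R by rewrite -mulr_natr; field.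
  rewrite cos_mulr2n => h; lra.
have -> : sin x = 2 * (sin (x / 2) * cos (x / 2)).
  have {1}-> : x = (x / 2) *+ 2 by rewrite -mulr_natr divfK // pnatr_eq0.
  by rewrite sin_mulr2n -mulr_natl mulrC; ring.
have : cos (pi / 4) ^+ 2 <= cos (x / 2) ^+ 2 by rewrite lerXn2r ?nnegrE // (le_trans c4).
rewrite hs => h2.
have hcx : 0 <= cos (x / 2) by apply: le_trans hcos.
have := ler_wpM2r hcx hc.
move: h2; rewrite expr2.
move: (cos (x / 2)) (sin (x / 2)) => c s; nra.
Qed.

Lemma chord_ge s t : `|s - t| <= pi -> `|s - t| / 2 <= normc (expi s - expi t).
Proof.
move=> h; rewrite chordE.
wlog st : s t h / t <= s => [H|].
  case: (leP t s) => [/H->//|st].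
  have := H t s; rewrite distrC => /(_ h (ltW st)).
  by rewrite -(normrN (sin _)) -sinN -mulNr opprB.
move: h; rewrite ger0_norm ?subr_ge0 // => h.
have hs : (s - t) / 2 / 2 <= sin ((s - t) / 2).
  by apply: sin_ge_half; apply/andP; split; rewrite ?divr_ge0 ?subr_ge0 ?ler_pM2r.
apply: (@le_trans _ _ (2 * sin ((s - t) / 2))); first by lra.
by rewrite ler_pM2l // ler_norm.
Qed.

End ChordLowerBound.

Section RealPart.
Context {R : realType}.
Implicit Types (z w : R[i]) (s t : R).

Lemma ReD z w : complex.Re (z + w) = complex.Re z + complex.Re w.
Proof. by case: z; case: w. Qed.

Lemma ReN z : complex.Re (- z) = - complex.Re z.
Proof. by case: z. Qed.

Lemma ReB z w : complex.Re (z - w) = complex.Re z - complex.Re w.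
Proof. by rewrite ReD ReN. Qed.

Lemma Re_realM t z : complex.Re (t%:C%C * z) = t * complex.Re z.
Proof. by case: z => x y /=; rewrite mul0r subr0. Qed.

Lemma Re_sum (I : Type) (r : seq I) (P : pred I) (F : I -> R[i]) :
  complex.Re (\sum_(i <- r | P i) F i) = \sum_(i <- r | P i) complex.Re (F i).
Proof. by elim/big_rec2: _ => [//|i y1 y2 Pi <-]; rewrite ReD. Qed.

Lemma ReM2 z w : 2 * (complex.Re z * complex.Re w) =
  complex.Re (z * w) + complex.Re (z * w^*%C).
Proof. by case: z => a b; case: w => c d /=; ring. Qed.

Lemma Re_divE z w : complex.Re (z / w) =
  (complex.Re z * complex.Re w + complex.Im z * complex.Im w) / normc w ^+ 2.
Proof.
rewrite sqr_normcE; case: z => a b; case: w => c d /=.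
by rewrite mulrN opprK !mulrA mulrDl.
Qed.

Lemma conjCM z w : (z * w)^*%C = z^*%C * w^*%C.
Proof. exact: rmorphM. Qed.

Lemma conjCB z w : (z - w)^*%C = z^*%C - w^*%C.
Proof. exact: rmorphB. Qed.

Lemma mulC_conj z : z * z^*%C = (normc z ^+ 2)%:C%C.
Proof. by rewrite sqr_normcE; case: z => a b; apply/eqP; rewrite eq_complex /=; apply/andP; split; apply/eqP; ring. Qed.

Lemma conj_unit z : normc z = 1 -> z^*%C = z^-1.
Proof.
move=> z1; have z0 : z != 0 by rewrite -normc_gt0 z1.
by apply: (mulfI z0); rewrite divff // mulC_conj z1 expr1n.
Qed.

End RealPart.

(** * Roots of unity and discrete means *)

Section RootsOfUnity.
Context {R : realType}.

Definition om (M : nat) : R[i] := expi (2 * pi / M%:R).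

Arguments om : simpl never.

Lemma normc_om M : normc (om M) = 1. Proof. exact: normc_expi. Qed.

Lemma normc_omX M k : normc (om M ^+ k) = 1.
Proof. by rewrite normcXn normc_om expr1n. Qed.

Lemma omX M k : om M ^+ k = expi (2 * pi * k%:R / M%:R).
Proof. by rewrite expiX; congr expi; ring. Qed.

Lemma om_prim M : (0 < M)%N -> om M ^+ M = 1.
Proof.
by move=> M0; rewrite omX mulfK ?pnatr_eq0 -?lt0n // expi2pi.
Qed.

Lemma om_neq1 M k : (0 < k < M)%N -> om M ^+ k != 1.
Proof.
move=> /andP[k0 kM]; have M0 : (0 < M)%N by apply: ltn_trans kM.
rewrite -subr_eq0 -normc_gt0 normc_distC omX chord_expi mulr_gt0 // normr_gt0.
apply: lt0r_neq0; apply: sin_gt0_pi; apply/andP; split.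
  by rewrite !divr_gt0 ?mulr_gt0 ?pi_gt0 ?ltr0n.
rewrite [X in X < _](_ : _ = pi * (k%:R / M%:R)); last by field; rewrite pnatr_eq0 -lt0n.
by rewrite gtr_pMr ?pi_gt0 // ltr_pdivrMr ?ltr0n // mul1r ltr_nat.
Qed.

Lemma sum_om M k : (0 < M)%N ->
  \sum_(l < M) (om M ^+ l) ^+ k = if (M %| k)%N then M%:R else 0.
Proof.
move=> M0; have -> : \sum_(l < M) (om M ^+ l) ^+ k = \sum_(l < M) (om M ^+ k) ^+ l.
  by apply: eq_bigr => l _; rewrite -!exprM mulnC.
case: ifPn => [/dvdnP[q ->]|ndiv].
  rewrite mulnC exprM om_prim // expr1n.
  by under eq_bigr do rewrite expr1n; rewrite sumr_const card_ord.
have : (om M ^+ k - 1) * \sum_(l < M) (om M ^+ k) ^+ l = 0.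
  by rewrite -subrX1 -exprM mulnC exprM om_prim // expr1n subrr.
move=> /eqP; rewrite mulf_eq0 => /orP[|/eqP //].
rewrite subr_eq0 (divn_eq k M) exprD mulnC exprM om_prim // expr1n mul1r.
by rewrite (negPf (om_neq1 _)) // ltn_mod M0 lt0n -/(dvdn M k) ndiv.
Qed.

(** Writing the conjugate as a power keeps all exponents in [nat], so that orthogonality reduces to
    the divisibility test of [sum_om]. *)
Lemma conj_om M l : (0 < M)%N -> ((om M ^+ l)^*)%C = om M ^+ (l * M.-1).
Proof.
move=> M0; rewrite conj_unit ?normc_omX //.
have h : om M ^+ l != 0 by rewrite -normc_gt0 normc_omX.
apply: (mulfI h); rewrite divff // -exprD -mulnS prednK // mulnC exprM om_prim //.
by rewrite expr1n.
Qed.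

Lemma sum_om_conj M n k : (0 < M)%N -> (n < M)%N -> (k < M)%N ->
  \sum_(l < M) (om M ^+ l) ^+ n * ((om M ^+ l)^*)%C ^+ k = if n == k then M%:R else 0.
Proof.
move=> M0 nM kM.
have -> : \sum_(l < M) (om M ^+ l) ^+ n * ((om M ^+ l)^*)%C ^+ k
    = \sum_(l < M) (om M ^+ l) ^+ (n + k * M.-1).
  by apply: eq_bigr => l _; rewrite conj_om // exprD -!exprM mulnA mulnAC -mulnA.
rewrite sum_om //; congr (if _ then _ else _).
rewrite /dvdn -[X in _ == X](mod0n M) -(eqn_modDr k) -addnA [(k * _ + k)%N]addnC -mulnS.
by rewrite prednK // addnC modnMDl add0n !modn_small.
Qed.

End RootsOfUnity.

Section DiscreteMean.
Context {R : realType}.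
Implicit Types (a b : nat -> R[i]).

(** Exact quadrature: both factors have degree at most [K], so their product has frequencies at most
    [2 K < M] and no aliasing occurs. This finite mean stands in for integration over the circle in
    Herglotz's formula. *)
Lemma mean_mul_trig (K : nat) (B : R) a b (M := (2 * K).+1) :
  \sum_(l < M) (1 + 2 * complex.Re (\sum_(n < K) a n * ((om M ^+ l)^*)%C ^+ n.+1))
             * (B + complex.Re (\sum_(n < K) b n * (om M ^+ l) ^+ n.+1))
  = M%:R * (B + complex.Re (\sum_(n < K) a n * b n)) :> R.
Proof.
have M0 : (0 < M)%N by [].
have KM (n : 'I_K) : (n.+1 < M)%N by rewrite ltnS mul2n -addnn (leq_trans (ltn_ord n)) // leq_addr.
pose X l := \sum_(n < K) a n * ((om M ^+ l)^*)%C ^+ n.+1 : R[i].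
pose Y l := \sum_(n < K) b n * (om M ^+ l) ^+ n.+1 : R[i].
have sX : \sum_(l < M) X l = 0.
  rewrite exchange_big /= big1 // => n _; rewrite -mulr_sumr.
  have := @sum_om_conj R M 0 n.+1 M0 M0 (KM n).
  by under eq_bigr do rewrite expr0 mul1r; move=> ->; rewrite mulr0.
have sY : \sum_(l < M) Y l = 0.
  rewrite exchange_big /= big1 // => n _; rewrite -mulr_sumr.
  have := @sum_om_conj R M n.+1 0 M0 (KM n) M0.
  by under eq_bigr do rewrite expr0 mulr1; move=> ->; rewrite mulr0.
have sXY : \sum_(l < M) X l * Y l = M%:R * \sum_(n < K) a n * b n.
  transitivity (\sum_(n < K) \sum_(k < K) \sum_(l < M)
      (a n * b k) * ((om M ^+ l) ^+ k.+1 * ((om M ^+ l)^*)%C ^+ n.+1)).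
    under [RHS]eq_bigr do rewrite exchange_big /=.
    rewrite [RHS]exchange_big /=; apply: eq_bigr => l _.
    rewrite /X mulr_suml; apply: eq_bigr => n _; rewrite /Y mulr_sumr.
    by apply: eq_bigr => k _; ring.
  rewrite mulr_sumr; apply: eq_bigr => n _.
  under eq_bigr => k _ do rewrite -mulr_sumr (sum_om_conj M0 (KM k) (KM n)) eqSS.
  rewrite (bigD1 n) //= eqxx [X in _ + X]big1 ?addr0 1?mulrC // => k kn.
  by rewrite val_eqE (negPf kn) mulr0.
have sXYc : \sum_(l < M) X l * ((Y l)^*)%C = 0.
  transitivity (\sum_(n < K) \sum_(k < K) \sum_(l < M)
      (a n * ((b k)^*)%C) * ((om M ^+ l) ^+ 0 * ((om M ^+ l)^*)%C ^+ (n.+1 + k.+1))).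
    under [RHS]eq_bigr do rewrite exchange_big /=.
    rewrite [RHS]exchange_big /=; apply: eq_bigr => l _.
    rewrite /X mulr_suml; apply: eq_bigr => n _; rewrite /Y rmorph_sum mulr_sumr.
    by apply: eq_bigr => k _; rewrite !rmorphM !rmorphXn exprD expr0 /=; ring.
  rewrite big1 // => n _; rewrite big1 // => k _.
  rewrite -mulr_sumr (@sum_om_conj R M 0) ?mulr0 //.
  by rewrite addSn addnS /M ltnS mul2n -addnn -addSn -addnS leq_add.
transitivity (\sum_(l < M) (B + complex.Re (Y l) + 2 * B * complex.Re (X l)
    + (complex.Re (X l * Y l) + complex.Re (X l * ((Y l)^*)%C)))).
  by apply: eq_bigr => l _; rewrite -ReM2 -/(X l) -/(Y l); ring.
rewrite !big_split /= -mulr_sumr -!Re_sum sX sY sXY sXYc /= !addr0 mulr0 addr0.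
rewrite sumr_const card_ord mulrDr; congr (_ + _); first by rewrite mulr_natl.
have -> : (M%:R : R[i]) = (M%:R : R)%:C%C by rewrite rmorph_nat.
by rewrite Re_realM.
Qed.

End DiscreteMean.

(** * Poisson kernels and Herglotz's formula *)

Section LogSeries.
Context {R : realType}.
Implicit Types (x : R[i]) (t u : R).

Lemma normc1B_gt0 x : normc x < 1 -> 0 < normc (1 - x).
Proof.
move=> x1; apply: lt_le_trans (normcBge _ _).
by rewrite Normc.normc1 subr_gt0.
Qed.

Lemma is_derive_ln_normc x u : normc (u%:C%C * x) < 1 ->
  is_derive u (1 : R) (fun u => ln (normc (1 - u%:C%C * x)))
    (complex.Re (- x / (1 - u%:C%C * x))).
Proof.
move=> ux; have n0 := normc1B_gt0 ux.
pose D (v : R) := (1 - v * complex.Re x) ^+ 2 + (v * complex.Im x) ^+ 2.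
have DE v : D v = normc (1 - v%:C%C * x) ^+ 2.
  by rewrite sqr_normcE /D; case: (x) => p q /=; ring.
have -> : (fun u => ln (normc (1 - u%:C%C * x))) = (fun u => 2^-1 * ln (D u)).
  (* The identity is needed at every [v]; where [1 - v x] vanishes both sides are 0 because
     [ln 0 = 0]. *)
  apply/funext => v; rewrite DE; have [->|v0] := eqVneq (normc (1 - v%:C%C * x)) 0.
    by rewrite expr0n /= ln0 // mulr0.
  by rewrite lnXn ?lt0r ?v0 ?normc_ge0 // mulr2n; field.
have D0 : 0 < D u by rewrite DE exprn_gt0.
have dD : is_derive u (1 : R) D (- 2 * (complex.Re x) * (1 - u * complex.Re x)
    + 2 * (complex.Im x) ^+ 2 * u).
  apply: is_derive_eq; rewrite /GRing.scale /=.
  ring.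
have dl := is_derive1_ln D0.
have : is_derive u (1 : R) (fun u => 2^-1 * ln (D u)) (2^-1 * ((- 2 * (complex.Re x) * (1 - u * complex.Re x)
    + 2 * (complex.Im x) ^+ 2 * u) * (D u)^-1)).
  apply: is_deriveZ.
  have := @is_derive1_comp R (@ln R) D u _ _ dl dD.
  by move/is_derive_eq; apply; rewrite mulrC.
move/is_derive_eq; apply.
rewrite Re_divE -DE.
have : D u != 0 by rewrite gt_eqF.
move: (D u) => d d0; case: (x) => p q /=; field; exact: d0.
Qed.


Lemma is_derive_logsum x K u : is_derive u (1 : R)
  (fun v => \sum_(n < K) complex.Re (x ^+ n.+1) * v ^+ n.+1 / n.+1%:R)
  (\sum_(n < K) complex.Re (x ^+ n.+1) * u ^+ n).
Proof.
elim: K => [|K IH].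
  rewrite big_ord0; under eq_fun do rewrite big_ord0; exact: is_derive_cst.
rewrite big_ord_recr /=; under eq_fun do rewrite big_ord_recr /=.
apply: is_deriveD.
have -> : (fun v : R => complex.Re (x ^+ K.+1) * v ^+ K.+1 / K.+1%:R)
    = (fun v : R => (complex.Re (x ^+ K.+1) / K.+1%:R) * v ^+ K.+1).
  by apply/funext => v; rewrite mulrAC.
have h : is_derive u (1 : R) (fun v : R => v ^+ K.+1) (K.+1%:R * u ^+ K).
  have := is_derive_poly ('X^(K.+1) : {poly R}) u.
  have -> : horner ('X^(K.+1) : {poly R}) = fun v => v ^+ K.+1.
    by apply/funext => v; rewrite hornerXn.
  by rewrite derivXn hornerMn hornerXn mulr_natl.
have := is_deriveZ (complex.Re (x ^+ K.+1) / K.+1%:R) h.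
move/is_derive_eq; apply; rewrite /GRing.scale /=.
by rewrite mulrA divfK // pnatr_eq0.
Qed.

Lemma realCX t n : (t%:C%C) ^+ n = (t ^+ n)%:C%C.
Proof. by rewrite rmorphXn. Qed.

Lemma geom_norm_le x (r : R) K : normc x <= r -> r < 1 ->
  normc (x ^+ K / (1 - x)) <= r ^+ K / (1 - r).
Proof.
move=> xr r1; have x1 := le_lt_trans xr r1.
rewrite normc_div normcXn ler_pM ?exprn_ge0 ?invr_ge0 ?lerXn2r ?nnegrE //.
  exact: le_trans xr.
rewrite lef_pV2 ?posrE ?subr_gt0 ?normc1B_gt0 //.
by apply: le_trans (normcBge _ _); rewrite Normc.normc1 lerB.
Qed.

(** Mean value theorem on [[0, 1]] for [ln |1 - v x|] plus the truncated series of [v x]: the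
    derivative in [v] is the tail of a geometric series. No complex logarithm is involved. *)
Lemma ln_normc_series x (r : R) K : normc x <= r -> r < 1 ->
  `|ln (normc (1 - x)) + complex.Re (\sum_(n < K) x ^+ n.+1 / n.+1%:R)|
    <= r ^+ K.+1 / (1 - r).
Proof.
move=> xr r1; have r0 : 0 <= r by apply: le_trans xr.
pose phi (v : R) := ln (normc (1 - v%:C%C * x))
   + \sum_(n < K) complex.Re (x ^+ n.+1) * v ^+ n.+1 / n.+1%:R.
pose dphi (v : R) := complex.Re (- x / (1 - v%:C%C * x))
   + \sum_(n < K) complex.Re (x ^+ n.+1) * v ^+ n.
have small (v : R) : 0 <= v <= 1 -> normc (v%:C%C * x) <= r.
  move=> /andP[v0 v1]; rewrite Normc.normcM normc_real ger0_norm //.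
  by apply: le_trans xr; rewrite ler_piMl.
have dphiP (v : R) : 0 <= v <= 1 -> is_derive v (1 : R) phi (dphi v).
  move=> v01; apply: is_deriveD; last exact: is_derive_logsum.
  by apply: is_derive_ln_normc; apply: le_lt_trans r1; apply: small.
have d1 (v : R) : v \in `]0, 1[ -> is_derive v (1 : R) phi (dphi v).
  by move=> /[!in_itv]/= /andP[v0 v1]; apply: dphiP; rewrite !ltW.
have c1 : {within `[0, 1], continuous phi}.
  apply: derivable_within_continuous => v /[!in_itv]/= v01.
  by have [] := dphiP v v01.
have [c /[!in_itv]/= /andP[c0 c1'] h] := MVT_segment ler01 d1 c1.
have phi1 : phi 1 = ln (normc (1 - x)) + complex.Re (\sum_(n < K) x ^+ n.+1 / n.+1%:R).
  rewrite /phi mul1r Re_sum; congr (_ + _); apply: eq_bigr => n _.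
  rewrite expr1n mulr1 mulrC -Re_realM; congr complex.Re.
  by rewrite mulrC fmorphV rmorph_nat.
have phi0 : phi 0 = 0.
  rewrite /phi mul0r subr0 Normc.normc1 ln1 add0r big1 // => n _.
  by rewrite expr0n /= mulr0 mul0r.
move: h; rewrite phi0 !subr0 mulr1 -phi1 => ->.
have cx := small c; set y := c%:C%C * x in cx.
have {}cx : normc y <= r by apply: cx; rewrite c0 c1'.
have y1 : 1 - y != 0 by rewrite -normc_gt0 normc1B_gt0 // (le_lt_trans cx).
have -> : dphi c = complex.Re (- x * (y ^+ K / (1 - y))).
  have -> : dphi c = complex.Re (- x / (1 - y) + \sum_(n < K) x ^+ n.+1 * (c ^+ n)%:C%C).
    rewrite ReD Re_sum; congr (_ + _); apply: eq_bigr => n _.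
    by rewrite [in RHS]mulrC Re_realM mulrC.
  congr complex.Re.
  have -> : \sum_(n < K) x ^+ n.+1 * (c ^+ n)%:C%C = x * \sum_(n < K) y ^+ n.
    by rewrite mulr_sumr; apply: eq_bigr => n _; rewrite exprMn realCX exprS; ring.
  have h := subrX1 y K.
  have -> : y ^+ K = 1 + (y - 1) * \sum_(n < K) y ^+ n by rewrite -h addrC subrK.
  by field.
apply: le_trans (normc_Re _) _; rewrite Normc.normcM normcNE exprS -mulrA.
apply: ler_pM; rewrite ?normc_ge0 //; exact: (geom_norm_le _ cx r1).
Qed.

End LogSeries.

Section Kernels.
Context {R : realType}.
Implicit Types (v w z : R[i]) (r : R).

(** This is [Re ((1 + v) / (1 - v))], in the form that shows its expansion
    [1 + 2 Re (v + v^2 + ...)]. *)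
Definition poisson v : R := 1 + 2 * complex.Re (v / (1 - v)).

(* [2 Re (v / (1 - v)^2)] is the radial derivative of the Poisson kernel: it is
   positive only where [v] is close to the unit, compared with [1 - |v|]. *)
Definition dpoisson v : R := 2 * complex.Re (v / (1 - v) ^+ 2).

Lemma poisson_series v r K : normc v <= r -> r < 1 ->
  `|poisson v - (1 + 2 * complex.Re (\sum_(n < K) v ^+ n.+1))| <= 2 * (r ^+ K.+1 / (1 - r)).
Proof.
move=> vr r1; have v1 : 1 - v != 0 by rewrite -normc_gt0 normc1B_gt0 // (le_lt_trans vr).
rewrite /poisson opprD addrACA subrr add0r -mulrBr normrM ger0_norm // ler_pM2l // -ReB.
apply: le_trans (normc_Re _) _.
have -> : \sum_(n < K) v ^+ n.+1 = v * \sum_(n < K) v ^+ n.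
  by rewrite mulr_sumr; apply: eq_bigr => n _; rewrite exprS.
have -> : v / (1 - v) - v * \sum_(n < K) v ^+ n = v ^+ K.+1 / (1 - v).
  rewrite exprS.
  have -> : v ^+ K = 1 + (v - 1) * \sum_(n < K) v ^+ n by rewrite -subrX1 addrC subrK.
  by field.
exact: (geom_norm_le _ vr r1).
Qed.

Lemma dpoisson_series v r K : normc v <= r -> r < 1 ->
  `|dpoisson v - 2 * complex.Re (\sum_(n < K) n.+1%:R * v ^+ n.+1)|
     <= 2 * ((2 * K).+1%:R * r ^+ K.+1 / (1 - r) ^+ 2).
Proof.
move=> vr r1; have v0 := normc1B_gt0 (le_lt_trans vr r1).
have v1 : 1 - v != 0 by rewrite -normc_gt0.
have r0 : 0 <= r by apply: le_trans vr.
rewrite /dpoisson -mulrBr normrM ger0_norm // ler_pM2l // -ReB.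
apply: le_trans (normc_Re _) _.
have id : \sum_(n < K) n.+1%:R * v ^+ n.+1 * (1 - v) ^+ 2
    = v - v ^+ K.+1 * (K.+1%:R - K%:R * v).
  elim: K => [|K IH]; first by rewrite big_ord0; ring.
  rewrite big_ord_recr /= IH !exprS -!natr1; ring.
rewrite -mulr_suml in id.
have -> : v / (1 - v) ^+ 2 - \sum_(n < K) n.+1%:R * v ^+ n.+1
   = v ^+ K.+1 * (K.+1%:R - K%:R * v) / (1 - v) ^+ 2.
  apply: (mulIf (expf_neq0 2 v1)); rewrite mulrBl id !divfK ?expf_neq0 //; ring.
rewrite normc_div Normc.normcM !normcXn; apply: ler_pM.
- by rewrite mulr_ge0 ?exprn_ge0 ?normc_ge0.
- by rewrite invr_ge0 exprn_ge0 ?normc_ge0.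
- rewrite mulrC; apply: ler_pM; rewrite ?exprn_ge0 ?normc_ge0 //.
    apply: le_trans (normcB _ _) _; rewrite Normc.normcM !normc_nat mul2n -addnn -addSn natrD.
    rewrite lerD2l -[leRHS]mulr1 ler_wpM2l // (le_trans vr) // ltW //.
  by rewrite lerXn2r ?nnegrE ?normc_ge0.
- rewrite lef_pV2 ?posrE ?exprn_gt0 ?subr_gt0 //.
  rewrite lerXn2r ?nnegrE ?subr_ge0 ?(ltW r1) ?normc_ge0 //.
  by apply: le_trans (normcBge _ _); rewrite Normc.normc1 lerB.
Qed.

Lemma cvg_natX (r : R) : 0 <= r < 1 -> (2 * n).+1%:R * r ^+ n.+1 @[n --> \oo] --> (0 : R).
Proof.
move=> /andP[r0 r1].
pose q := (1 + r) / 2; have q1 : q < 1 by rewrite /q; lra.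
have q0 : 0 < q by rewrite /q; lra.
have rq : r < q by rewrite /q; lra.
(* [q] lies midway between [r] and 1; the gap [q - r] turns the linear factor into a geometric
   bound. *)
have bern n : n%:R * (q - r) * r ^+ n <= q ^+ n.+1.
  elim: n => [|n IH]; first by rewrite !mul0r exprn_ge0 // ltW.
  rewrite [q ^+ n.+2]exprS.
  apply: (@le_trans _ _ (r * q ^+ n.+1 + (q - r) * q ^+ n.+1)); last by rewrite -mulrDl addrC subrK.
  rewrite -natr1 mulrDl mul1r mulrDl; apply: lerD.
    by rewrite exprS mulrCA ler_wpM2l.
  by rewrite ler_wpM2l ?subr_ge0 ?(ltW rq) // lerXn2r ?nnegrE ?(ltW q0) ?(ltW rq).
pose C := 2 / (q - r).
apply: (@squeeze_cvgr _ _ _ _ (fun=> 0) (fun n => C * q ^+ n)).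
- near=> n; rewrite mulr_ge0 ?exprn_ge0 //=.
  rewrite mulrAC ler_pdivlMr ?subr_gt0 //.
  have h : (2 * n).+1%:R <= 2 * n.+1%:R :> R by rewrite -natrM ler_nat mulnS addSn ltnS leq_addl.
  apply: (@le_trans _ _ (2 * (n.+1%:R * (q - r) * r ^+ n.+1))).
    rewrite !mulrA mulrAC ler_wpM2r ?exprn_ge0 // ler_wpM2r // subr_ge0 ltW //.
  rewrite ler_pM2l //; apply: le_trans (bern _) _.
  by rewrite exprS exprS mulrA ler_piMl ?exprn_ge0 ?(ltW q0) // mulr_ile1 // ltW.
- exact: cvg_cst.
- rewrite -[X in _ --> X](mulr0 C); apply: cvgM; first exact: cvg_cst.
  by apply: cvg_expr; rewrite ger0_norm // ltW.
Unshelve. all: by end_near.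
Qed.

End Kernels.

Section Herglotz.
Context {R : realType}.
Variables (J : nat) (w0 : R[i]) (zz : nat -> R[i]) (cc : nat -> R).

(** Taylor coefficients of the kernel [rho]; [eta] bounds the error of truncating [rho] after [K]
    terms. *)
Let coef n : R[i] := w0 ^+ n.+1 - \sum_(j < J) (cc j)%:C%C * (n.+1%:R * zz j ^+ n.+1).
Let S : R := \sum_(j < J) `|cc j|.
Let eta (r : R) K : R := 2 * (r ^+ K.+1 / (1 - r))
  + S * (2 * ((2 * K).+1%:R * r ^+ K.+1 / (1 - r) ^+ 2)).

Let rho (xi : R[i]) : R := poisson (w0 * xi^*%C) - \sum_(j < J) cc j * dpoisson (zz j * xi^*%C).

Let rho_series r K xi : r < 1 -> normc w0 <= r -> (forall j, (j < J)%N -> normc (zz j) <= r) ->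
  normc xi = 1 ->
  `|rho xi - (1 + 2 * complex.Re (\sum_(n < K) coef n * xi^*%C ^+ n.+1))| <= eta r K.
Proof.
move=> r1 w0r zzr xi1.
have nx z : normc (z * xi^*%C) = normc z by rewrite Normc.normcM normc_conj xi1 mulr1.
have -> : complex.Re (\sum_(n < K) coef n * xi^*%C ^+ n.+1) =
  complex.Re (\sum_(n < K) (w0 * xi^*%C) ^+ n.+1)
  - \sum_(j < J) cc j * complex.Re (\sum_(n < K) n.+1%:R * (zz j * xi^*%C) ^+ n.+1).
  under [X in _ = _ - X]eq_bigr do rewrite -Re_realM.
  rewrite -Re_sum -ReB; congr complex.Re.
  under [X in _ = _ - X]eq_bigr do rewrite mulr_sumr.
  rewrite exchange_big /= -sumrB; apply: eq_bigr => n _.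
  rewrite /coef mulrBl exprMn; congr (_ - _).
  by rewrite mulr_suml; apply: eq_bigr => j _; rewrite exprMn; ring.
have -> : forall a b x y : R, a - x - (1 + 2 * (b - y)) = (a - (1 + 2 * b)) - (x - 2 * y).
  by move=> *; ring.
apply: le_trans (ler_normB _ _) _; apply: lerD; first by apply: poisson_series; rewrite ?nx.
rewrite mulr_sumr -sumrB mulr_suml.
apply: le_trans (ler_norm_sum _ _ _) _; apply: ler_sum => j _.
rewrite [2 * (cc j * _)]mulrCA -mulrBr normrM; apply: ler_wpM2l => //.
by apply: dpoisson_series; rewrite ?nx ?zzr.
Qed.

(** Mean of [u = ln A + sum ln |1 - y xi|] against [rho]: the Poisson kernel reproduces [u] at [w0],
    and [dpoisson] reproduces the radial derivative of [u], which at [z] is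
    [- sum Re (y z / (1 - y z))]. *)
Let Lam (A : R) (ys : seq R[i]) := ln A + \sum_(y <- ys) ln (normc (1 - y * w0))
  + \sum_(j < J) cc j * \sum_(y <- ys) complex.Re (y * zz j / (1 - y * zz j)).

Let err (r : R) K d := d * (r ^+ K.+1 / (1 - r)).

(** [u <= E] on the circle and [rho >= 0] has mean 1, so the mean of [u rho] is at most [E]. Kernel
    and logarithms are truncated at order [K] so that a finite mean is exact; [eta] is added to the
    truncated kernel to keep it nonnegative, which adds [eta * ln A] to the mean. *)
Let herglotz_K (ys : seq R[i]) (A E r : R) K (d : R := (size ys)%:R) :
  r < 1 -> normc w0 <= r -> (forall j, (j < J)%N -> normc (zz j) <= r) ->
  (forall y, y \in ys -> normc y <= r) ->
  (forall xi, normc xi = 1 -> ln A + \sum_(y <- ys) ln (normc (1 - y * xi)) <= E) ->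
  (forall xi, normc xi = 1 -> \sum_(j < J) cc j * dpoisson (zz j * xi^*%C) <= poisson (w0 * xi^*%C)) ->
  Lam A ys <= (E + err r K d) * (1 + eta r K) - eta r K * ln A + (1 + S) * err r K d.
Proof.
move=> r1 w0r zzr ysr ysE pos.
have r0 : 0 <= r by apply: le_trans w0r; rewrite normc_ge0.
pose M := (2 * K).+1.
pose b n : R[i] := - \sum_(y <- ys) y ^+ n.+1 / n.+1%:R.
pose u (xi : R[i]) := ln A + complex.Re (\sum_(n < K) b n * xi ^+ n.+1).
pose q (xi : R[i]) := 1 + 2 * complex.Re (\sum_(n < K) coef n * xi^*%C ^+ n.+1).
have reb (c : 'I_K -> R[i]) : complex.Re (\sum_(n < K) b n * c n)
    = - \sum_(y <- ys) complex.Re (\sum_(n < K) y ^+ n.+1 / n.+1%:R * c n).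
  rewrite -Re_sum -ReN; congr complex.Re.
  rewrite exchange_big /= -sumrN; apply: eq_bigr => n _.
  by rewrite /b mulNr mulr_suml.
have uE xi : normc xi = 1 -> u xi <= E + err r K d.
  move=> xi1; apply: (@le_trans _ _ (ln A + \sum_(y <- ys) ln (normc (1 - y * xi)) + err r K d)); last first.
    by rewrite lerD2r ysE.
  rewrite /u -addrA lerD2l reb /err /d -sum1_size natr_sum mulr_suml -big_split -sumrN /=.
  rewrite !big_seq; apply: ler_sum => y yin; rewrite mul1r.
  have := @ln_normc_series R (y * xi) r K; rewrite Normc.normcM xi1 mulr1 => /(_ (ysr _ yin) r1).
  have -> : \sum_(n < K) (y * xi) ^+ n.+1 / n.+1%:R
      = \sum_(n < K) y ^+ n.+1 / n.+1%:R * xi ^+ n.+1.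
    by apply: eq_bigr => n _; rewrite exprMn mulrAC.
  by rewrite ler_norml => /andP[h _]; lra.
have qpos xi : normc xi = 1 -> 0 <= q xi + eta r K.
  move=> xi1; have := rho_series K r1 w0r zzr xi1.
  rewrite ler_norml => /andP[_ h].
  have : 0 <= rho xi by rewrite subr_ge0 pos.
  by rewrite /q; move: h; lra.
have s1 : \sum_(l < M) q (om M ^+ l) * u (om M ^+ l)
   = M%:R * (ln A + complex.Re (\sum_(n < K) coef n * b n)) by exact: mean_mul_trig.
have s2 : \sum_(l < M) u (om M ^+ l) = M%:R * ln A.
  have := @mean_mul_trig R K (ln A) (fun=> 0) b; cbv beta zeta; rewrite -/M.
  have z0 (c : 'I_K -> R[i]) : complex.Re (\sum_(n < K) 0 * c n) = 0.
    by rewrite big1 // => n _; rewrite mul0r.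
  by under eq_bigr => l _ do rewrite z0 mulr0 addr0 mul1r; rewrite z0 addr0.
have s3 : \sum_(l < M) q (om M ^+ l) = M%:R.
  have := @mean_mul_trig R K 1 coef (fun=> 0); cbv beta zeta; rewrite -/M.
  have z0 (c : 'I_K -> R[i]) : complex.Re (\sum_(n < K) 0 * c n) = 0.
    by rewrite big1 // => n _; rewrite mul0r.
  have z0' (c : 'I_K -> R[i]) : complex.Re (\sum_(n < K) c n * 0) = 0.
    by rewrite big1 // => n _; rewrite mulr0.
  by under eq_bigr => l _ do rewrite z0 addr0 mulr1; rewrite z0' addr0 mulr1.
have M0 : 0 < M%:R :> R by rewrite ltr0n.
have main : ln A + complex.Re (\sum_(n < K) coef n * b n) + eta r K * ln A
    <= (E + err r K d) * (1 + eta r K).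
  rewrite -(ler_pM2l M0).
  have -> : M%:R * (ln A + complex.Re (\sum_(n < K) coef n * b n) + eta r K * ln A)
     = \sum_(l < M) (q (om M ^+ l) + eta r K) * u (om M ^+ l).
    under [RHS]eq_bigr do rewrite mulrDl.
    by rewrite [RHS]big_split /= -[X in _ = _ + X]mulr_sumr s1 s2; ring.
  have -> : M%:R * ((E + err r K d) * (1 + eta r K))
     = \sum_(l < M) (q (om M ^+ l) + eta r K) * (E + err r K d).
    rewrite -mulr_suml big_split /= s3 sumr_const card_ord -[eta r K *+ M]mulr_natl; ring.
  apply: ler_sum => l _; apply: ler_wpM2l; first by rewrite qpos ?normc_omX.
  by rewrite uE ?normc_omX.
have cmp : Lam A ys - (ln A + complex.Re (\sum_(n < K) coef n * b n)) <= (1 + S) * err r K d.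
  have -> : \sum_(n < K) coef n * b n = \sum_(n < K) b n * coef n.
    by apply: eq_bigr => n _; rewrite mulrC.
  rewrite reb.
  have -> : \sum_(y <- ys) complex.Re (\sum_(n < K) y ^+ n.+1 / n.+1%:R * coef n)
     = \sum_(y <- ys) complex.Re (\sum_(n < K) (y * w0) ^+ n.+1 / n.+1%:R)
       - \sum_(j < J) cc j * \sum_(y <- ys) complex.Re (\sum_(n < K) (y * zz j) ^+ n.+1).
    under [X in _ = _ - X]eq_bigr do rewrite mulr_sumr.
    rewrite exchange_big -sumrB /=; apply: eq_bigr => y _.
    under [X in _ = _ - X]eq_bigr do rewrite -Re_realM.
    rewrite -Re_sum -ReB; congr complex.Re.
    under [X in _ = _ - X]eq_bigr do rewrite mulr_sumr.
    rewrite exchange_big -sumrB /=; apply: eq_bigr => n _.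
    rewrite /coef mulrBr exprMn; congr (_ - _); first by rewrite mulrAC.
    rewrite mulr_sumr; apply: eq_bigr => j _; rewrite exprMn.
    have : n.+1%:R != 0 :> R[i] by rewrite pnatr_eq0.
    by move=> h; field; rewrite addrC natr1.
  have -> : forall a b c e f : R, a + b + c - (a - (e - f)) = (b + e) + (c - f) by move=> *; ring.
  rewrite [leRHS]mulrDl mul1r; apply: lerD.
    rewrite -big_split /= /err /d -sum1_size natr_sum mulr_suml !big_seq; apply: ler_sum => y yin.
    rewrite mul1r; apply: le_trans (ler_norm _) _; apply: ln_normc_series => //.
    rewrite Normc.normcM; apply: le_trans (ysr _ yin); apply: ler_piMr; rewrite ?normc_ge0 //.
    by apply: le_trans w0r _; exact: ltW.
  rewrite -sumrB /S mulr_suml; apply: ler_sum => j _; rewrite -mulrBr.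
  apply: le_trans (ler_norm _) _; rewrite normrM ler_wpM2l // -sumrB.
  apply: le_trans (ler_norm_sum _ _ _) _.
  rewrite /err /d -sum1_size natr_sum mulr_suml !big_seq; apply: ler_sum => y yin; rewrite mul1r.
  have yz : normc (y * zz j) <= r.
    rewrite Normc.normcM; apply: le_trans (ysr _ yin); apply: ler_piMr; rewrite ?normc_ge0 //.
    by apply: le_trans (zzr _ (ltn_ord j)) _; exact: ltW.
  have := poisson_series K yz r1.
  rewrite /poisson opprD addrACA subrr add0r -mulrBr normrM ger0_norm // ler_pM2l //.
by move: main cmp; lra.
Qed.

(** All [y] lie in a disc of radius [r < 1], so the truncation errors vanish as [K] tends to
    infinity. *)
Lemma herglotz_lt (ys : seq R[i]) (A E r : R) :
  r < 1 -> normc w0 <= r -> (forall j, (j < J)%N -> normc (zz j) <= r) ->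
  (forall y, y \in ys -> normc y <= r) ->
  (forall xi, normc xi = 1 -> ln A + \sum_(y <- ys) ln (normc (1 - y * xi)) <= E) ->
  (forall xi, normc xi = 1 -> \sum_(j < J) cc j * dpoisson (zz j * xi^*%C) <= poisson (w0 * xi^*%C)) ->
  ln A + \sum_(y <- ys) ln (normc (1 - y * w0))
  + \sum_(j < J) cc j * \sum_(y <- ys) complex.Re (y * zz j / (1 - y * zz j)) <= E.
Proof.
move=> r1 w0r zzr ysr ysE pos; rewrite -/(Lam A ys).
have r0 : 0 <= r by apply: le_trans w0r; rewrite normc_ge0.
set d : R := (size ys)%:R.
have cr : r ^+ K.+1 @[K --> \oo] --> (0 : R).
  by rewrite (cvg_shiftS (fun K => r ^+ K)); apply: cvg_expr; rewrite ger0_norm.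
have cerr : err r K d @[K --> \oo] --> (0 : R).
  rewrite -(mulr0 d); apply: cvgM; first exact: cvg_cst.
  by rewrite -(mul0r (1 - r)^-1); apply: cvgM => //; exact: cvg_cst.
have ceta : eta r K @[K --> \oo] --> (0 : R).
  rewrite -[X in _ --> X](addr0 (0:R)); apply: cvgD.
    rewrite -(mulr0 2); apply: cvgM; first exact: cvg_cst.
    by rewrite -(mul0r (1 - r)^-1); apply: cvgM => //; exact: cvg_cst.
  rewrite -(mulr0 S); apply: cvgM; first exact: cvg_cst.
  rewrite -(mulr0 2); apply: cvgM; first exact: cvg_cst.
  rewrite -(mul0r ((1 - r) ^+ 2)^-1); apply: cvgM; last exact: cvg_cst.
  by apply: cvg_natX; rewrite r0.
have cE : (E + err r K d) * (1 + eta r K) - eta r K * ln A + (1 + S) * err r K d @[K --> \oo]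
   --> (E + 0) * (1 + 0) - 0 * ln A + (1 + S) * 0.
  apply: cvgD; last by apply: cvgM => //; exact: cvg_cst.
  apply: cvgB; last by apply: cvgM => //; exact: cvg_cst.
  by apply: cvgM; apply: cvgD => //; exact: cvg_cst.
move: cE; rewrite !addr0 mulr1 mul0r mulr0 subr0 addr0 => cE.
apply: (cvgr_to_ge cE); near=> K.
exact: herglotz_K.
Unshelve. all: by end_near.
Qed.

End Herglotz.

Section HerglotzLimit.
Context {R : realType}.

Lemma cvg_ln_dilation (v : R[i]) : normc v < 1 ->
  ln (normc (1 - t%:C%C * v)) @[t --> (1 : R)^'-] --> ln (normc (1 - v)).
Proof.
move=> v1.
have h : normc ((1 : R)%:C%C * v) < 1 by rewrite mul1r.
have [d _] := is_derive_ln_normc h.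
have : ln (normc (1 - u%:C%C * v)) @[u --> (1 : R)] --> ln (normc (1 - (1 : R)%:C%C * v)).
  exact: (differentiable_continuous (iffLR (derivable1_diffP _ _) d)).
rewrite mul1r => c; exact: cvg_at_left_filter c.
Qed.

Lemma cvg_Re_dilation (v : R[i]) : normc v < 1 ->
  complex.Re (t%:C%C * v / (1 - t%:C%C * v)) @[t --> (1 : R)^'-] --> complex.Re (v / (1 - v)).
Proof.
move=> v1.
pose p := complex.Re v; pose q := complex.Im v.
pose N (t : R) := t * p * (1 - t * p) - t * q * (t * q).
pose D (t : R) := (1 - t * p) * (1 - t * p) + t * q * (t * q).
have E (t : R) : complex.Re (t%:C%C * v / (1 - t%:C%C * v)) = N t / D t.
  rewrite Re_divE sqr_normcE /N /D /p /q; case: (v) => a b /=; congr (_ / _); ring.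
have D1 : D 1 != 0.
  have -> : D 1 = normc (1 - v) ^+ 2.
    by rewrite sqr_normcE /D /p /q; case: (v) => a b /=; ring.
  by rewrite expf_neq0 // gt_eqF // normc1B_gt0.
have -> : complex.Re (v / (1 - v)) = N 1 / D 1 by rewrite -E mul1r.
under eq_fun do rewrite E.
have cx (c : R) : t * c @[t --> (1 : R)^'-] --> (1 : R) * c.
  by apply: cvgM; [exact: cvg_at_left_filter cvg_id | exact: cvg_cst].
have c1 (c : R) : 1 - t * c @[t --> (1 : R)^'-] --> 1 - (1 : R) * c.
  by apply: cvgB => //; exact: cvg_cst.
apply: cvgM; first by apply: cvgB; apply: cvgM.
by apply: cvgV => //; apply: cvgD; apply: cvgM.
Qed.

Lemma sum_cvg (I : Type) (s : seq I) (T : Type) (F : set_system T) (FF : Filter F)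
  (f : I -> T -> R) (l : I -> R) :
  (forall i, f i x @[x --> F] --> l i) ->
  (\sum_(i <- s) f i x) @[x --> F] --> \sum_(i <- s) l i.
Proof. by move=> h; apply: cvg_big => // x; exact: add_continuous. Qed.

(** Points [x] on the circle give [u] logarithmic singularities there. They are replaced by [t x]
    with [t < 1], which amounts to dilating the disc, and then [t] tends to 1. *)
Lemma herglotz (J : nat) (w0 : R[i]) (zz : nat -> R[i]) (cc : nat -> R)
    (xs : seq R[i]) (A E : R) :
  normc w0 < 1 -> (forall j, (j < J)%N -> normc (zz j) < 1) ->
  (forall x, x \in xs -> normc x <= 1) ->
  (forall w, normc w < 1 -> ln A + \sum_(x <- xs) ln (normc (1 - x * w)) <= E) ->
  (forall xi, normc xi = 1 -> \sum_(j < J) cc j * dpoisson (zz j * xi^*%C) <= poisson (w0 * xi^*%C)) ->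
  ln A + \sum_(x <- xs) ln (normc (1 - x * w0))
  + \sum_(j < J) cc j * \sum_(x <- xs) complex.Re (x * zz j / (1 - x * zz j)) <= E.
Proof.
move=> w01 zz1 xs1 xsE pos.
(* For [r0 < t < 1] the single radius [t] bounds [w0], all poles and all points [t x]. *)
pose r0 : R := \big[Num.max/normc w0]_(j < J) normc (zz j).
have r01 : r0 < 1 by apply/bigmax_ltP; split => // j _; apply: zz1.
have w0r : normc w0 <= r0 by apply: bigmax_ge_id.
have zr j : (j < J)%N -> normc (zz j) <= r0.
  by move=> jJ; apply: (@le_bigmax _ _ _ _ (fun j : 'I_J => normc (zz j)) (Ordinal jJ)).
have r00 : 0 <= r0 by apply: le_trans w0r; rewrite normc_ge0.
pose L (t : R) := ln A + \sum_(x <- xs) ln (normc (1 - t%:C%C * x * w0))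
  + \sum_(j < J) cc j * \sum_(x <- xs) complex.Re (t%:C%C * x * zz j / (1 - t%:C%C * x * zz j)).
have LE (t : R) : r0 < t -> t < 1 -> L t <= E.
  move=> rt t1; have t0 : 0 <= t by apply: le_trans (ltW rt).
  have nt : normc t%:C%C = t by rewrite normc_real ger0_norm.
  have -> : L t = ln A + \sum_(y <- [seq t%:C%C * x | x <- xs]) ln (normc (1 - y * w0))
    + \sum_(j < J) cc j * \sum_(y <- [seq t%:C%C * x | x <- xs]) complex.Re (y * zz j / (1 - y * zz j)).
    by rewrite /L big_map; congr (_ + _); apply: eq_bigr => j _; rewrite big_map.
  apply: (@herglotz_lt R J w0 zz cc _ A E t) => //.
  - exact: le_trans w0r (ltW rt).
  - by move=> j /zr h; apply: le_trans h (ltW rt).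
  - move=> y /mapP[x xin ->]; rewrite Normc.normcM nt ler_piMr //; exact: xs1.
  - move=> xi xi1; rewrite big_map.
    have -> : \sum_(x <- xs) ln (normc (1 - t%:C%C * x * xi))
      = \sum_(x <- xs) ln (normc (1 - x * (t%:C%C * xi))).
      by apply: eq_bigr => x _; congr (ln (normc (1 - _))); ring.
    by apply: xsE; rewrite Normc.normcM nt xi1 mulr1.
have xsw w : normc w < 1 -> forall x, x \in xs -> normc (x * w) < 1.
  move=> w1 x /xs1 h; rewrite Normc.normcM; apply: le_lt_trans w1.
  by rewrite ler_piMl ?normc_ge0.
have cL : L t @[t --> (1 : R)^'-] --> ln A + \sum_(x <- xs) ln (normc (1 - x * w0))
  + \sum_(j < J) cc j * \sum_(x <- xs) complex.Re (x * zz j / (1 - x * zz j)).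
  apply: cvgD.
    apply: cvgD; first exact: cvg_cst.
    rewrite big_seq; under eq_fun do rewrite big_seq.
    apply: cvg_big => [x|x xin]; first exact: add_continuous.
    under eq_fun do rewrite -mulrA.
    by apply: cvg_ln_dilation; apply: xsw.
  apply: sum_cvg => j; apply: cvgM; first exact: cvg_cst.
  rewrite big_seq; under eq_fun do rewrite big_seq.
  apply: cvg_big => [x|x xin]; first exact: add_continuous.
  under eq_fun => t do rewrite -[t%:C%C * x * zz j]mulrA.
  by apply: cvg_Re_dilation; apply: xsw => //; apply: zz1.
apply: (cvgr_to_le cL); near=> t; apply: LE; near: t.
  exact: nbhs_left_gt.
exact: nbhs_left_lt.
Unshelve. all: by end_near.
Qed.

End HerglotzLimit.

(** * Polynomials with many zeros near 1 on the unit circle *)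

Section PolyOnDisc.
Context {R : realType}.
Implicit Types (p Q : {poly R[i]}) (z w x : R[i]) (B : R).

Lemma poissonE v : normc v < 1 -> poisson v = (1 - normc v ^+ 2) / normc (1 - v) ^+ 2 :> R.
Proof.
move=> v1; have := normc1B_gt0 v1; rewrite /poisson Re_divE => h.
have n0 : normc (1 - v) ^+ 2 != 0 by rewrite expf_neq0 // gt_eqF.
apply: (mulIf n0); rewrite mulrDl -mulrA !divfK // mul1r !sqr_normcE.
by case: (v) => a b /=; ring.
Qed.

Lemma poisson_ge0 v : normc v < 1 -> 0 <= poisson v :> R.
Proof.
move=> v1; rewrite poissonE // divr_ge0 ?exprn_ge0 ?normc_ge0 //.
by rewrite subr_ge0 expr_le1 ?normc_ge0 // ltW.
Qed.

Lemma Re_poisson v : complex.Re (v / (1 - v)) = (poisson v - 1) / 2 :> R.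
Proof. by rewrite /poisson; move: (complex.Re _) => u; field. Qed.

(** Cauchy's estimate, with a mean over [size p] roots of unity in place of an integral. *)
Lemma coef_le_max p B n : (forall xi, normc xi = 1 -> normc p.[xi] <= B) -> normc p`_n <= B.
Proof.
move=> pB; have [np|np] := leqP (size p) n.
  rewrite nth_default // Normc.normc0; apply: le_trans (pB 1 _); rewrite ?normc_ge0 //.
  exact: Normc.normc1.
set M := size p; have M0 : (0 < M)%N by apply: leq_ltn_trans np.
have h : \sum_(l < M) p.[om M ^+ l] * ((om M ^+ l)^*)%C ^+ n = M%:R * p`_n.
  under eq_bigr do rewrite horner_coef mulr_suml.
  rewrite exchange_big /= (bigD1 (Ordinal np)) //= [X in _ + X]big1 ?addr0.
    under eq_bigr do rewrite -mulrA.
    by rewrite -mulr_sumr sum_om_conj // eqxx mulrC.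
  move=> i ni; under eq_bigr do rewrite -mulrA.
  rewrite -mulr_sumr sum_om_conj //; move: ni; rewrite -val_eqE /= => /negPf ->.
  by rewrite mulr0.
have : normc (M%:R * p`_n) <= M%:R * B.
  rewrite -h; apply: le_trans (normc_sum _ _ _) _.
  rewrite mulr_natl -[in leRHS](card_ord M) -sumr_const; apply: ler_sum => l _.
  rewrite Normc.normcM normcXn normc_conj normc_omX expr1n mulr1.
  by apply: pB; rewrite normc_omX.
by rewrite Normc.normcM normc_nat ler_pM2l // ltr0n.
Qed.

(** A weak maximum principle from Cauchy's estimates; the extra factor [size p] is subexponential
    and harmless later. *)
Lemma horner_le_max p B w : (forall xi, normc xi = 1 -> normc p.[xi] <= B) -> normc w <= 1 ->
  normc p.[w] <= (size p)%:R * B.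
Proof.
move=> pB w1; rewrite horner_coef; apply: le_trans (normc_sum _ _ _) _.
rewrite mulr_natl -[in leRHS](card_ord (size p)) -sumr_const; apply: ler_sum => l _.
rewrite Normc.normcM normcXn -[leRHS]mulr1; apply: ler_pM; rewrite ?normc_ge0 ?exprn_ge0 ?normc_ge0 //.
  exact: coef_le_max.
by rewrite exprn_ile1 ?normc_ge0.
Qed.

Lemma sum_subseq_le (T : eqType) (s X : seq T) (g : T -> R) : uniq X -> {subset X <= s} ->
  (forall y, y \in s -> 0 <= g y) -> \sum_(y <- X) g y <= \sum_(y <- s) g y.
Proof.
elim: X s => [|z X IH] s /=; first by move=> _ _ g0; rewrite big_nil big_seq sumr_ge0.
move=> /andP[zX uX] sub g0; have zs : z \in s by apply: sub; rewrite inE eqxx.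
rewrite big_cons (perm_big _ (perm_to_rem zs)) /= big_cons lerD2l; apply: IH => //.
- move=> y yX; have : y \in z :: rem z s by rewrite -(perm_mem (perm_to_rem zs)) sub // inE yX orbT.
  by rewrite inE => /predU1P[yz|//]; rewrite yz (negPf zX) in yX.
- by move=> y /mem_rem; exact: g0.
Qed.

(* The zeros inside the disc are reflected in the circle. *)
Lemma factor_reflected Q B (X : seq R[i]) : Q != 0 -> uniq X ->
    (forall z, z \in X -> normc z = 1 /\ root Q z) ->
    (forall xi, normc xi = 1 -> normc Q.[xi] <= B) ->
  exists (A : R) (xs : seq R[i]),
    [/\ 0 < A, (size xs).+1 = size Q, forall x, x \in xs -> normc x <= 1 &
     [/\ forall xi, normc xi = 1 -> normc Q.[xi] = A * \prod_(x <- xs) normc (1 - x * xi),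
      forall w, normc w <= 1 -> A * \prod_(x <- xs) normc (1 - x * w) <= (size Q)%:R * B &
      forall g : R[i] -> R, (forall x, x \in xs -> 0 <= g x) ->
        \sum_(z <- X) g z^*%C <= \sum_(x <- xs) g x]].
Proof.
move=> Q0 uX XQ QB.
have [rs Qrs] := closed_field_poly_normal Q.
have lQ : lead_coef Q != 0 by rewrite lead_coef_eq0.
pose h z := if normc z < 1 then z^*%C else z^-1.
pose c z : R := if normc z < 1 then 1 else normc z.
have h1 z : normc (h z) <= 1.
  rewrite /h; case: ltP => [z1|z1]; first by rewrite normc_conj ltW.
  by rewrite Normc.normcV invf_le1 //; apply: lt_le_trans z1; exact: ltr01.
have c0 z : 0 < c z.
  by rewrite /c; case: (ltP (normc z) 1) => z1; [exact: ltr01 | apply: lt_le_trans z1; exact: ltr01].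
have hc z xi : normc xi = 1 -> normc (xi - z) = c z * normc (1 - h z * xi).
  move=> xi1; rewrite /c /h; case: ltP => z1.
    rewrite mul1r -[LHS]normc_conj conjCB (conj_unit xi1).
    have xi0 : xi != 0 by rewrite -normc_gt0 xi1.
    have -> : 1 - z^*%C * xi = xi * (xi^-1 - z^*%C) by rewrite mulrBr divff // mulrC.
    by rewrite Normc.normcM xi1 mul1r.
  have z0 : z != 0 by rewrite -normc_gt0; apply: lt_le_trans z1; exact: ltr01.
  by rewrite -Normc.normcM mulrBr mulr1 mulrA divff // mul1r normc_distC.
pose A := normc (lead_coef Q) * \prod_(z <- rs) c z.
have A0 : 0 < A.
  by rewrite mulr_gt0 ?normc_gt0 // prodr_gt0.
have sQ : (size rs).+1 = size Q.
  by rewrite Qrs size_scale // size_prod_XsubC.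
have QA xi : normc xi = 1 -> normc Q.[xi] = A * \prod_(x <- map h rs) normc (1 - x * xi).
  move=> xi1; rewrite {1}Qrs hornerZ horner_prod Normc.normcM normc_prod /A -mulrA; congr (_ * _).
  rewrite big_map -big_split /=; apply: eq_bigr => z _.
  by rewrite hornerXsubC hc.
exists A, (map h rs); split => //.
- by rewrite size_map.
- by move=> x /mapP[z _ ->].
split=> //.
- move=> w w1.
  (* The reflected polynomial agrees with [Q] in modulus on the circle but not inside, so the bound
     inside is taken from its own values on the circle. *)
  pose Qt : {poly R[i]} := A%:C%C *: \prod_(x <- map h rs) (1 - x *: 'X).
  have Qtw v : normc Qt.[v] = A * \prod_(x <- map h rs) normc (1 - x * v).
    rewrite hornerZ horner_prod Normc.normcM normc_real ger0_norm ?(ltW A0) // normc_prod.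
    by congr (_ * _); apply: eq_bigr => x _; rewrite !hornerE.
  rewrite -Qtw; have : normc Qt.[w] <= (size Qt)%:R * B.
    by apply: horner_le_max => // xi xi1; rewrite Qtw -QA // QB.
  move=> hw; apply: le_trans hw _; apply: ler_wpM2r.
    by apply: le_trans (QB 1 _); rewrite ?normc_ge0 // Normc.normc1.
  rewrite ler_nat -sQ /Qt; apply: leq_trans (size_scale_leq _ _) _.
  elim: (rs) => [|z s IH] /=; first by rewrite big_nil size_poly1.
  rewrite big_cons; apply: leq_trans (size_polyMleq _ _) _.
  have : (size (1 - h z *: 'X : {poly R[i]})%R <= 2)%N.
    apply: leq_trans (size_polyD _ _) _; rewrite size_poly1 size_polyN geq_max /=.
    by apply: leq_trans (size_scale_leq _ _) _; rewrite size_polyX.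
  by move=> h2; rewrite -subn1 leq_subLR; apply: leq_trans (leq_add h2 IH) _; rewrite add2n.
- move=> g g0; rewrite big_map.
  have -> : \sum_(z <- X) g z^*%C = \sum_(z <- X) g (h z).
    rewrite !big_seq; apply: eq_bigr => z /XQ[z1 _].
    by rewrite /h z1 ltxx conj_unit.
  apply: sum_subseq_le => //.
  - move=> z /XQ[_]; rewrite Qrs rootZ // root_prod_XsubC //.
  - by move=> z zr; apply: g0; apply: map_f.
Qed.

End PolyOnDisc.

Section PolyAtOne.
Context {R : realType}.

Lemma ln_prod (I : eqType) (s : seq I) (f : I -> R) : (forall i, i \in s -> 0 < f i) ->
  ln (\prod_(i <- s) f i) = \sum_(i <- s) ln (f i).
Proof.
elim: s => [|i s IH] h; first by rewrite !big_nil ln1.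
rewrite !big_cons lnM ?posrE ?h ?inE ?eqxx //.
  by rewrite IH // => j js; apply: h; rewrite inE js orbT.
by rewrite big_seq prodr_gt0 // => j js; apply: h; rewrite inE js orbT.
Qed.

(** The two sides differ by [(1 - w) (1 - w |x|^2)]. This is the price, per zero, of passing from
    the point 1 to the point [w] inside the disc, where Herglotz's formula applies. *)
Lemma normc1B_dilation (x : R[i]) (w : R) : 0 < w < 1 -> normc x <= 1 ->
  normc (1 - x) ^+ 2 * w <= normc (1 - x * w%:C%C) ^+ 2.
Proof.
move=> /andP[w0 w1] x1; rewrite !sqr_normcE.
have : normc x ^+ 2 <= 1 by rewrite expr_le1 ?normc_ge0.
rewrite sqr_normcE; case: (x) => a b /=; rewrite !mulr0 subr0 add0r => h.
have : 0 <= (1 - w) * (1 - w * (a ^+ 2 + b ^+ 2)).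
  rewrite mulr_ge0 ?subr_ge0 ?(ltW w1) // mulr_ile1 ?(ltW w0) ?(ltW w1) //.
  by rewrite addr_ge0 ?sqr_ge0.
by rewrite -subr_ge0; congr (0 <= _); ring.
Qed.

(** Herglotz's formula at [w] for the reflected polynomial. As
    [Re (v / (1 - v)) = (poisson v - 1) / 2], a pole [zz j] yields a gain as soon as the Poisson sum
    over the zeros exceeds [d]; zeros outside [X] may be dropped because [poisson] is nonnegative in
    the disc. Going from [w] to 1 costs [d / 2 * ln w^-1]. *)
Lemma ln_poly1_le (Q : {poly R[i]}) (d : nat) (B : R) (X : seq R[i]) (J : nat) (w : R)
    (zz : nat -> R[i]) (cc : nat -> R) :
  Q.[1] != 0 -> (size Q <= d.+1)%N -> uniq X ->
  (forall z, z \in X -> normc z = 1 /\ root Q z) ->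
  (forall xi, normc xi = 1 -> normc Q.[xi] <= B) ->
  0 < w < 1 -> (forall j, (j < J)%N -> normc (zz j) < 1) ->
  (forall j, (j < J)%N -> 0 <= cc j) ->
  (forall xi, normc xi = 1 ->
     \sum_(j < J) cc j * dpoisson (zz j * xi^*%C) <= poisson (w%:C%C * xi^*%C)) ->
  ln (normc Q.[1]) <= ln (d.+1%:R * B) + d%:R / 2 * ln w^-1
     + 2^-1 * \sum_(j < J) cc j * (d%:R - \sum_(z <- X) poisson (z^*%C * zz j)).
Proof.
move=> Q1 sQ uX XQ QB w01 zz1 cc0 pos; have /andP[w0 w1] := w01.
have Q0 : Q != 0 by apply: contraNneq Q1 => ->; rewrite horner0.
have n1 : normc (1 : R[i]) = 1 by exact: Normc.normc1.
have B0 : 0 < B by apply: lt_le_trans (QB 1 n1); rewrite normc_gt0.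
have [A [xs [A0 sxs xs1 [QA bd cnt]]]] := factor_reflected Q0 uX XQ QB.
have sxd : (size xs <= d)%N by rewrite -ltnS sxs.
have w01' : normc w%:C%C < 1 by rewrite normc_real gtr0_norm.
have xw v : normc v < 1 -> forall x, x \in xs -> normc (x * v) < 1.
  move=> v1 x /xs1 h; rewrite Normc.normcM; apply: le_lt_trans v1.
  by rewrite ler_piMl ?normc_ge0.
pose E := ln (d.+1%:R * B).
have H := @herglotz R J w%:C%C zz cc xs A E w01' zz1 xs1.
have {}H : ln A + \sum_(x <- xs) ln (normc (1 - x * w%:C%C)) +
      \sum_(j < J) cc j * \sum_(x <- xs) complex.Re (x * zz j / (1 - x * zz j)) <= E.
  apply: H => // v v1.
  rewrite -ln_prod => [|x xin]; last by rewrite normc1B_gt0 // xw.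
  have p0 : 0 < \prod_(x <- xs) normc (1 - x * v).
    by rewrite big_seq prodr_gt0 // => x xin; rewrite normc1B_gt0 // xw.
  rewrite -lnM ?posrE // ler_ln ?posrE ?mulr_gt0 // ?ltr0n //.
  by apply: le_trans (bd v (ltW v1)) _; rewrite ler_pM2r // ler_nat.
have p1 : \prod_(x <- xs) normc (1 - x * 1) != 0.
  by apply: contraNneq Q1 => h; rewrite -[_ == 0]negbK -normc_gt0 -leNgt QA // h mulr0 lexx.
have n0 x : x \in xs -> 0 < normc (1 - x).
  move=> xin; rewrite normc_gt0; apply: contraNneq p1 => h.
  by rewrite (big_rem x xin) /= mulr1 h Normc.normc0 mul0r.
have -> : ln (normc Q.[1]) = ln A + \sum_(x <- xs) ln (normc (1 - x)).
  rewrite QA // lnM ?posrE //.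
    by rewrite ln_prod => [|x xin]; [under eq_bigr do rewrite mulr1 | rewrite mulr1 n0].
  by rewrite big_seq prodr_gt0 // => x xin; rewrite mulr1 n0.
have st1 : \sum_(x <- xs) ln (normc (1 - x))
    <= \sum_(x <- xs) ln (normc (1 - x * w%:C%C)) + d%:R / 2 * ln w^-1.
  have lw : 0 <= ln w^-1 by rewrite ln_ge0 // invf_ge1 // ltW.
  apply: (@le_trans _ _ (\sum_(x <- xs) (ln (normc (1 - x * w%:C%C)) + ln w^-1 / 2))).
    rewrite !big_seq; apply: ler_sum => x xin.
    have a0 := n0 x xin; have b0 := normc1B_gt0 (xw _ w01' x xin).
    have := normc1B_dilation w01 (xs1 x xin).
    rewrite -ler_ln ?posrE ?mulr_gt0 ?exprn_gt0 // lnM ?posrE ?exprn_gt0 // !lnXn // lnV ?posrE //.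
    move=> h; have {}h : 2 * ln (normc (1 - x)) + ln w <= 2 * ln (normc (1 - x * w%:C%C)).
      by rewrite !mulr_natl.
    by lra.
  rewrite big_split /= lerD2l.
  rewrite big_const_seq count_predT iter_addr_0.
  have -> : ln w^-1 / 2 *+ size xs = (size xs)%:R / 2 * ln w^-1.
    by rewrite -[LHS]mulr_natr; ring.
  by rewrite ler_wpM2r // ler_wpM2r // ler_nat.
have st2 : - (\sum_(j < J) cc j * \sum_(x <- xs) complex.Re (x * zz j / (1 - x * zz j)))
   <= 2^-1 * \sum_(j < J) cc j * (d%:R - \sum_(z <- X) poisson (z^*%C * zz j)).
  rewrite -sumrN mulr_sumr; apply: ler_sum => j _.
  rewrite mulrCA -mulrN ler_wpM2l ?cc0 //.
  under eq_bigr do rewrite Re_poisson.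
  rewrite -mulr_suml sumrB big_const_seq count_predT iter_addr_0.
  have c1 : \sum_(z <- X) poisson (z^*%C * zz j) <= \sum_(x <- xs) poisson (x * zz j).
    apply: (cnt (fun x => poisson (x * zz j))) => x xin.
    by rewrite poisson_ge0 // xw // zz1.
  have c2 : (size xs)%:R <= d%:R :> R by rewrite ler_nat.
  move: c1 c2; rewrite -[1 *+ _]/((size xs)%:R); lra.
move: H st1 st2; rewrite -/E; lra.
Qed.

End PolyAtOne.

Section KernelDomination.
Context {R : realType}.
Implicit Types (v xi u : R[i]).

(** Denominator-free form, from which the sign of [dpoisson] can be read off. *)
Lemma dpoissonE v : normc (1 - v) ^+ 4 * dpoisson v =
  2 * (complex.Re v * (1 + normc v ^+ 2) - 2 * normc v ^+ 2) :> R.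
Proof.
rewrite /dpoisson; have [v1|v1] := eqVneq v 1.
  rewrite v1 subrr Normc.normc0 Normc.normc1 expr0n mul0r /=; ring.
have n0 : normc (1 - v) != 0 by rewrite gt_eqF // normc_gt0 subr_eq0 eq_sym.
rewrite Re_divE normcXn -exprM (_ : (2 * 2)%N = 4) //; set num := complex.Re v * _ + _.
have -> : normc (1 - v) ^+ 4 * (2 * (num / normc (1 - v) ^+ 4)) = 2 * num by field.
rewrite /num sqr_normcE; case: (v) => a b /=; ring.
Qed.

(** Positivity at [r u] means [Re u > 2 r / (1 + r^2)], whence [|1 - u|^2 = 2 - 2 Re u < 2 (1 - r)^2
    / (1 + r^2)]. *)
Lemma dpoisson_gt0 (r : R) u : 0 <= r < 1 -> normc u = 1 ->
  0 < dpoisson (r%:C%C * u) -> normc (1 - u) < 2 * (1 - r).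
Proof.
move=> /andP[r0 r1] u1 h.
have : 0 < normc (1 - r%:C%C * u) ^+ 4 * dpoisson (r%:C%C * u).
  rewrite mulr_gt0 // exprn_gt0 // normc1B_gt0 //.
  by rewrite Normc.normcM u1 mulr1 normc_real ger0_norm.
rewrite dpoissonE Normc.normcM u1 mulr1 normc_real (ger0_norm r0) Re_realM.
rewrite pmulr_rgt0 // => h2.
have r0' : 0 < r.
  by rewrite lt0r r0 andbT; apply: contraTneq h2 => ->; rewrite mul0r expr0n /= mul0r mulr0 subr0 ltxx.
have {}h2 : 0 < complex.Re u * (1 + r ^+ 2) - 2 * r.
  by rewrite -(pmulr_rgt0 _ r0'); move: h2; congr (0 < _); ring.
have e1 : normc (1 - u) ^+ 2 = 2 - 2 * complex.Re u.
  have := sqr_normcE u; rewrite u1 expr1n sqr_normcE; case: (u) => a b /= h3; transitivity (1 - 2 * a + (a ^+ 2 + b ^+ 2)); [ring | rewrite -h3; ring].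
rewrite -(@ltr_pXn2r _ 2) ?nnegrE ?normc_ge0 ?mulr_ge0 ?subr_ge0 ?(ltW r1) // e1.
move: (complex.Re u) h2 => c h2.
have p : 0 < 1 + r ^+ 2 by rewrite ltr_pwDl // sqr_ge0.
rewrite -(ltr_pM2r p).
have : 0 <= (1 - r) ^+ 2 * (1 + 2 * r ^+ 2) by rewrite mulr_ge0 ?sqr_ge0 // addr_ge0 ?mulr_ge0 ?sqr_ge0.
have -> : (2 * (1 - r)) ^+ 2 * (1 + r ^+ 2) =
  2 * ((1 - r) ^+ 2 * (1 + 2 * r ^+ 2)) + 2 * (1 + r ^+ 2) - 4 * r by ring.
move: ((1 - r) ^+ 2 * (1 + 2 * r ^+ 2)) => q q0.
have -> : (2 - 2 * c) * (1 + r ^+ 2) = 2 * (1 + r ^+ 2) - 2 * (c * (1 + r ^+ 2)) by ring.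
by move: h2 q0; move: (c * (1 + r ^+ 2)) (1 + r ^+ 2) => *; lra.
Qed.

Lemma dpoisson_le (r : R) v : r < 1 -> normc v <= r -> dpoisson v <= 2 / (1 - r) ^+ 2.
Proof.
move=> r1 vr; rewrite /dpoisson ler_pM2l //; apply: le_trans (Re_le_normc _) _.
rewrite normc_div normcXn -[leRHS]mul1r; apply: ler_pM; rewrite ?normc_ge0 ?invr_ge0 ?exprn_ge0 ?normc_ge0 //.
  by apply: le_trans vr _; exact: ltW.
rewrite lef_pV2 ?posrE ?exprn_gt0 ?subr_gt0 ?normc1B_gt0 // ?(le_lt_trans vr) //.
rewrite lerXn2r ?nnegrE ?subr_ge0 ?normc_ge0 ?(ltW r1) //.
by apply: le_trans (normcBge _ _); rewrite Normc.normc1 lerB.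
Qed.

(* The positive parts of the kernels [dpoisson] have disjoint supports, so only
   one of them has to be compared with the Poisson kernel. *)
Lemma dpoisson_dominated (J : nat) (w : R) (eta D cc : nat -> R) (zeta : nat -> R[i]) :
  0 < w < 1 -> (forall j, normc (zeta j) = 1) ->
  (forall j, (j < J)%N -> [/\ 0 < eta j <= 1, 0 < D j, 0 <= cc j,
     normc (zeta j - 1) + 2 * eta j <= D j /\ 1 - w <= D j &
     cc j <= (1 - w) * eta j ^+ 2 / (8 * D j ^+ 2)]) ->
  (forall i j, (i < J)%N -> (j < J)%N -> i != j ->
     2 * (eta i + eta j) <= normc (zeta i - zeta j)) ->
  forall xi, normc xi = 1 ->
   \sum_(j < J) cc j * dpoisson ((1 - eta j)%:C%C * zeta j * xi^*%C) <= poisson (w%:C%C * xi^*%C).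
Proof.
move=> /andP[w0 w1] z1 hj sep xi xi1.
have nw : normc (w%:C%C * xi^*%C) = w.
  by rewrite Normc.normcM normc_conj xi1 mulr1 normc_real gtr0_norm.
have P0 : 0 <= poisson (w%:C%C * xi^*%C) by rewrite poisson_ge0 // nw.
have nu j : normc (zeta j * xi^*%C) = 1 by rewrite Normc.normcM normc_conj xi1 mulr1.
have dist j : normc (xi - zeta j) = normc (1 - zeta j * xi^*%C).
  have -> : xi - zeta j = xi * (1 - zeta j * xi^*%C).
    rewrite mulrBr mulr1 mulrCA mulC_conj xi1 expr1n mulr1 //.
  by rewrite Normc.normcM xi1 mul1r.
have near j : (j < J)%N -> 0 < dpoisson ((1 - eta j)%:C%C * zeta j * xi^*%C) ->
    normc (xi - zeta j) < 2 * eta j.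
  move=> jJ; have [/andP[e0 e1] _ _ _ _] := hj j jJ.
  rewrite -mulrA dist => /dpoisson_gt0 -/(_ _ (nu j)); rewrite opprB addrCA subrr addr0.
  by apply; rewrite subr_ge0 e1 ltrBlDr ltrDl.
(* Either all kernels are nonpositive at [xi], or one of them, [j0], is positive there; the
   separation of the [zeta j] then makes the others nonpositive. *)
have [[j0 h0]|h0] := pselect (exists j : 'I_J, 0 < dpoisson ((1 - eta j)%:C%C * zeta j * xi^*%C)); last first.
  apply: le_trans P0; apply: sumr_le0 => j _; have [_ _ c0 _ _] := hj j (ltn_ord j).
  rewrite mulr_ge0_le0 // leNgt; apply/negP => h; apply: h0; by exists j.
have n0 := near _ (ltn_ord j0) h0.
rewrite (bigD1 j0) //=; have [/andP[e0 e1] D0 c0 [d1 d2] cle] := hj _ (ltn_ord j0).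
have rest : \sum_(i < J | i != j0) cc i * dpoisson ((1 - eta i)%:C%C * zeta i * xi^*%C) <= 0.
  apply: sumr_le0 => i ij; have [_ _ ci _ _] := hj i (ltn_ord i).
  rewrite mulr_ge0_le0 // leNgt; apply/negP => /(near _ (ltn_ord i)) ni.
  have := sep i j0 (ltn_ord i) (ltn_ord j0) ij; rewrite leNgt => /negP; apply.
  have -> : zeta i - zeta j0 = (xi - zeta j0) - (xi - zeta i) by ring.
  by apply: le_lt_trans (normcB _ _) _; lra.
apply: (@le_trans _ _ (cc j0 * dpoisson ((1 - eta j0)%:C%C * zeta j0 * xi^*%C))); first lra.
apply: (@le_trans _ _ (cc j0 * (2 / eta j0 ^+ 2))).
  apply: ler_wpM2l => //.
  have -> : eta j0 = 1 - (1 - eta j0) by ring.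
  apply: dpoisson_le; first by rewrite ltrBlDr ltrDl.
  by rewrite -mulrA Normc.normcM nu mulr1 normc_real opprB addrCA subrr addr0 ger0_norm // subr_ge0.
(* The factor 8 in the bound on [cc] absorbs the 2 of the bound [2 / eta^2] on the kernel and leaves
   [(1 - w) / (2 D)^2]. *)
apply: (@le_trans _ _ ((1 - w) / (4 * D j0 ^+ 2))).
  have -> : (1 - w) / (4 * D j0 ^+ 2) = (1 - w) * eta j0 ^+ 2 / (8 * D j0 ^+ 2) * (2 / eta j0 ^+ 2).
    by field; rewrite !gt_eqF.
  by rewrite ler_wpM2r // divr_ge0 // exprn_ge0 // ltW.
(* The denominator of the Poisson kernel is at most [(2 D)^2], since the distance in it is at most
   [|xi - 1| + (1 - w) <= 2 D]. *)
rewrite poissonE nw //; apply: ler_pM.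
- by rewrite subr_ge0 ltW.
- by rewrite invr_ge0 mulr_ge0 ?exprn_ge0 // ltW.
- by rewrite expr2; nra.
rewrite lef_pV2 ?posrE ?mulr_gt0 ?exprn_gt0 // ?normc1B_gt0 ?nw //.
have -> : 4 * D j0 ^+ 2 = (2 * D j0) ^+ 2 by ring.
rewrite lerXn2r ?nnegrE ?normc_ge0 ?mulr_ge0 ?(ltW D0) //.
have -> : 1 - w%:C%C * xi^*%C = (1 - xi^*%C) + (1 - w)%:C%C * xi^*%C.
  by rewrite rmorphB /=; ring.
apply: le_trans (normcD _ _) _.
rewrite Normc.normcM normc_conj xi1 mulr1 normc_real (gtr0_norm (_ : 0 < 1 - w)) ?subr_gt0 //.
have -> : normc (1 - xi^*%C) = normc (xi - 1).
  rewrite -[RHS]normc_conj conjCB normc_distC; congr (normc (_ - _)).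
  by rewrite conj_unit ?Normc.normc1 // invr1.
have : normc (xi - 1) <= normc (xi - zeta j0) + normc (zeta j0 - 1).
  by apply: le_trans (normcD _ _); rewrite addrA subrK.
lra.
Qed.

End KernelDomination.

Section PoissonAverage.
Context {R : realType}.

Lemma poisson_inv (v : R[i]) : 1 - v != 0 -> poisson v = 2 * complex.Re ((1 - v)^-1) - 1 :> R.
Proof.
move=> h; have -> : (1 - v)^-1 = 1 + v / (1 - v) by field.
by rewrite ReD /poisson /=; ring.
Qed.

(** Averaging over the [N]-th roots of unity keeps only the frequencies divisible by [N], so the sum
    is exactly [N (1 + r^N) / (1 - r^N)]. *)
Lemma sum_poisson_ge N (r : R) (u : R[i]) : (0 < N)%N -> 0 <= r < 1 -> u ^+ N = 1 -> normc u = 1 ->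
  N%:R <= \sum_(y < N) poisson (r%:C%C * (u * om N ^+ y)) :> R.
Proof.
move=> N0 /andP[r0 r1] uN u1.
pose v (y : nat) := r%:C%C * (u * om N ^+ y).
have nv y : normc (v y) = r.
  by rewrite /v !Normc.normcM u1 normc_omX !mulr1 normc_real ger0_norm.
have v1 y : 1 - v y != 0 by rewrite -normc_gt0 normc1B_gt0 // nv.
have vN y : v y ^+ N = (r ^+ N)%:C%C.
  by rewrite /v !exprMn realCX uN mul1r -exprM mulnC exprM om_prim // expr1n mulr1.
have rN : r ^+ N < 1 by rewrite exprn_ilt1 // -lt0n.
have rN0 : (1 - r ^+ N)%:C%C != 0 :> R[i].
  by rewrite -normc_gt0 normc_real normr_gt0 subr_eq0 gt_eqF.
have geo y : (1 - v y)^-1 = (1 - r ^+ N)%:C%C^-1 * \sum_(n < N) v y ^+ n.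
  apply: (mulfI rN0); rewrite mulrA divff // mul1r rmorphB /= -(vN y).
  have -> : 1 - v y ^+ N = (1 - v y) * \sum_(n < N) v y ^+ n.
    by rewrite -[LHS]opprB subrX1 -mulNr opprB.
  by rewrite mulrAC divff // mul1r.
have -> : \sum_(y < N) poisson (r%:C%C * (u * om N ^+ y))
    = 2 * (N%:R / (1 - r ^+ N)) - N%:R.
  under eq_bigr do rewrite poisson_inv ?v1 //.
  rewrite sumrB sumr_const card_ord -mulr_sumr -Re_sum; congr (2 * _ - _).
  under eq_bigr do rewrite -/(v _) geo.
  rewrite -mulr_sumr exchange_big /=.
  rewrite (bigD1 (Ordinal N0)) //= [X in _ * (_ + X)]big1 ?addr0; last first.
    move=> n n0; under eq_bigr do rewrite /v !exprMn.
    rewrite -!mulr_sumr sum_om // gtnNdvd ?mulr0 //.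
    by rewrite lt0n; apply: contraNneq n0 => h; apply/eqP/val_inj.
  under eq_bigr do rewrite expr0.
  rewrite sumr_const card_ord -fmorphV /= Re_realM mulrC; congr (_ * _).
  have -> : (N%:R : R[i]) = (N%:R : R)%:C%C by rewrite rmorph_nat.
  by [].
have : 1 <= (1 - r ^+ N)^-1.
  by rewrite invf_ge1 ?subr_gt0 // gerBl exprn_ge0.
have : 0 <= N%:R :> R by [].
move: (N%:R) ((1 - r ^+ N)^-1) => a b a0 b1; nra.
Qed.

Lemma om_dist N x y : (0 < N)%N -> (x <= y)%N -> (2 * (y - x) <= N)%N ->
  2 * (y - x)%:R / N%:R <= normc (om N ^+ x - om N ^+ y) :> R.
Proof.
move=> N0 xy h; have N0' : 0 < N%:R :> R by rewrite ltr0n.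
have p2 := pi_ge2 R.
have e : `|2 * pi * x%:R / N%:R - 2 * pi * y%:R / N%:R| = pi * (2 * (y - x)%:R / N%:R) :> R.
  rewrite distrC natrB // ger0_norm; first by field; rewrite gt_eqF.
  by rewrite subr_ge0 ler_pM2r ?invr_gt0 // ler_pM2l ?mulr_gt0 ?pi_gt0 // ler_nat.
rewrite !omX; apply: le_trans (chord_ge _); rewrite e.
  have : 0 <= 2 * (y - x)%:R / N%:R :> R by rewrite divr_ge0 // mulr_ge0.
  by move: (2 * _ / _) (pi) p2 => t p *; nra.
by rewrite ger_pMr ?pi_gt0 // ler_pdivrMr // mul1r -natrM ler_nat.
Qed.

Lemma om_dist_le N x y : (0 < N)%N -> (x <= y)%N ->
  normc (om N ^+ x - om N ^+ y) <= 8 * (y - x)%:R / N%:R :> R.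
Proof.
move=> N0 xy; have N0' : 0 < N%:R :> R by rewrite ltr0n.
rewrite !omX; apply: le_trans (chord_le _ _) _.
rewrite distrC -mulrBl -mulrBr -natrB // ger0_norm; last first.
  by rewrite divr_ge0 ?mulr_ge0 ?pi_ge0 // ltW.
rewrite ler_pM2r ?invr_gt0 // ler_wpM2r //.
have /andP[_ h] := (pihalf_02_cos_pihalf R).1; lra.
Qed.

End PoissonAverage.


(** * Excess of zeros seen from a well chosen pole *)

Section Pigeonhole.
Context {R : realType}.
Variables (N : nat) (eta : R).
Hypothesis (N0 : (0 < N)%N) (eta01 : 0 < eta <= 2^-1).

Let P (x y : nat) : R := poisson ((1 - eta)%:C%C * (((om N ^+ x)^*)%C * om N ^+ y)).

Let nP x y : normc ((1 - eta)%:C%C * (((om N ^+ x)^*)%C * om N ^+ y)) = 1 - eta.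
Proof.
have /andP[e0 e1] := eta01.
by rewrite !Normc.normcM normc_conj !normc_omX !mulr1 normc_real ger0_norm //; lra.
Qed.

Let P_ge0 x y : 0 <= P x y.
Proof. by apply: poisson_ge0; rewrite nP; have /andP[e0 e1] := eta01; lra. Qed.

(** For [|u| = 1], [|1 - (1 - eta) u|^2 = eta^2 + (1 - eta) |1 - u|^2], and [1 - eta >= 1/2]. *)
Let P_le x y c : 0 < c -> c <= normc (om N ^+ x - om N ^+ y) -> P x y <= 4 * eta / c ^+ 2.
Proof.
move=> c0 cn; have /andP[e0 e1] := eta01.
have r1 : 1 - eta < 1 by lra.
rewrite /P poissonE nP //; set u := ((om N ^+ x)^*)%C * om N ^+ y.
have u1 : normc u = 1 by rewrite /u Normc.normcM normc_conj !normc_omX mulr1.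
have cu : c ^+ 2 <= normc (1 - u) ^+ 2.
  rewrite lerXn2r ?nnegrE ?normc_ge0 ?(ltW c0) //; apply: le_trans cn _.
  have -> : om N ^+ x - om N ^+ y = om N ^+ x * (1 - u).
    by rewrite mulrBr mulr1 /u mulrA mulC_conj normc_omX expr1n mul1r.
  by rewrite Normc.normcM normc_omX mul1r.
have e : normc (1 - (1 - eta)%:C%C * u) ^+ 2 = eta ^+ 2 + (1 - eta) * normc (1 - u) ^+ 2.
  have := sqr_normcE u; rewrite u1 expr1n !sqr_normcE; case: (u) => a b /= h.
  have -> : eta ^+ 2 + (1 - eta) * ((1 - a) ^+ 2 + (0 - b) ^+ 2)
    = eta ^+ 2 + (1 - eta) * (1 - 2 * a + (a ^+ 2 + b ^+ 2)) by ring.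
  transitivity (1 - 2 * (1 - eta) * a + (1 - eta) ^+ 2 * (a ^+ 2 + b ^+ 2)); first by ring.
  by rewrite -h; ring.
rewrite e; move: cu; move: (normc _ ^+ 2) => /= q' cq'; pose q : R := q'.
have cq : c ^+ 2 <= q by []; rewrite -/q; clearbody q; clear cq' q'.
have c2 : 0 < c ^+ 2 by rewrite exprn_gt0.
have d0 : c ^+ 2 / 2 <= eta ^+ 2 + (1 - eta) * q.
  have q0 : 0 <= (2^-1 - eta) * q.
    by rewrite mulr_ge0 ?subr_ge0 //; apply: le_trans cq; exact: ltW.
  have -> : (1 - eta) * q = q / 2 + (2^-1 - eta) * q by field.
  have h1 : c ^+ 2 / 2 <= q / 2 by rewrite ler_pM2r ?invr_gt0.
  apply: le_trans h1 _; rewrite addrCA lerDl addr_ge0 ?sqr_ge0 //.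
apply: (@le_trans _ _ (2 * eta / (c ^+ 2 / 2))); last first.
  by rewrite le_eqVlt; apply/orP; left; apply/eqP; field; rewrite gt_eqF.
apply: ler_pM.
- have -> : 1 - (1 - eta) ^+ 2 = eta * (2 - eta) by ring.
  by rewrite mulr_ge0 //; lra.
- by rewrite invr_ge0; apply: le_trans d0; rewrite divr_ge0 // ltW.
- have -> : 1 - (1 - eta) ^+ 2 = 2 * eta - eta ^+ 2 by ring.
  by rewrite gerBl sqr_ge0.
- by rewrite lef_pV2 ?posrE ?divr_gt0 //; apply: lt_le_trans d0; rewrite divr_gt0.
Qed.

(** With truncated subtraction [(x - y) + (y - x)] is [|x - y|]; chords at index distance at least
    [k] have length at least [2 k / N]. *)
Let P_le_lt (x y k : nat) : (0 < k)%N -> (k <= (x - y) + (y - x))%N ->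
  (2 * ((x - y) + (y - x)) <= N)%N ->
  P x y <= eta * N%:R ^+ 2 / k%:R ^+ 2.
Proof.
move=> k0 kd dN; have N0' : 0 < N%:R :> R by rewrite ltr0n.
have k0' : 0 < k%:R :> R by rewrite ltr0n.
apply: (@le_trans _ _ (4 * eta / (2 * k%:R / N%:R) ^+ 2)).
  apply: P_le; first by rewrite divr_gt0 // mulr_gt0.
  have [xy|/ltnW xy] := leqP x y.
    apply: le_trans (@om_dist R N x y N0 xy _); last by lia.
    by rewrite ler_pM2r ?invr_gt0 // ler_pM2l // ler_nat; lia.
  rewrite normc_distC; apply: le_trans (@om_dist R N y x N0 xy _); last by lia.
  by rewrite ler_pM2r ?invr_gt0 // ler_pM2l // ler_nat; lia.
rewrite le_eqVlt; apply/orP; left; apply/eqP; field.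
by rewrite !gt_eqF.
Qed.

Let tail_up a x mu : (0 < mu)%N -> (x + mu <= a)%N -> forall n : nat,
  \sum_(a.+1 <= y < n) ((y - x)%:R ^+ 2)^-1 <= mu%:R^-1 :> R.
Proof.
move=> mu0 xa n; have [na|na] := leqP n a.+1.
  by rewrite big_geq // invr_ge0.
(* [1 / k^2 <= 1 / (k - 1) - 1 / k], which telescopes. *)
apply: (@le_trans _ _ (\sum_(a.+1 <= y < n) (- (y - x)%:R^-1 - - (y.-1 - x)%:R^-1))).
  rewrite !big_nat; apply: ler_sum => y /andP[ay yn].
  have -> : (y - x)%:R = (y.-1 - x)%:R + 1 :> R by rewrite natr1; congr (_%:R); lia.
  have : 0 < (y.-1 - x)%:R :> R by rewrite ltr0n; lia.
  move: (_%:R) => k k0.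
  have -> : - (k + 1)^-1 - - k^-1 = (k * (k + 1))^-1 by field; rewrite !gt_eqF //; lra.
  rewrite lef_pV2 ?posrE ?exprn_gt0 ?mulr_gt0 //; first (by nra); lra.
have tel : forall f : nat -> R, \sum_(a.+1 <= y < n) (f y - f y.-1) = f n.-1 - f a.
  move=> f; rewrite big_add1; under eq_bigr do rewrite /=.
  by rewrite telescope_sumr //; lia.
rewrite (tel (fun y => - (y - x)%:R^-1)) opprK addrC.
apply: (@le_trans _ _ (a - x)%:R^-1).
  by rewrite gerDl oppr_le0 invr_ge0.
by rewrite lef_pV2 ?posrE ?ltr0n ?ler_nat; lia.
Qed.

Let tail_down b x mu : (0 < mu)%N -> (b + mu <= x)%N ->
  \sum_(0 <= y < b) ((x - y)%:R ^+ 2)^-1 <= mu%:R^-1 :> R.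
Proof.
move=> mu0 xa.
apply: (@le_trans _ _ (\sum_(0 <= y < b) ((x - y.+1)%:R^-1 - (x - y)%:R^-1))).
  rewrite !big_nat; apply: ler_sum => y /andP[ay yn].
  have -> : (x - y)%:R = (x - y.+1)%:R + 1 :> R by rewrite natr1; congr (_%:R); lia.
  have : 0 < (x - y.+1)%:R :> R by rewrite ltr0n; lia.
  move: (_%:R) => k k0.
  have -> : k^-1 - (k + 1)^-1 = (k * (k + 1))^-1 by field; rewrite !gt_eqF //; lra.
  rewrite lef_pV2 ?posrE ?exprn_gt0 ?mulr_gt0 //; first (by nra); lra.
rewrite (telescope_sumr (fun y => (x - y)%:R^-1)) //.
apply: (@le_trans _ _ (x - b)%:R^-1).
  by rewrite gerBl invr_ge0.
by rewrite lef_pV2 ?posrE ?ltr0n ?ler_nat; lia.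
Qed.

(** The [N] grid points together carry Poisson mass at least [N]. Those outside the shrunken block
    are at index distance more than [mu] from [x]; they form three tails, one below and two above
    because the circle closes up, each of mass at most [eta N^2 / mu]. *)
Lemma poisson_block_ge (A B mu x : nat) : (0 < mu)%N -> (2 * B <= N)%N ->
  (A + 2 * mu <= x)%N -> (x + 2 * mu <= B)%N ->
  N%:R - 3 * eta * N%:R ^+ 2 / mu%:R <= \sum_(A + mu <= y < (B - mu).+1) P x y.
Proof.
move=> mu0 BN Ax xB; have /andP[e0 e1] := eta01.
have r01 : 0 <= 1 - eta < 1 by lra.
have u1 : normc ((om N ^+ x)^*)%C = 1 :> R by rewrite normc_conj normc_omX.
have uN : ((om N ^+ x)^*)%C ^+ N = 1 :> R[i].
  by rewrite conj_om // -exprM mulnC exprM om_prim // expr1n.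
have tot := sum_poisson_ge N0 r01 uN u1.
have {}tot : N%:R <= \sum_(0 <= y < N) P x y by rewrite big_mkord.
rewrite (@big_cat_nat _ _ _ (A + mu)) //= in tot; last by lia.
rewrite (@big_cat_nat _ _ _ (B - mu).+1 (A + mu)) //= in tot; try lia.
have E0 : 0 <= eta * N%:R ^+ 2 by rewrite mulr_ge0 ?exprn_ge0 // ltW.
have t1 : \sum_(0 <= y < A + mu) P x y <= eta * N%:R ^+ 2 / mu%:R.
  apply: (@le_trans _ _ (\sum_(0 <= y < A + mu) eta * N%:R ^+ 2 * ((x - y)%:R ^+ 2)^-1)).
    rewrite !big_nat; apply: ler_sum => y /andP[_ yA].
    by apply: P_le_lt; lia.
  by rewrite -mulr_sumr ler_wpM2l // tail_down //; lia.
have t2 : \sum_((B - mu).+1 <= y < N) P x y <= 2 * (eta * N%:R ^+ 2 / mu%:R).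
  (* For [y] beyond the antipode of [x] the shorter arc has index length [x + N - y]. *)
  apply: (@le_trans _ _ (\sum_((B - mu).+1 <= y < N) eta * N%:R ^+ 2 *
     (((y - x)%:R ^+ 2)^-1 + ((x + N - y)%:R ^+ 2)^-1))).
    rewrite !big_nat; apply: ler_sum => y /andP[yB yN].
    rewrite mulrDr; have [h|h] := leqP (2 * (y - x)) N.
      apply: (@le_trans _ _ (eta * N%:R ^+ 2 * ((y - x)%:R ^+ 2)^-1)); first by apply: P_le_lt; lia.
      by rewrite lerDl mulr_ge0 // invr_ge0 exprn_ge0.
    apply: (@le_trans _ _ (eta * N%:R ^+ 2 * ((x + N - y)%:R ^+ 2)^-1)); last first.
      by rewrite lerDr mulr_ge0 // invr_ge0 exprn_ge0.
    have -> : P x y = P (x + N) y by rewrite /P exprD om_prim // mulr1.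
    by apply: P_le_lt; lia.
  have -> : 2 * (eta * N%:R ^+ 2 / mu%:R) = eta * N%:R ^+ 2 * (mu%:R^-1 + mu%:R^-1) by ring.
  rewrite -mulr_sumr big_split /= ler_wpM2l //.
  apply: lerD; first by apply: tail_up => //; lia.
  apply: le_trans (@tail_down N (x + N) mu mu0 _); last lia.
  rewrite [leRHS](@big_cat_nat _ _ _ (B - mu).+1) //=; last lia.
  by rewrite lerDr sumr_ge0 // => y _; rewrite invr_ge0 exprn_ge0.
have -> : 3 * eta * N%:R ^+ 2 / mu%:R = 3 * (eta * N%:R ^+ 2 / mu%:R) by ring.
move: tot t1 t2; lra.
Qed.

(** Double counting over the centres [y] of the shrunken block: each [x] at index distance at least
    [2 mu] from both ends contributes almost [N], at most [4 mu] points are lost near the ends, and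
    there are at most [B - A] centres, one of which attains the average. *)
Lemma poisson_pigeonhole (A B mu : nat) (X : seq nat) (T : R) : (0 < mu)%N -> (2 * B <= N)%N ->
  (A + 4 * mu < B)%N -> uniq X -> (forall x, x \in X -> (A < x <= B)%N) ->
  0 <= N%:R - 3 * eta * N%:R ^+ 2 / mu%:R ->
  0 < T -> T * (B - A)%:R <= ((size X)%:R - 4 * mu%:R) * (N%:R - 3 * eta * N%:R ^+ 2 / mu%:R) ->
  exists2 y, (A + mu <= y <= B - mu)%N & T <= \sum_(x <- X) P x y.
Proof.
move=> mu0 BN AB uX XAB q0 T0 h.
apply: contrapT => nex.
have small y : (A + mu <= y < (B - mu).+1)%N -> \sum_(x <- X) P x y < T.
  move=> yI; rewrite ltNge; apply/negP => hT; apply: nex; exists y => //.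
pose X' := [seq x <- X | (A + 2 * mu <= x)%N && (x + 2 * mu <= B)%N].
have sX : (size X <= size X' + 4 * mu)%N.
  rewrite -(count_predC (fun x => (A + 2 * mu <= x)%N && (x + 2 * mu <= B)%N) X) size_filter leq_add2l.
  rewrite -size_filter; set Y := seq.filter _ X.
  have -> : (4 * mu = size (iota A.+1 (2 * mu) ++ iota (B - 2 * mu).+1 (2 * mu)))%N.
    by rewrite size_cat !size_iota; lia.
  apply: uniq_leq_size; first exact: filter_uniq.
  move=> x; rewrite mem_filter /= => /andP[xn /XAB xAB].
  by rewrite mem_cat !mem_iota; move: xn; lia.
have lb : ((size X)%:R - 4 * mu%:R) * (N%:R - 3 * eta * N%:R ^+ 2 / mu%:R)
   <= \sum_(A + mu <= y < (B - mu).+1) \sum_(x <- X) P x y.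
  rewrite exchange_big /=.
  apply: (@le_trans _ _ (\sum_(x <- X') \sum_(A + mu <= y < (B - mu).+1) P x y)); last first.
    rewrite big_filter [leRHS](bigID (fun x => (A + 2 * mu <= x)%N && (x + 2 * mu <= B)%N)) /=.
    by rewrite lerDl sumr_ge0 // => x _; rewrite sumr_ge0.
  apply: (@le_trans _ _ ((size X')%:R * (N%:R - 3 * eta * N%:R ^+ 2 / mu%:R))).
    by rewrite ler_wpM2r // lerBlDr -natrM -natrD ler_nat.
  rewrite -sum1_size natr_sum mulr_suml !big_seq; apply: ler_sum => x.
  rewrite mem_filter mul1r => /andP[/andP[x1 x2] _].
  exact: poisson_block_ge.
have ub : \sum_(A + mu <= y < (B - mu).+1) \sum_(x <- X) P x y < T * (B - A)%:R.
  apply: (@lt_le_trans _ _ (\sum_(A + mu <= y < (B - mu).+1) T)).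
    by apply: ltr_sum_nat => //; lia.
  rewrite sumr_const_nat -[leLHS]mulr_natr ler_wpM2l ?(ltW T0) // ler_nat; lia.
by move: (le_lt_trans (le_trans h lb) ub); rewrite ltxx.
Qed.

End Pigeonhole.

Section GapEstimate.
Context {R : realType}.

(** Accounting in fractions of the length [l]: from the proportion [e - g / 8] of zeros the ends
    remove [4 mu <= g l / 16], which leaves at least [e - g / 4]. As [mu >= g l / 128], the choice
    of [eta] makes the lost Poisson mass [3 eta N^2 / mu] at most [g N / 8]. The product is at least
    [e - 3 g / 8], and the remaining [g / 8] pays for the up to [l + 1] indices of the block. *)
Lemma one_block_gain (N A B mu : nat) (z : pred nat) (e g l eta a b : R) :
  (0 < N)%N -> (2 * B <= N)%N -> 0 < g -> g <= e -> e <= 1 ->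
  l = b - a -> A%:R <= a -> a < A.+1%:R -> B%:R <= b -> b < B.+1%:R ->
  mu%:R <= g / 64 * l -> g / 64 * l < mu.+1%:R ->
  0 < eta <= 2^-1 -> eta * N%:R = g / 64 * (g / 48) * l ->
  128 <= g * l ->
  (e - g / 8) * l <= (size [seq i <- iota A.+1 (B - A) | z i])%:R ->
  exists2 y, (A + mu <= y <= B - mu)%N &
    (e - g / 2) * N%:R <= \sum_(i <- [seq i <- iota A.+1 (B - A) | z i])
        poisson ((1 - eta)%:C%C * (((om N ^+ i)^*)%C * om N ^+ y)).
Proof.
move=> N0 BN g0 ge e1 lE A1 A2 B1 B2 u1 u2 eta01 etaE large cnt.
have N0' : 0 < N%:R :> R by rewrite ltr0n.
have g1 : g <= 1 by lra.
have l0 : 0 < l by rewrite -(pmulr_rgt0 _ g0); lra.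
have gl : g * l <= l by rewrite ger_pMl.
move: A2 B2 u2; rewrite -[A.+1%:R]natr1 -[B.+1%:R]natr1 -[mu.+1%:R]natr1 => A2 B2 u2.
have muh : g * l / 128 <= mu%:R by lra.
have mu0 : (0 < mu)%N by rewrite -(ltr0n R); lra.
have AB : (A + 4 * mu < B)%N.
  by rewrite -(ltr_nat R) natrD natrM; lra.
have BA : (B - A)%:R = B%:R - A%:R :> R by rewrite natrB // (leq_trans (leq_addr (4 * mu) A) (ltnW AB)).
have q1 : 3 * eta * N%:R ^+ 2 / mu%:R <= g / 8 * N%:R.
  rewrite ler_pdivrMr ?ltr0n //.
  have -> : 3 * eta * N%:R ^+ 2 = g / 8 * N%:R * (g * l / 128).
    have -> : 3 * eta * N%:R ^+ 2 = 3 * (eta * N%:R) * N%:R by ring.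
    by rewrite etaE; field.
  by rewrite ler_wpM2l // mulr_ge0 ?divr_ge0 // ltW.
have gN : g / 8 * N%:R <= N%:R by rewrite ler_piMl ?(ltW N0') //; lra.
apply: (@poisson_pigeonhole R N eta N0 eta01 A B mu) => //.
- by rewrite filter_uniq // iota_uniq.
- move=> x; rewrite mem_filter mem_iota => /andP[_]; clear -AB; lia.
- lra.
- by rewrite mulr_gt0 //; lra.
apply: (@le_trans _ _ ((e - g / 4) * l * ((1 - g / 8) * N%:R))); last first.
  apply: ler_pM.
  - by rewrite mulr_ge0 //; lra.
  - by rewrite mulr_ge0 //; lra.
  - by move: cnt; set s := size _; move: (s%:R) => s' *; lra.
  - by rewrite mulrBl mul1r; lra.
rewrite BA mulrAC [leRHS]mulrA ler_wpM2r //.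
have h2 : 0 <= e - g / 2 by lra.
apply: (@le_trans _ _ ((e - g / 2) * (l + 1))); first by rewrite ler_wpM2l //; lra.
have h3 : e - 3 * g / 8 <= (e - g / 4) * (1 - g / 8) by nra.
have h4 : (e - 3 * g / 8) * l <= (e - g / 4) * (1 - g / 8) * l by rewrite ler_wpM2r // ltW.
by rewrite mulrAC; apply: le_trans h4; lra.
Qed.

End GapEstimate.

Section GapEstimateSum.
Context {R : realType}.

Lemma om_inj N i j : (i < N)%N -> (j < N)%N -> om N ^+ i = om N ^+ j :> R[i] -> i = j.
Proof.
have key a b : (a <= b)%N -> (b < N)%N -> om N ^+ a = om N ^+ b :> R[i] -> a = b.
  move=> ab bN h; apply/eqP; rewrite eqn_leq ab /= leqNgt; apply/negP => ba.
  have : om N ^+ (b - a) != 1 :> R[i] by apply: om_neq1; rewrite subn_gt0 ba (leq_ltn_trans (leq_subr _ _) bN).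
  have n0 : om N ^+ a != 0 :> R[i] by rewrite -normc_gt0 normc_omX.
  by rewrite -(inj_eq (mulfI n0)) -exprD subnKC // mulr1 h eqxx.
move=> iN jN h; have [/key|/ltnW/key] := leqP i j; first exact.
by move=> /(_ iN) k; rewrite k.
Qed.

(** Balance of the terms of [ln_poly1_le] with [t = s / C], so that [N t = s m]. The Poisson sums at
    the poles over the blocks are at least [(e - g / 2) N] and the degree is at most
    [(e - 7 g / 8) N], an excess of [3 g N / 8]. The assumption on the squares turns it into a gain
    of at least [2 N t], of which passing from [w] to 1 uses up [N t]. *)
Lemma gap_estimate (m C d n0 : nat) (F : seq (R * R)) (z : pred nat) (e g s Bd : R)
    (Q : {poly R[i]}) (N := (C * m)%N) (kap := g / 64 * (g / 48)) :
  (1 < C)%N -> 0 < g -> g <= e -> e <= 1 -> 0 < s <= 2^-1 -> (n0 < N)%N ->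
  (forall p, p \in F -> [/\ 0 < p.1, p.1 < p.2, p.2 <= 1, s <= p.2 &
    [/\ (trunc (p.2 * m%:R) <= n0)%N, 128 <= g * ((p.2 - p.1) * m%:R) &
     (e - g / 8) * ((p.2 - p.1) * m%:R)
      <= (size [seq i <- iota (trunc (p.1 * m%:R)).+1 (trunc (p.2 * m%:R) - trunc (p.1 * m%:R)) | z i])%:R]]) ->
  pairwise (fun p q => p.2 <= q.1) F ->
  16 * (8 * 100) <= g * kap ^+ 2 * \sum_(p <- F) ((p.2 - p.1) / p.2) ^+ 2 ->
  (forall i, (0 < i <= n0)%N -> z i -> root Q (om N ^+ i)) ->
  Q.[1] != 0 -> (size Q <= d.+1)%N -> d%:R <= (e - 7 * g / 8) * N%:R ->
  (forall xi, normc xi = 1 -> normc Q.[xi] <= Bd) ->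
  ln (normc Q.[1]) <= ln (d.+1%:R * Bd) - s * m%:R.
Proof.
move=> C1 g0 ge e1 /andP[s0 s1] n0N HF pwF KF rootQ Q1 sQ dN QB.
have N0 : (0 < N)%N by exact: leq_ltn_trans n0N.
have N0' : 0 < N%:R :> R by rewrite ltr0n.
have C0 : 1 < C%:R :> R by rewrite ltr1n.
have C2 : 2 <= C%:R :> R by rewrite ler_nat.
have C0' : 0 < C%:R :> R by apply: lt_trans C0.
have NE : N%:R = C%:R * m%:R :> R by rewrite /N natrM.
have m0' : 0 < m%:R :> R by rewrite -(pmulr_rgt0 _ C0') -NE.
have g1 : g <= 1 by apply: le_trans e1.
have kap0 : 0 < kap by rewrite mulr_gt0 // divr_gt0.
have kap1 : kap <= g / 64.
  rewrite /kap ler_piMr //; [by rewrite divr_ge0 // ltW | lra].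
pose J := size F; pose f j := nth (0, 0) F j.
have fF j : (j < J)%N -> f j \in F by move=> jJ; apply: mem_nth.
pose al j := (f j).1; pose be j := (f j).2.
pose L j := be j - al j.
(* Distance of the pole to the circle, normalized as in [one_block_gain]:
   [eta j * N = kap * (L j * m)]. *)
pose eta j := kap * L j / C%:R.
pose A j := trunc (al j * m%:R); pose B j := trunc (be j * m%:R).
pose mu j := trunc (g / 64 * (L j * m%:R)).
pose Xj j := [seq i <- iota (A j).+1 (B j - A j) | z i].
have basic j : (j < J)%N -> [/\ 0 < al j, 0 < be j, 0 < L j, L j <= be j & be j <= 1].
  move=> jJ; have [a0 ab b1 _ _] := HF _ (fF j jJ); split => //.
  - exact: lt_trans ab.
  - by rewrite subr_gt0.
  - by rewrite gerBl ltW.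
have eta01 j : (j < J)%N -> 0 < eta j <= 2^-1.
  move=> jJ; have [_ _ L0 Lb b1] := basic j jJ.
  rewrite divr_gt0 ?mulr_gt0 //= ler_pdivrMr //.
  have : kap * L j <= kap by rewrite ger_pMr //; lra.
  lra.
have etaN j : eta j * N%:R = kap * (L j * m%:R).
  by rewrite NE /eta; field; rewrite gt_eqF.
have muB j : (j < J)%N -> (mu j)%:R <= g / 64 * (L j * m%:R) < (mu j).+1%:R.
  move=> jJ; have [_ _ L0 _ _] := basic j jJ.
  by apply: truncn_itv; rewrite !mulr_ge0 ?(ltW g0) ?(ltW L0).
have AI j : (j < J)%N -> (A j)%:R <= al j * m%:R < (A j).+1%:R.
  by move=> jJ; have [a0 _ _ _ _] := basic j jJ; apply: truncn_itv; rewrite mulr_ge0 // ltW.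
have BI j : (j < J)%N -> (B j)%:R <= be j * m%:R < (B j).+1%:R.
  by move=> jJ; have [_ a0 _ _ _] := basic j jJ; apply: truncn_itv; rewrite mulr_ge0 // ltW.
have Bm j : (j < J)%N -> (B j <= m)%N.
  move=> jJ; have /andP[h _] := BI j jJ; have [_ _ _ _ b1] := basic j jJ.
  by rewrite -(ler_nat R); apply: le_trans h _; rewrite ger_pMl.
have BN j : (j < J)%N -> (2 * B j <= N)%N.
  by move=> jJ; rewrite leq_mul // Bm.
have center j : exists y, (j < J)%N -> (A j + mu j <= y <= B j - mu j)%N /\
    (e - g / 2) * N%:R <= \sum_(i <- Xj j)
        poisson ((1 - eta j)%:C%C * (((om N ^+ i)^*)%C * om N ^+ y)).
  have [jJ|] := ltnP j J; last by exists 0%N.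
  have [a0 ab b1 _ [_ large cnt]] := HF _ (fF j jJ).
  have /andP[u1 u2] := muB j jJ; have /andP[A1 A2] := AI j jJ; have /andP[B1 B2] := BI j jJ.
  have lE : L j * m%:R = be j * m%:R - al j * m%:R by rewrite /L mulrBl.
  have [y hy1 hy2] := @one_block_gain R N (A j) (B j) (mu j) z e g (L j * m%:R) (eta j)
     (al j * m%:R) (be j * m%:R) N0 (BN j jJ) g0 ge e1 lE A1 A2 B1 B2 u1 u2 (eta01 j jJ) (etaN j) large cnt.
  by exists y.
have /choice[y Hy] := center.
pose zeta j : R[i] := om N ^+ (y j).
pose zz j : R[i] := (1 - eta j)%:C%C * zeta j.
(* [s] is at most every [be j], so [1 - w] does not exceed [be j / C]. *)
pose w := 1 - s / C%:R; pose t := s / C%:R.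
have t0 : 0 < t by rewrite divr_gt0.
have t1 : t <= 4^-1.
  by rewrite ler_pdivrMr //; lra.
have w01 : 0 < w < 1 by rewrite /w -/t; lra.
have tE : 1 - w = t by rewrite /w -/t; ring.
(* Of the 10, 8 accounts for the distance from [zeta j] to 1, the bound [2 pi <= 8] being used for
   chords, and 2 for the term [2 eta j]. *)
pose D j := 10 * be j / C%:R.
(* The largest weight that [dpoisson_dominated] allows; it equals
   [t kap^2 / 800 * (L j / be j)^2]. *)
pose cc j := t * eta j ^+ 2 / (8 * D j ^+ 2).
have cc0 j : (j < J)%N -> 0 <= cc j.
  by move=> _; rewrite divr_ge0 // mulr_ge0 ?sqr_ge0 // ltW.
have z1 j : normc (zeta j) = 1 by rewrite normc_omX.
have etamu j : (j < J)%N -> eta j <= (mu j)%:R / N%:R.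
  move=> jJ; have [a0 ab b1 _ [_ large cnt]] := HF _ (fF j jJ).
  rewrite ler_pdivlMr // etaN; have /andP[_ u2] := muB j jJ.
  move: u2; rewrite -[(mu j).+1%:R]natr1 => u2.
  have [_ _ L0 _ _] := basic j jJ.
  have : kap * (L j * m%:R) <= g / 128 * (L j * m%:R).
    rewrite ler_wpM2r ?mulr_ge0 ?(ltW L0) //; have : g / 64 * (g / 48) <= g / 64 * 2^-1.
      by rewrite ler_wpM2l ?divr_ge0 ?(ltW g0) //; lra.
    rewrite /kap; lra.
  move: large; rewrite -/(be j) -/(al j) -/(L j); move: (L j * m%:R) u2 => l u2 large; lra.
have pos : forall xi, normc xi = 1 ->
   \sum_(j < J) cc j * dpoisson (zz j * xi^*%C) <= poisson (w%:C%C * xi^*%C).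
  apply: (@dpoisson_dominated R J w eta D cc zeta) => //.
  - move=> j jJ; have [a0 b0 L0 Lb b1] := basic j jJ; have /andP[e0 eh] := eta01 j jJ.
    have D0 : 0 < D j by rewrite divr_gt0 ?mulr_gt0.
    split => //.
    + by rewrite e0 /=; lra.
    + exact: cc0.
    + split.
      have yB : (y j)%:R <= be j * m%:R.
        have [/andP[_ h] _] := Hy j jJ; have /andP[h2 _] := BI j jJ.
        by apply: le_trans h2; rewrite ler_nat; apply: leq_trans h (leq_subr _ _).
      have d1 : normc (zeta j - 1) <= 8 * (be j / C%:R).
        rewrite normc_distC -(expr0 (om N)); apply: le_trans (om_dist_le N0 (leq0n _)) _.
        rewrite subn0 -mulrA ler_pM2l // NE ler_pdivrMr ?mulr_gt0 //.
        have -> : be j / C%:R * (C%:R * m%:R) = be j * m%:R by field; rewrite gt_eqF.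
        by [].
      have d2 : eta j <= be j / C%:R.
        rewrite ler_pM2r ?invr_gt0 //; apply: le_trans Lb.
        by rewrite ger_pMl //; lra.
      by rewrite /D; lra.
      rewrite tE /D -mulrA; have [_ _ _ sb _] := HF _ (fF j jJ).
      have : t <= be j / C%:R by rewrite ler_pM2r ?invr_gt0.
      have : 0 < be j / C%:R by rewrite divr_gt0.
      lra.
    + by rewrite tE.
  (* The blocks are disjoint and each centre stays [mu] indices away from the ends of its block, so
     centres are [mu i + mu j] apart, while [eta <= mu / N]. *)
  - have half i j : (i < j)%N -> (j < J)%N -> 2 * (eta i + eta j) <= normc (zeta i - zeta j).
      move=> ij jJ; have iJ := ltn_trans ij jJ.
      have bi : be i <= al j by move/(pairwiseP (0, 0)): pwF => /(_ i j); rewrite !inE; apply.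
      have BA : (B i <= A j)%N by apply: le_truncn; rewrite ler_pM2r.
      have [/andP[y1 y2] _] := Hy i iJ; have [/andP[y3 y4] _] := Hy j jJ.
      have muBi : (mu i <= B i)%N.
        rewrite /mu /B; apply: le_truncn; rewrite mulrA ler_pM2r //.
        have [_ _ L0 Lb _] := basic i iJ; apply: le_trans Lb; rewrite ger_pMl //; lra.
      have BNj := BN j jJ.
      have yy : (mu i + mu j <= y j - y i)%N.
        by move: y1 y2 y3 y4 muBi BA; clear; lia.
      apply: (@le_trans _ _ (2 * (y j - y i)%:R / N%:R)).
        rewrite -mulrA ler_pM2l // ; have h1 := etamu i iJ; have h2 := etamu j jJ.
        apply: (@le_trans _ _ ((mu i + mu j)%:R / N%:R)); first by rewrite natrD mulrDl lerD.
        by rewrite ler_pM2r ?invr_gt0 // ler_nat.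
      apply: om_dist => //.
        by move: y1 y2 y3 y4 muBi BA; clear; lia.
      apply: leq_trans BNj; rewrite leq_mul2l /=.
      by apply: leq_trans (leq_subr _ _) _; apply: leq_trans y4 (leq_subr _ _).
    move=> i j iJ jJ ij; case: (ltngtP i j) => [ij'|ji|]; first exact: half.
      by rewrite addrC normc_distC; apply: half.
    by move=> eij; rewrite eij eqxx in ij.
pose Xn := [seq i <- iota 1 n0 | z i].
pose X := [seq om N ^+ i | i <- Xn] : seq R[i].
have XnN i : i \in Xn -> (0 < i <= n0)%N /\ z i.
  by rewrite mem_filter mem_iota => /andP[zi /andP[i0]]; rewrite add1n ltnS i0 => ->.
have uX : uniq X.
  rewrite map_inj_in_uniq ?filter_uniq ?iota_uniq // => i j /XnN[/andP[_ i1] _] /XnN[/andP[_ j1] _].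
  by apply: om_inj; apply: leq_ltn_trans n0N.
have XQ x : x \in X -> normc x = 1 /\ root Q x.
  by move=> /mapP[i /XnN[i1 i2] ->]; rewrite normc_omX; split => //; apply: rootQ.
have zz1 j : (j < J)%N -> normc (zz j) < 1.
  move=> jJ; have /andP[e0 eh] := eta01 j jJ.
  by rewrite Normc.normcM z1 mulr1 normc_real ger0_norm; lra.
have := @ln_poly1_le R Q d Bd X J w zz cc Q1 sQ uX XQ QB w01 zz1 cc0 pos.
move/le_trans; apply.
rewrite -addrA lerD2l.
have dN1 : d%:R <= N%:R :> R.
  apply: le_trans dN _; rewrite ger_pMl //; lra.
(* [ln (1 + x) <= x] at [x = t / (1 - t)], which is at most [2 t] as [t <= 1/4]. *)
have lw : ln w^-1 <= 2 * t.
  have -> : w^-1 = 1 + t / (1 - t).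
    by rewrite /w -/t; field; lra.
  apply: le_trans (le_ln1Dx _) _.
    by apply: (@lt_le_trans _ _ 0) => //; rewrite divr_ge0 //; lra.
  by rewrite ler_pdivrMr; nra.
have lw0 : 0 <= ln w^-1.
  by rewrite ln_ge0 // invf_ge1 //; lra.
have st1 : d%:R / 2 * ln w^-1 <= N%:R * t.
  have -> : N%:R * t = N%:R / 2 * (2 * t) by field.
  by apply: ler_pM => //; rewrite ?divr_ge0 // ler_pM2r ?invr_gt0.
have st2 : 2^-1 * \sum_(j < J) cc j * (d%:R - \sum_(x <- X) poisson (x^*%C * zz j)) <= - (2 * (N%:R * t)).
  have term j : (j < J)%N -> cc j * (d%:R - \sum_(x <- X) poisson (x^*%C * zz j))
     <= - (3 / 8 * (g * N%:R * t * kap ^+ 2 / (8 * 100)) * ((be j - al j) / be j) ^+ 2).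
    move=> jJ; have [a0 b0 L0 Lb b1] := basic j jJ.
    have c1 : (e - g / 2) * N%:R <= \sum_(x <- X) poisson (x^*%C * zz j).
      have [_ h] := Hy j jJ; apply: le_trans h _; rewrite big_map.
      under [leRHS]eq_bigr do rewrite mulrCA.
      apply: sum_subseq_le.
      - by rewrite filter_uniq // iota_uniq.
      - move=> i; rewrite !mem_filter !mem_iota => /andP[-> /andP[i1 i2]] /=.
        have [_ _ _ _ [Bn _ _]] := HF _ (fF j jJ).
        have Bn' : (B j <= n0)%N := Bn.
        move: i1 i2 Bn'; move: (A j) (B j) => a b; clear; lia.
      - move=> i _; apply: poisson_ge0; rewrite !Normc.normcM normc_conj !normc_omX !mulr1 normc_real.
        by have /andP[e0 eh] := eta01 j jJ; rewrite ger0_norm; lra.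
    apply: (@le_trans _ _ (cc j * - (3 / 8 * g * N%:R))).
      by rewrite ler_wpM2l ?cc0 //; lra.
    rewrite mulrN lerN2 le_eqVlt; apply/orP; left; apply/eqP.
    rewrite /cc /eta /D /L; field.
    by rewrite !gt_eqF.
  apply: (@le_trans _ _ (2^-1 * \sum_(j < J) - (3 / 8 * (g * N%:R * t * kap ^+ 2 / (8 * 100)) * ((be j - al j) / be j) ^+ 2))).
    by rewrite ler_pM2l ?invr_gt0 //; apply: ler_sum => j _; apply: term.
  rewrite sumrN -mulr_sumr mulrN lerN2.
  have -> : \sum_(j < J) ((be j - al j) / be j) ^+ 2 = \sum_(p <- F) ((p.2 - p.1) / p.2) ^+ 2.
    by rewrite (big_nth (0, 0)) big_mkord.
  move: KF; move: (\sum_(p <- F) _) => S KF.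
  have -> : 2^-1 * (3 / 8 * (g * N%:R * t * kap ^+ 2 / (8 * 100)) * S)
    = (N%:R * t) * (3 * (g * kap ^+ 2 * S) / (16 * (8 * 100))) by field.
  rewrite [leLHS]mulrC ler_pM2l; last by rewrite mulr_gt0.
  by rewrite ler_pdivlMr ?mulr_gt0 //; lra.
have -> : s * m%:R = N%:R * t by rewrite NE /t; field; rewrite gt_eqF.
lra.
Qed.

End GapEstimateSum.

(** * Continuation across an arc and small exponential sums *)

Section ComplexLimits.
Context {R : realType}.
Implicit Types (z w l : R[i]) (u : nat -> R[i]) (e : R).

(** Balls of [R[i]] have radii in [R[i]]; a positive one is real, since the order of [R[i]] relates
    only numbers with equal imaginary parts. *)
Lemma nbhs_normc z (A : set R[i]) :
  nbhs z A <-> exists2 e : R, 0 < e & forall w, normc (w - z) < e -> A w.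
Proof.
split.
  move=> /nbhs_ballP[[e e'] /= e0 sub].
  have /andP[/eqP ee0 ee] : (e' == 0) && (0 < e) by move: e0; rewrite ltcE /= eq_sym.
  exists e => // w wz; apply: sub.
  by rewrite -ball_normE /ball_ /= normr_normc normc_distC ltcE /= ee0 eqxx.
move=> [e e0 sub]; apply/nbhs_ballP; exists e%:C%C => /=; first by rewrite ltcR.
move=> w; rewrite -ball_normE /ball_ /= normr_normc ltcR normc_distC => h; exact: sub.
Qed.

Definition tends u l := forall e, 0 < e -> exists n0, forall n, (n0 <= n)%N -> normc (u n - l) < e.

Lemma cvg_tends u l : u n @[n --> \oo] --> l -> tends u l.
Proof.
move=> h e e0.
have : nbhs l [set w | normc (w - l) < e] by apply/nbhs_normc; exists e.
by move=> /h [n0 _ h0]; exists n0 => n n0n; apply: h0.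
Qed.

Lemma tends_le u l c : tends u l -> (forall n, normc (u n) <= c) -> normc l <= c.
Proof.
move=> h ub; rewrite leNgt; apply/negP => cl.
have /h[n0 /(_ n0 (leqnn _)) h0] : 0 < normc l - c by rewrite subr_gt0.
have := normcBge l (u n0); rewrite normc_distC; have := ub n0; lra.
Qed.

Lemma tends_sum (I : Type) (s : seq I) (u : I -> nat -> R[i]) (l c : I -> R[i]) :
  (forall i, tends (u i) (l i)) ->
  tends (fun n => \sum_(i <- s) u i n * c i) (\sum_(i <- s) l i * c i).
Proof.
move=> h; elim: s => [|i s IH] e e0.
  by exists 0%N => n _; rewrite !big_nil subrr Normc.normc0.
have e2 : 0 < e / 2 by rewrite divr_gt0.
have [n1 h1] := IH _ e2.
have cp : 0 < normc (c i) + 1 by rewrite ltr_wpDl // normc_ge0.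
have [n2 h2] := h i _ (divr_gt0 e2 cp).
exists (maxn n1 n2) => n; rewrite geq_max => /andP[/h1 k1 /h2 k2].
rewrite !big_cons opprD addrACA; apply: le_lt_trans (normcD _ _) _.
rewrite -mulrBl Normc.normcM.
have : normc (u i n - l i) * normc (c i) <= e / 2.
  apply: (@le_trans _ _ (e / 2 / (normc (c i) + 1) * (normc (c i) + 1))).
    by apply: ler_pM; rewrite ?normc_ge0 ?(ltW k2) // lerDl.
  by rewrite divfK // gt_eqF.
by move: k1; lra.
Qed.

Lemma tends_bounded u l : tends u l -> exists2 B, 0 < B & forall n, normc (u n) <= B.
Proof.
move=> /(_ 1 ltr01)[n0 h].
pose B := \sum_(i < n0) normc (u i) + (normc l + 1).
have s0 : 0 <= \sum_(i < n0) normc (u i) by apply: sumr_ge0 => i _; exact: normc_ge0.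
exists B.
  by rewrite /B ltr_wpDl // ltr_wpDl // normc_ge0.
move=> n; have [nn|nn] := ltnP n n0.
  rewrite /B (bigD1 (Ordinal nn)) //= -addrA lerDl addr_ge0 //; last by rewrite addr_ge0 // normc_ge0.
  by apply: sumr_ge0 => i _; exact: normc_ge0.
rewrite /B; have := h n nn; have := normcBge (u n) l; lra.
Qed.

Lemma series_terms_bounded (a : nat -> R[i]) z l :
  [series a n * z ^+ n]_n @ \oo --> l -> exists2 B, 0 < B & forall n, normc (a n) * normc z ^+ n <= B.
Proof.
move=> /cvg_tends/tends_bounded[B B0 h]; exists (2 * B); first by rewrite mulr_gt0.
move=> n; rewrite -normcXn -Normc.normcM.
have -> : a n * z ^+ n = series (fun n => a n * z ^+ n) n.+1 - series (fun n => a n * z ^+ n) n.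
  by rewrite /series /= big_nat_recr //= [_ + a n * _]addrC addrK.
apply: le_trans (normcB _ _) _; have := h n; have := h n.+1; rewrite /series /=; lra.
Qed.

(* A power series at a point near [expi s] that continues [f] across the unit
   circle, with bounds that can be made uniform in [s]. *)
Definition continues_at (f : R[i] -> R[i]) (q B s : R) : Prop :=
  exists (xi : R[i]) (b : nat -> R[i]) (r : R),
    [/\ normc (expi s - xi) <= r / 8, q <= r / 16, forall j, normc (b j) * r ^+ j <= B &
     forall w, normc w < 1 -> normc (w - xi) < r ->
       [series b n * (w - xi) ^+ n]_n @ \oo --> f w].

Lemma continues_at_mono f q q' B B' s : q' <= q -> B <= B' -> continues_at f q B s -> continues_at f q' B' s.
Proof.
move=> qq BB [xi [b [r [h1 h2 h3 h4]]]]; exists xi, b, r; split => //.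
  exact: le_trans h2.
by move=> j; apply: le_trans BB.
Qed.

(** The bound [B] comes from convergence at the single point [expi s + r], with [r] half of the
    available radius; the same expansion serves every [s'] within [r / 8]. *)
Lemma analytic_continues_at (f F : R[i] -> R[i]) (s : R) :
  analytic_at F (expi s) -> (forall z, unit_disc R z -> F z = f z) ->
  exists d q B, [/\ 0 < d, 0 < q & forall s', `|s' - s| <= d -> continues_at f q B s'].
Proof.
move=> [b /nbhs_normc[r0 r00 h]] Ff.
pose r := r0 / 2; have r1 : 0 < r by rewrite divr_gt0.
have hr : normc ((expi s + r%:C%C) - expi s) < r0.
  by rewrite addrC addKr normc_real gtr0_norm // /r; lra.
have [B B0 hB] := series_terms_bounded (h _ hr).
exists (r / 8), (r / 16), B; split; rewrite ?divr_gt0 // => s' ss.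
exists (expi s), b, r; split => //.
- by apply: le_trans (chord_le _ _) ss.
- by move=> j; have := hB j; rewrite addrC addKr normc_real gtr0_norm.
move=> w w1 wr; rewrite -Ff; first by apply: h; apply: lt_trans wr _; rewrite /r; lra.
by rewrite /unit_disc /= normr_normc ltcR.
Qed.

(** Compactness makes [q] and [B] uniform. As the expansion used at the endpoint also covers nearby
    points, the bounds hold on a strictly longer arc, which gives the proof its room. *)
Lemma arc_continues_at (f : R[i] -> R[i]) (t l : R) : 0 <= l ->
  ~ has_singularity_on f (closed_arc t l) ->
  exists q B d, [/\ 0 < q <= 16^-1, 0 < d & forall s, t <= s <= t + l + d -> continues_at f q B s].
Proof.
move=> l0 /contrapT[U [F [oU sU an Ff]]].
(* A single index controls the three quantities: radius and [q] are [1 / (n + 1)], the bound is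
   [n]. *)
pose P (n : nat) (s : R) := forall s', `|s' - s| <= n.+1%:R^-1 -> continues_at f n.+1%:R^-1 n%:R s'.
have cK : compact (`[t, t + l]%classic : set R) by exact: segment_compact.
have cov := (compact_near_coveringP _).1 cK.
have cP : forall s : R, (`[t, t + l]%classic : set R) s -> \forall s' \near s & n \near \oo, P n s'.
  move=> s sK; have anF : analytic_at F (expi s) by apply: an; right; apply: sU; exists s.
  have [d [q [B [d0 q0 hg]]]] := analytic_continues_at anF Ff.
  have e0 : 0 < Num.min (d / 2) q by rewrite lt_min divr_gt0.
  have nn : \forall n \near \oo, n.+1%:R^-1 < Num.min (d / 2) q by exact: near_infty_natSinv_lt (PosNum e0).
  have nB : \forall n \near \oo, B <= n%:R by exact: nbhs_infty_ger.
  near=> s' n => s'' ss.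
  have h1 : n.+1%:R^-1 < Num.min (d / 2) q by near: n.
  have h2 : B <= n%:R by near: n.
  have h3 : `|s - s'| < d / 2 by near: s'; apply: cvgr_dist_lt => //; rewrite divr_gt0.
  move: h1; rewrite lt_min => /andP[h11 h12].
  apply: (continues_at_mono (ltW h12) h2); apply: hg.
  have -> : s'' - s = (s'' - s') - (s - s') by ring.
  apply: le_trans (ler_normB _ _) _.
  by rewrite (splitr d); apply: lerD; [exact: le_trans ss (ltW h11) | exact: ltW].
have [n0 _ hn] := cov nat (nbhs \oo) P _ cP.
(* [n >= 15] yields [q = 1 / (n + 1) <= 1/16]. *)
pose n := maxn n0 15; have Pn s : s \in `[t, t + l] -> P n s.
  by move=> sK; apply: (hn n) => //=; exact: leq_maxl.
have n10 : 0 < n.+1%:R^-1 :> R by rewrite invr_gt0.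
exists n.+1%:R^-1, n%:R, n.+1%:R^-1; split => //.
  by rewrite n10 lef_pV2 ?posrE // ler_nat /n ltnS leq_maxr.
move=> s /andP[ts sl]; have [sl'|sl'] := leP s (t + l).
  by apply: (Pn s); rewrite ?in_itv /= ?ts ?sl' // subrr normr0 ltW.
apply: (Pn (t + l)); first by rewrite in_itv /= lexx lerDl l0.
by rewrite ger0_norm ?subr_ge0 ?(ltW sl') // lerBlDl.
Unshelve. all: by end_near.
Qed.

End ComplexLimits.

(** * Averages over small circles and binomial weights *)

Section BinomialAverage.
Context {R : realType}.
Implicit Types (y v : R[i]).

(** For [n < M], the Fourier coefficient of index [n] of [(y + v om^l)^j] over the [M]-th roots of
    unity: aliasing collects all [i] congruent to [n]. For [j < M] only [i = n] can occur. *)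
Definition binpart (M n : nat) y v j : R[i] :=
  \sum_(i < j.+1 | (i %% M == n)%N) 'C(j, i)%:R * y ^+ (j - i) * v ^+ i.

Lemma sum_om_mod M n i : (n < M)%N ->
  \sum_(l < M) (om M ^+ l) ^+ i * ((om M ^+ l)^*)%C ^+ n = (if (i %% M == n)%N then M%:R else 0) :> R[i].
Proof.
move=> nM; have M0 : (0 < M)%N by apply: leq_ltn_trans nM.
rewrite -(sum_om_conj M0 (ltn_pmod i M0) nM); apply: eq_bigr => l _; congr (_ * _).
rewrite {1}(divn_eq i M) exprD mulnC exprM -[(om M ^+ l) ^+ M]exprM mulnC exprM om_prim //.
by rewrite !expr1n mul1r.
Qed.

Lemma average_binpart M n y v j : (n < M)%N ->
  \sum_(l < M) (y + v * om M ^+ l) ^+ j * (((om M ^+ l)^*)%C ^+ n / M%:R) = binpart M n y v j.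
Proof.
move=> nM; have M0 : (M%:R : R[i]) != 0 by rewrite pnatr_eq0 -lt0n (leq_ltn_trans _ nM).
transitivity (\sum_(i < j.+1) 'C(j, i)%:R * y ^+ (j - i) * v ^+ i / M%:R *
    \sum_(l < M) (om M ^+ l) ^+ i * ((om M ^+ l)^*)%C ^+ n).
  under [RHS]eq_bigr do rewrite mulr_sumr.
  rewrite [RHS]exchange_big /=; apply: eq_bigr => l _.
  rewrite exprDn mulr_suml; apply: eq_bigr => i _.
  by rewrite -mulr_natl exprMn; ring.
rewrite /binpart [RHS]big_mkcond /=; apply: eq_bigr => i _; rewrite sum_om_mod //.
by case: ifP => _; rewrite ?mulr0 // divfK.
Qed.

Lemma binpart_small M n (p q : R) j : (j < M)%N -> (n < M)%N ->
  binpart M n p%:C%C q%:C%C j = ('C(j, n)%:R * p ^+ (j - n) * q ^+ n)%:C%C.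
Proof.
move=> jM nM; rewrite /binpart !rmorphM !rmorphXn rmorph_nat /=.
have [nj|jn] := leqP n j; last first.
  rewrite bin_small // !mul0r big1 // => i /eqP; rewrite modn_small; last first.
    by apply: leq_ltn_trans jM; rewrite -ltnS.
  by move=> ein; have := ltn_ord i; rewrite ein ltnS leqNgt jn.
rewrite (bigD1 (Ordinal (nj : (n < j.+1)%N))) /=; last by rewrite modn_small.
rewrite [X in _ + X]big1 ?addr0 // => i /andP[/eqP h]; rewrite -val_eqE /=.
rewrite modn_small in h; first by rewrite h eqxx.
by apply: leq_ltn_trans jM; rewrite -ltnS.
Qed.

(** Cauchy's estimate on a circle enlarged by [lam]: every [i] in the sum is at least [n], so
    [lam^n <= lam^i]. The value 2 of [lam] yields the factor [2^-n], the value 1 a plain bound. *)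
Lemma binpart_le M n y v j (lam Y V : R) : 1 <= lam -> normc y <= Y -> normc v <= V ->
  normc (binpart M n y v j) * lam ^+ n <= (Y + lam * V) ^+ j.
Proof.
move=> l1 yY vV; have l0 : 0 <= lam by apply: le_trans l1.
have Y0 : 0 <= Y by apply: le_trans yY; exact: normc_ge0.
have V0 : 0 <= V by apply: le_trans vV; exact: normc_ge0.
apply: (@le_trans _ _ (\sum_(i < j.+1 | (i %% M == n)%N) 'C(j, i)%:R * Y ^+ (j - i) * (lam * V) ^+ i)).
  apply: (@le_trans _ _ ((\sum_(i < j.+1 | (i %% M == n)%N) normc ('C(j, i)%:R * y ^+ (j - i) * v ^+ i)) * lam ^+ n)).
    by rewrite ler_wpM2r ?exprn_ge0 // normc_sum.
  rewrite mulr_suml; apply: ler_sum => i /eqP hi.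
  have -> : 'C(j, i)%:R * Y ^+ (j - i) * (lam * V) ^+ i = 'C(j, i)%:R * (Y ^+ (j - i) * (V ^+ i * lam ^+ i)).
    by rewrite exprMn; ring.
  rewrite !Normc.normcM !normcXn normc_nat -!mulrA.
  rewrite ler_wpM2l //; apply: ler_pM; rewrite ?exprn_ge0 ?mulr_ge0 ?exprn_ge0 ?normc_ge0 //.
    by rewrite lerXn2r ?nnegrE ?normc_ge0.
  apply: ler_pM; rewrite ?exprn_ge0 ?normc_ge0 //.
    by rewrite lerXn2r ?nnegrE ?normc_ge0.
  by apply: ler_weXn2l => //; rewrite -hi leq_mod.
rewrite exprDn [leRHS](bigID (fun i : 'I_j.+1 => (i %% M == n)%N)) /=.
have pos (i : 'I_j.+1) : 'C(j, i)%:R * Y ^+ (j - i) * (lam * V) ^+ i = Y ^+ (j - i) * (lam * V) ^+ i *+ 'C(j, i).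
  by rewrite -[RHS]mulr_natl mulrA.
under eq_bigr do rewrite pos.
by rewrite lerDl sumr_ge0 // => i _; rewrite mulrn_wge0 // mulr_ge0 ?exprn_ge0 // mulr_ge0.
Qed.

End BinomialAverage.

Section ExpAsymptotics.
Context {R : realType}.

Lemma linear_le_expR (K delta : R) : 0 < delta ->
  exists m0, forall m, (m0 <= m)%N -> K * m.+1%:R <= expR (delta * m%:R).
Proof.
move=> d0; pose x := 4 * `|K| / delta ^+ 2; exists (Num.truncn x).+1 => m mm.
have m0 : (0 < m)%N by apply: leq_ltn_trans mm.
have m1 : 1 <= m%:R :> R by rewrite ler1n.
have xm : x <= m%:R.
  have x0 : 0 <= x by rewrite /x divr_ge0 ?sqr_ge0 // mulr_ge0.
  by have /andP[_ /ltW h] := truncn_itv x0; apply: le_trans h _; rewrite ler_nat.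
have e := expR_ge1Dxn 1 (mulr_ge0 (ltW d0) (ler0n R m)).
apply: le_trans (le_trans _ e); last exact: lexx.
have h1 : K * m.+1%:R <= `|K| * (2 * m%:R).
  apply: (@le_trans _ _ (`|K| * m.+1%:R)); first by rewrite ler_wpM2r // ler_norm.
  by rewrite ler_wpM2l // -natrM ler_nat mul2n -addnn -add1n leq_add2r.
apply: le_trans h1 _.
have -> : (2`!)%:R = 2 :> R by [].
have : x * delta ^+ 2 * m%:R <= m%:R * delta ^+ 2 * m%:R.
  by rewrite !ler_wpM2r ?sqr_ge0.
rewrite /x divfK; last by rewrite expf_neq0 // gt_eqF.
have -> : m%:R * delta ^+ 2 * m%:R = (delta * m%:R) ^+ 2 by ring.
move: ((delta * m%:R) ^+ 2) => X; move: (`|K|) (m%:R) => k n h; lra.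
Qed.

Lemma expRXn (x : R) n : expR x ^+ n = expR (n%:R * x).
Proof. by rewrite expRM_natl. Qed.

Lemma sum_geom_le (A th : R) (N J : nat) : 0 <= A -> 0 <= th < 1 ->
  \sum_(N <= j < J) A * th ^+ j <= A * th ^+ N / (1 - th).
Proof.
move=> A0 /andP[t0 t1]; rewrite -mulr_sumr -mulrA ler_wpM2l //.
have [JN|NJ] := leqP J N.
  by rewrite big_geq // divr_ge0 ?exprn_ge0 // subr_ge0 ltW.
rewrite ler_pdivlMr ?subr_gt0 // mulr_suml.
under eq_bigr do rewrite mulrBr mulr1 -exprSr.
have -> : \sum_(N <= j < J) (th ^+ j - th ^+ j.+1) = th ^+ N - th ^+ J.
  have := @telescope_sumr R N J (fun j => - th ^+ j) (ltnW NJ); rewrite opprK addrC => <-.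
  by apply: eq_bigr => j _; rewrite opprK addrC.
by rewrite gerBl exprn_ge0.
Qed.

End ExpAsymptotics.

Section ExpSum.
Context {R : realType}.

Lemma binom_term_le (X Y : R) j n : 0 <= X -> 0 <= Y -> 'C(j, n)%:R * X ^+ (j - n) * Y ^+ n <= (X + Y) ^+ j.
Proof.
move=> X0 Y0; have [nj|jn] := leqP n j; last first.
  by rewrite bin_small // !mul0r exprn_ge0 // addr_ge0.
rewrite exprDn (bigD1 (Ordinal (nj : (n < j.+1)%N))) //= -[X in _ <= X + _]mulr_natl mulrA lerDl.
by rewrite sumr_ge0 // => i _; rewrite mulrn_wge0 // mulr_ge0 ?exprn_ge0.
Qed.

Lemma sum_half_le (B : R) J : 0 <= B -> \sum_(0 <= j < J) B * 2^-1 ^+ j <= 2 * B.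
Proof.
move=> B0; apply: le_trans (sum_geom_le 0 J B0 _) _; first by apply/andP; split; lra.
by rewrite expr0 mulr1 le_eqVlt; apply/orP; left; apply/eqP; field.
Qed.

(** The Fourier coefficient of index [n] of [f] on the circle of radius [q] about [p * expi s] is
    computed twice. The series about [xi] converges with room to spare, whence [2^-n]. The Taylor
    series at 0 yields the binomial weights; its terms from [N] to [M] give the last summand of the
    bound, and those beyond [M], where aliasing occurs, vanish as [M] grows. *)
Lemma arc_sum_le (a : nat -> R[i]) (f : R[i] -> R[i]) (q B s p A delta : R) (n N : nat) :
  (forall z, unit_disc R z -> [series a n * z ^+ n]_n @ \oo --> f z) ->
  continues_at f q B s -> 0 < q -> 0 < p -> p + q < 1 -> 1 - p <= 2 * q ->
  0 <= A -> (forall j, normc (a j) <= A * expR delta ^+ j) ->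
  expR delta * (p + q / 2) < 1 -> expR delta * (p + q) < 1 -> (n < N)%N ->
  normc (\sum_(j < N) a j * ('C(j, n)%:R * p ^+ (j - n) * q ^+ n)%:C%C * expi (j%:R * s))
   <= 2 * B / 2 ^+ n + A * 2 ^+ n * (expR delta * (p + q / 2)) ^+ N / (1 - expR delta * (p + q / 2)).
Proof.
move=> hf [xi [b [r [sxi qr bB bf]]]] q0 p0 pq1 p1 A0 aA th1 rh1 nN.
set th := expR delta * _ in th1 *; set rh := expR delta * _ in rh1.
have th0 : 0 <= th by rewrite mulr_ge0 ?expR_ge0 //; lra.
have rh0 : 0 <= rh by rewrite mulr_ge0 ?expR_ge0 //; lra.
have r0 : 0 < r by lra.
have B0 : 0 <= B.
  by apply: le_trans (bB 0%N); rewrite mulr_ge0 ?normc_ge0 // exprn_ge0 // ltW.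
set W := fun j => 'C(j, n)%:R * p ^+ (j - n) * q ^+ n.
have W0 j : 0 <= W j by rewrite /W !mulr_ge0 ?exprn_ge0 // ltW.
apply/ler_addgt0Pr => e e0.
have e2 : 0 < e / 2 by rewrite divr_gt0.
have [M NM hM] : exists2 M, (N < M)%N & A * rh ^+ M / (1 - rh) <= e / 2.
  have c : A * rh ^+ M / (1 - rh) @[M --> \oo] --> A * 0 / (1 - rh).
    apply: cvgM; last exact: cvg_cst.
    by apply: cvgM; [exact: cvg_cst | apply: cvg_expr; rewrite ger0_norm].
  rewrite mulr0 mul0r in c.
  have := cvgr_lt _ c (e / 2) e2 => -[M0 _ hM].
  exists (maxn M0 N.+1); first by rewrite leq_max ltnSn orbT.
  by apply/ltW/hM; rewrite /= leq_maxl.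
have nM : (n < M)%N by apply: ltn_trans NM.
have M0 : (0 < M)%N by apply: leq_ltn_trans nM.
pose w (l : nat) := p%:C%C * expi s + q%:C%C * expi s * om M ^+ l.
have wE l : w l = expi s * (p%:C%C + q%:C%C * om M ^+ l) by rewrite /w; ring.
have w1 l : normc (w l) < 1.
  apply: le_lt_trans (normcD _ _) _.
  by rewrite !Normc.normcM normc_omX normc_expi !mulr1 !normc_real !gtr0_norm.
pose c (l : 'I_M) : R[i] := ((om M ^+ l)^*)%C ^+ n / M%:R.
pose avg := \sum_(l < M) f (w l) * c l.
have avg_le : normc avg <= 2 * B / 2 ^+ n.
  have tl : tends (fun J => \sum_(l < M) series (fun j => b j * (w l - xi) ^+ j) J * c l) avg.
    apply: (@tends_sum R 'I_M _ (fun l J => series (fun j => b j * (w l - xi) ^+ j) J) (fun l => f (w l)) c) => l.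
    apply: cvg_tends; apply: bf => //.
    have -> : w l - xi = (expi s - xi) - (1 - p)%:C%C * expi s + q%:C%C * expi s * om M ^+ l.
      by rewrite /w rmorphB /=; ring.
    apply: le_lt_trans (normcD _ _) _.
    have h1 : normc ((expi s - xi) - (1 - p)%:C%C * expi s) <= r / 8 + 2 * q.
      apply: le_trans (normcB _ _) _; apply: lerD => //.
      by rewrite Normc.normcM normc_expi mulr1 normc_real ger0_norm //; lra.
    rewrite !Normc.normcM normc_omX normc_expi !mulr1 normc_real gtr0_norm //; lra.
  apply: (tends_le tl) => J.
  have -> : \sum_(l < M) series (fun j => b j * (w l - xi) ^+ j) J * c l
     = \sum_(0 <= j < J) b j * binpart M n (p%:C%C * expi s - xi) (q%:C%C * expi s) j.
    rewrite /series /=; under eq_bigr do rewrite mulr_suml.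
    rewrite exchange_big /=; apply: eq_bigr => j _.
    rewrite -average_binpart // mulr_sumr; apply: eq_bigr => l _.
    by rewrite -[LHS]mulrA /w addrAC.
  apply: le_trans (normc_sum _ _ _) _.
  have -> : 2 * B / 2 ^+ n = 2 * (B / 2 ^+ n) by rewrite mulrA.
  apply: le_trans (sum_half_le J _); last by rewrite divr_ge0 // exprn_ge0.
  apply: ler_sum => j _; rewrite Normc.normcM.
  (* [r / 8] comes from [xi] and [1 - p <= 2 q <= r / 8] from the shift; the doubled radius [2 q]
     adds [r / 8], so [3 r / 8 <= r / 2] is not exceeded. *)
  have y1 : normc (p%:C%C * expi s - xi) <= r / 4.
    have -> : p%:C%C * expi s - xi = (expi s - xi) - (1 - p)%:C%C * expi s.
      by rewrite rmorphB /=; ring.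
    apply: le_trans (normcB _ _) _.
    by rewrite [normc (_ * _)]Normc.normcM normc_expi mulr1 normc_real ger0_norm //; lra.
  have v1 : normc (q%:C%C * expi s) <= r / 16.
    by rewrite Normc.normcM normc_expi mulr1 normc_real gtr0_norm.
  have := @binpart_le R M n _ _ j 2 _ _ _ y1 v1; rewrite ler1n => /(_ isT) h.
  have {}h : normc (binpart M n (p%:C%C * expi s - xi) (q%:C%C * expi s) j) * 2 ^+ n <= (r / 2) ^+ j.
    by apply: le_trans h _; rewrite lerXn2r ?nnegrE; lra.
  rewrite mulrAC ler_pdivlMr ?exprn_gt0 // -mulrA.
  apply: (@le_trans _ _ (normc (b j) * (r / 2) ^+ j)); first by rewrite ler_wpM2l ?normc_ge0.
  by rewrite exprMn mulrA ler_wpM2r ?exprn_ge0 //; lra.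
have ta : tends (fun J => \sum_(l < M) series (fun j => a j * w l ^+ j) J * c l) avg.
  apply: (@tends_sum R 'I_M _ (fun l J => series (fun j => a j * w l ^+ j) J) (fun l => f (w l)) c) => l.
  by apply: cvg_tends; apply: hf; rewrite /unit_disc /= normr_normc ltcR.
have [J0 hJ] := ta _ e2; pose J := maxn J0 M; have := hJ J (leq_maxl _ _).
have MJ : (M <= J)%N by exact: leq_maxr.
have -> : \sum_(l < M) series (fun j => a j * w l ^+ j) J * c l
   = \sum_(0 <= j < J) a j * binpart M n p%:C%C q%:C%C j * expi (j%:R * s).
  rewrite /series /=; under eq_bigr do rewrite mulr_suml.
  rewrite exchange_big /=; apply: eq_bigr => j _.
  rewrite -average_binpart // mulr_sumr mulr_suml; apply: eq_bigr => l _.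
  rewrite wE exprMn expiX -/(c l); move: ((p%:C%C + _) ^+ _) => Xj; ring.
rewrite (@big_cat_nat _ _ _ N) //=; last by apply: leq_trans MJ; apply: ltnW.
rewrite (@big_cat_nat _ _ _ M N J) //=; last exact: ltnW.
set S1 := \sum_(0 <= j < N) _; set S2 := \sum_(N <= j < M) _; set S3 := \sum_(M <= j < J) _.
move=> hS.
have S1E : S1 = \sum_(j < N) a j * (W j)%:C%C * expi (j%:R * s).
  rewrite /S1 big_mkord; apply: eq_bigr => j _; congr (_ * _ * _).
  by rewrite binpart_small // (ltn_trans (ltn_ord j)).
have S2le : normc S2 <= A * 2 ^+ n * th ^+ N / (1 - th).
  apply: le_trans (normc_sum _ _ _) _.
  apply: le_trans (sum_geom_le N M (mulr_ge0 A0 (exprn_ge0 n (ler0n R 2))) _); last by rewrite th0.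
  rewrite !big_nat; apply: ler_sum => j /andP[Nj jM].
  rewrite !Normc.normcM normc_expi mulr1 binpart_small // normc_real ger0_norm; last exact: W0.
  rewrite /th exprMn mulrACA; apply: ler_pM; rewrite ?normc_ge0 ?W0 ?aA //.
  (* Since [q^n = 2^n (q / 2)^n], the weight is at most [2^n (p + q / 2)^j]. *)
  have := @binom_term_le p (q / 2) j n (ltW p0) (ltW (divr_gt0 q0 (ltr0Sn R 1))).
  move=> h; have := ler_wpM2l (exprn_ge0 n (ler0n R 2)) h; apply: le_trans; rewrite /W.
  rewrite exprMn exprVn le_eqVlt; apply/orP; left; apply/eqP; field.
  by rewrite expf_neq0 // pnatr_eq0.
have S3le : normc S3 <= e / 2.
  apply: le_trans hM; apply: le_trans (normc_sum _ _ _) _.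
  apply: le_trans (sum_geom_le M J A0 _); last by rewrite rh0.
  apply: ler_sum => j _; rewrite !Normc.normcM normc_expi mulr1 /rh exprMn mulrA.
  apply: ler_pM; rewrite ?normc_ge0 ?aA //.
  have pp : normc (p%:C%C : R[i]) <= p by rewrite normc_real gtr0_norm.
  have qq : normc (q%:C%C : R[i]) <= q by rewrite normc_real gtr0_norm.
  by have := @binpart_le R M n _ _ j 1 _ _ (lexx 1) pp qq; rewrite expr1n mulr1 mul1r.
rewrite -S1E.
have -> : S1 = (S1 + (S2 + S3) - avg) + (avg - (S2 + S3)) by ring.
apply: le_trans (normcD _ _) _.
have h2 := le_trans (normcB avg (S2 + S3)) (lerD avg_le (le_trans (normcD _ _) (lerD S2le S3le))).
apply: le_trans (lerD (ltW hS) h2) _.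
move: (2 * B / _) (_ / (1 - th)) => X Y; lra.
Qed.

End ExpSum.

Section ExpSumSmall.
Context {R : realType}.

Lemma exprn_small (x e : R) : 0 <= x < 1 -> 0 < e -> exists2 k, (1 < k)%N & x ^+ k <= e.
Proof.
move=> /andP[x0 x1] e0.
have c : x ^+ k @[k --> \oo] --> (0 : R) by apply: cvg_expr; rewrite ger0_norm.
have [k0 _ h] := cvgr_lt _ c e e0.
by exists (maxn k0 2); [rewrite leq_max orbT | apply/ltW/h; rewrite /= leq_maxl].
Qed.

(** The terms of [(p + q)^m] below index [m / k] sum to at most half of it: replacing [q] by [q / 2]
    costs them at most [2^(m / k)], while [p + q / 2 <= (1 - q / 2) (p + q)]. Among the others one
    is at least average up to a constant. The lower bound on [n] is what makes [2^-n] exponentially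
    small in [m]. *)
Lemma binomial_mode (p q : R) (k m : nat) : 0 < p -> 0 < q -> p + q <= 1 ->
  (0 < k <= m)%N -> 2 * (1 - q / 2) ^+ k <= 2^-1 ->
  exists2 n, (m %/ k <= n <= m)%N &
    (p + q) ^+ m <= 4 * m.+1%:R * ('C(m, n)%:R * p ^+ (m - n) * q ^+ n).
Proof.
move=> p0 q0 pq /andP[k0 km] hk.
apply: contrapT => nex.
pose T i := 'C(m, i)%:R * p ^+ (m - i) * q ^+ i.
have T0 i : 0 <= T i by rewrite !mulr_ge0 ?exprn_ge0 // ltW.
have P0 : 0 < (p + q) ^+ m by rewrite exprn_gt0 // addr_gt0.
set n0 := (m %/ k)%N in nex.
have n00 : (0 < n0)%N by rewrite divn_gt0.
have large i : (n0 <= i <= m)%N -> 4 * m.+1%:R * T i <= (p + q) ^+ m.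
  move=> im; rewrite leNgt; apply/negP => h; apply: nex; exists i => //; exact: ltW.
have tot : \sum_(i < m.+1) T i = (p + q) ^+ m.
  by rewrite exprDn; apply: eq_bigr => i _; rewrite /T -[RHS]mulr_natl mulrA.
have low : \sum_(i < m.+1 | (i < n0)%N) T i <= (p + q) ^+ m / 2.
  apply: (@le_trans _ _ (2 ^+ n0 * (p + q / 2) ^+ m)).
    rewrite [(p + q / 2) ^+ m]exprDn mulr_sumr [leRHS](bigID (fun i : 'I_m.+1 => (i < n0)%N)) /= -[leLHS]addr0.
    apply: lerD; last by apply: sumr_ge0 => i _; rewrite mulr_ge0 ?exprn_ge0 // mulrn_wge0 // mulr_ge0 ?exprn_ge0 ?divr_ge0 // ltW.
    apply: ler_sum => i /ltnW hi; rewrite -[_ *+ 'C(_, _)]mulr_natl.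
    have -> : T i = 2 ^+ i * ('C(m, i)%:R * (p ^+ (m - i) * (q / 2) ^+ i)).
      by rewrite /T exprMn exprVn; field; rewrite expf_neq0 // pnatr_eq0.
    rewrite ler_wpM2r //; first by rewrite mulr_ge0 // mulr_ge0 ?exprn_ge0 ?divr_ge0 // ltW.
    by apply: ler_weXn2l => //; rewrite ler1n.
  apply: (@le_trans _ _ (2 ^+ n0 * ((1 - q / 2) ^+ m * (p + q) ^+ m))).
    rewrite ler_wpM2l ?exprn_ge0 // -exprMn lerXn2r ?nnegrE; [by []|lra| |nra].
    by rewrite mulr_ge0; lra.
  rewrite mulrA mulrC ler_pM2l //.
  apply: (@le_trans _ _ ((2 * (1 - q / 2) ^+ k) ^+ n0)).
    rewrite exprMn ler_wpM2l ?exprn_ge0 // -exprM ler_wiXn2l ?leq_trunc_div //; try lra.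
    by rewrite mulnC leq_trunc_div.
  apply: (@le_trans _ _ (2^-1 ^+ n0)).
    by rewrite lerXn2r ?nnegrE // ?invr_ge0 // mulr_ge0 // exprn_ge0; lra.
  by rewrite -{2}[2^-1]expr1 ler_wiXn2l //; lra.
have high : \sum_(i < m.+1 | ~~ (i < n0)%N) T i <= (p + q) ^+ m / 4.
  apply: (@le_trans _ _ (\sum_(i < m.+1 | ~~ (i < n0)%N) (p + q) ^+ m / (4 * m.+1%:R))).
    apply: ler_sum => i hi; rewrite ler_pdivlMr ?mulr_gt0 // mulrC; apply: large.
    by rewrite leqNgt hi /= -ltnS.
  apply: (@le_trans _ _ (\sum_(i < m.+1) (p + q) ^+ m / (4 * m.+1%:R))).
    rewrite [leRHS](bigID (fun i : 'I_m.+1 => (i < n0)%N)) /= lerDr sumr_ge0 // => i _.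
    by rewrite divr_ge0 ?mulr_ge0 // ltW.
  rewrite sumr_const card_ord -[leLHS]mulr_natr le_eqVlt; apply/orP; left; apply/eqP; field.
  by rewrite addrC natr1 pnatr_eq0.
move: tot; rewrite (bigID (fun i : 'I_m.+1 => (i < n0)%N)) /= => tot; lra.
Qed.

(** [c] and [C] come from [q] alone, before [eps]; then [p] is chosen with [p + q = expR (- d1)] as
    close to 1 as [eps] demands. The binomial weights are normalized at [m], which by
    [binomial_mode] costs at most [4 (m + 1) expR (d1 m)], against the gain [2^-n] with
    [n >= m / k]. *)
Lemma exp_sum_small (a : nat -> R[i]) (f : R[i] -> R[i]) (q B t len : R) :
  (forall z, unit_disc R z -> [series a n * z ^+ n]_n @ \oo --> f z) ->
  0 < q <= 16^-1 -> (forall s, t <= s <= t + len -> continues_at f q B s) ->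
  exists (c : R) (C : nat), [/\ 0 < c, (1 < C)%N & forall eps, 0 < eps -> exists m1, forall m, (m1 <= m)%N ->
    exists cc : nat -> R[i], [/\ cc m = a m, forall j, a j = 0 -> cc j = 0,
      forall j, (j < C * m)%N -> normc (cc j) <= expR (eps * m%:R) &
      forall s, t <= s <= t + len ->
        normc (\sum_(j < C * m) cc j * expi (j%:R * s)) <= expR (- c * m%:R)]].
Proof.
move=> hf /andP[q0 q16] hgood.
have [k k1 hk] : exists2 k, (1 < k)%N & (1 - q / 2) ^+ k <= 4^-1.
  by apply: exprn_small; lra.
have hk2 : 2 * (1 - q / 2) ^+ k <= 2^-1 by lra.
pose th := expR (- (q / 4)).
have th0 : 0 <= th by exact: expR_ge0.
have th1 : th < 1 by rewrite -expR0 ltr_expR; lra.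
(* [th^C <= 1/8] beats the factor [2^n] of the tail: [2^n 8^-m <= 2^-n] for [n <= m]. *)
have [C C1 hC] : exists2 C, (1 < C)%N & th ^+ C <= 8^-1.
  by apply: exprn_small; rewrite ?th0.
have k0 : 0 < k%:R :> R by rewrite ltr0n ltnW.
have C0 : 0 < C%:R :> R by rewrite ltr0n ltnW.
pose b := ln 2 / k%:R : R.
have l20 : 0 < ln 2 :> R by rewrite ln_gt0 // ltr1n.
have b0 : 0 < b by rewrite divr_gt0.
exists (b / 2), C; split=> //; first by rewrite divr_gt0.
move=> eps e0.
(* [d1 <= q] gives [1 - p <= 2 q]; the other two bounds limit the cost of the normalization, in the
   size of [cc] and in the decay on the arc. *)
pose d1 := Num.min (eps / 4) (Num.min (b / 4) q).
have d10 : 0 < d1 by rewrite !lt_min !divr_gt0.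
have [d1e d1b d1q] : [/\ d1 <= eps / 4, d1 <= b / 4 & d1 <= q].
  by rewrite /d1 !ge_min !lexx !orbT.
(* Growth rate granted to the [a j]: [d1 / 2] keeps the series convergent on the small circle,
   [eps / (4 C)] handles the indices below [C m], and [q / 4] keeps the tail ratio at most [th]. *)
pose d2 := Num.min (d1 / 2) (Num.min (eps / (4 * C%:R)) (q / 4)).
have d20 : 0 < d2 by rewrite !lt_min !divr_gt0 // mulr_gt0.
have [d2d d2e d2q] : [/\ d2 <= d1 / 2, d2 <= eps / (4 * C%:R) & d2 <= q / 4].
  by rewrite /d2 !ge_min !lexx !orbT.
pose p := expR (- d1) - q.
have pqE : p + q = expR (- d1) by rewrite /p subrK.
have ed1 : 1 - d1 <= expR (- d1) by apply: expR_ge1Dx.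
have ed1' : expR (- d1) < 1 by rewrite -expR0 ltr_expR oppr_lt0.
have p0 : 0 < p by rewrite /p; lra.
have pq1 : p + q < 1 by rewrite pqE.
have p1 : 1 - p <= 2 * q by rewrite /p; lra.
have [A A0 hA] : exists2 A, 0 < A & forall j, normc (a j) <= A * expR d2 ^+ j.
  have z1 : unit_disc R (expR (- d2))%:C%C.
    by rewrite /unit_disc /= normr_normc ltcR normc_real ger0_norm ?expR_ge0 // -expR0 ltr_expR oppr_lt0.
  have [A A0 h] := series_terms_bounded (hf _ z1); exists A => // j.
  have := h j; rewrite normc_real ger0_norm ?expR_ge0 // expRN exprVn ler_pdivrMr //.
  by rewrite exprn_gt0 // expR_gt0.
have e2q : expR d2 * (p + q / 2) <= th.
  apply: (@le_trans _ _ (expR d2 * expR (- (q / 2)))).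
    rewrite ler_wpM2l ?expR_ge0 //; apply: le_trans (expR_ge1Dx _); rewrite /p; lra.
  by rewrite -expRD ler_expR; lra.
have e2q1 : expR d2 * (p + q / 2) < 1 by apply: le_lt_trans th1.
have e2q0 : 0 <= expR d2 * (p + q / 2) by rewrite mulr_ge0 ?expR_ge0 //; lra.
have e3 : expR d2 * (p + q) < 1.
  by rewrite pqE -expRD -expR0 ltr_expR; lra.
pose K := 8 * (2 * B + A / (1 - th)).
have [m1 hm1] := linear_le_expR (4 * A) (divr_gt0 e0 (ltr0Sn R 1)).
have [m2 hm2] := linear_le_expR K (divr_gt0 b0 (ltr0Sn R 3)).
exists (maxn k (maxn m1 m2)) => m; rewrite !geq_max => /and3P[km /hm1 {}hm1 /hm2 {}hm2].
have km' : (0 < k <= m)%N by rewrite km andbT ltnW.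
have [n /andP[n0 nm] hn] := binomial_mode p0 q0 (ltW pq1) km' hk2.
set N := (C * m)%N.
have m0 : (0 < m)%N by apply: leq_trans km; apply: ltnW.
have nN : (n < N)%N by apply: leq_ltn_trans nm _; rewrite /N ltn_Pmull.
pose W j := 'C(j, n)%:R * p ^+ (j - n) * q ^+ n.
have W0 j : 0 <= W j by rewrite !mulr_ge0 ?exprn_ge0 // ltW.
have m10 : 0 < 4 * m.+1%:R :> R by rewrite mulr_gt0.
have Wm : 0 < W m.
  rewrite -(pmulr_rgt0 _ m10); apply: lt_le_trans hn; rewrite exprn_gt0 //; lra.
have Winv : (W m)^-1 <= 4 * m.+1%:R * expR (d1 * m%:R).
  rewrite -[(W m)^-1]mul1r ler_pdivrMr //.
  apply: (@le_trans _ _ (expR (d1 * m%:R) * (p + q) ^+ m)).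
    by rewrite pqE expRXn -expRD mulrN mulrC subrr expR0.
  rewrite -[4 * _ * _ * _]mulrA mulrCA -mulrCA [leRHS]mulrCA ler_wpM2l ?expR_ge0 //.
pose cc j := a j * (W j / W m)%:C%C.
exists cc; split.
- by rewrite /cc divff ?gt_eqF // mulr1.
- by move=> j aj; rewrite /cc aj mul0r.
- move=> j jN; rewrite /cc Normc.normcM normc_real ger0_norm ?divr_ge0 // ?(ltW Wm) //.
  have Wj1 : W j <= 1.
    apply: le_trans (@binom_term_le R p q j n (ltW p0) (ltW q0)) _.
    by apply: exprn_ile1; lra.
  have aj : normc (a j) <= A * expR (eps / 4 * m%:R).
    apply: le_trans (hA j) _; rewrite ler_wpM2l ?(ltW A0) // expRXn ler_expR.
    apply: (@le_trans _ _ (N%:R * d2)); first by rewrite ler_wpM2r ?(ltW d20) // ler_nat ltnW.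
    apply: (@le_trans _ _ (N%:R * (eps / (4 * C%:R)))); first by rewrite ler_wpM2l.
    by rewrite /N natrM le_eqVlt; apply/orP; left; apply/eqP; field; rewrite gt_eqF.
  apply: (@le_trans _ _ (A * expR (eps / 4 * m%:R) * (4 * m.+1%:R * expR (eps / 4 * m%:R)))).
    apply: ler_pM; rewrite ?normc_ge0 ?divr_ge0 // ?(ltW Wm) //.
    apply: (@le_trans _ _ (W m)^-1); first by rewrite ler_piMl // invr_ge0 ltW.
    apply: le_trans Winv _; rewrite ler_wpM2l ?(ltW m10) // ler_expR ler_wpM2r //.
  have -> : expR (eps * m%:R) = expR (eps / 4 * m%:R) * expR (eps / 4 * m%:R) * expR (eps / 2 * m%:R).
    by rewrite -!expRD; congr expR; field.
  have -> : A * expR (eps / 4 * m%:R) * (4 * m.+1%:R * expR (eps / 4 * m%:R))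
    = expR (eps / 4 * m%:R) * expR (eps / 4 * m%:R) * (4 * A * m.+1%:R) by ring.
  by rewrite ler_wpM2l // mulr_ge0 ?expR_ge0.
move=> s hs.
have := @arc_sum_le R a f q B s p A d2 n N hf (hgood s hs) q0 p0 pq1 p1 (ltW A0) hA e2q1 e3 nN.
have -> : \sum_(j < N) cc j * expi (j%:R * s)
  = (W m)^-1%:C%C * \sum_(j < N) a j * (W j)%:C%C * expi (j%:R * s).
  by rewrite mulr_sumr; apply: eq_bigr => j _; rewrite /cc rmorphM /=; ring.
rewrite Normc.normcM normc_real gtr0_norm ?invr_gt0 // => hS.
have B0 : 0 <= B.
  have [xi [bb [r [h1 h2 h3 _]]]] := hgood s hs.
  by apply: le_trans (h3 0%N); rewrite expr0 mulr1 normc_ge0.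
have hS2 : 2 * B / 2 ^+ n + A * 2 ^+ n * (expR d2 * (p + q / 2)) ^+ N / (1 - expR d2 * (p + q / 2))
   <= (2 * B + A / (1 - th)) / 2 ^+ n.
  rewrite [leRHS]mulrDl lerD2l.
  have -> : A / (1 - th) / 2 ^+ n = A / 2 ^+ n / (1 - th) by rewrite mulrAC.
  apply: ler_pM.
  - by rewrite !mulr_ge0 ?exprn_ge0 // ltW.
  - by rewrite invr_ge0 subr_ge0 ltW.
  - rewrite -mulrA ler_wpM2l ?(ltW A0) //.
    apply: (@le_trans _ _ (2 ^+ n * 8^-1 ^+ m)).
      rewrite ler_wpM2l ?exprn_ge0 //; apply: (@le_trans _ _ (th ^+ N)).
        by rewrite lerXn2r ?nnegrE.
      by rewrite /N exprM lerXn2r ?nnegrE ?exprn_ge0.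
    rewrite -ler_pdivlMl ?exprn_gt0 // -invfM -exprMn.
    have -> : (2 * 2 : R) = 4 by ring.
    rewrite exprVn lef_pV2 ?posrE ?exprn_gt0 //.
    apply: (@le_trans _ _ (4 ^+ m)); first by apply: ler_weXn2l => //; rewrite ler1n.
    by rewrite lerXn2r ?nnegrE // ler_nat.
  - by rewrite lef_pV2 ?posrE ?subr_gt0 // lerB.
have pow : (2 ^+ n)^-1 <= 2 * expR (- (b * m%:R)).
  have e2 : expR (ln 2) = 2 :> R by rewrite lnK // posrE.
  rewrite -{1 2}e2 expRXn -expRN -expRD ler_expR -[n%:R * ln 2]mulrC -mulrN.
  have -> : ln 2 - b * m%:R = ln 2 * - (m%:R / k%:R - 1) :> R.
    by rewrite /b; field; rewrite gt_eqF.
  rewrite ler_wpM2l ?(ltW l20) // lerN2 lerBlDr ler_pdivrMr // natr1 -natrM ler_nat.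
  rewrite {1}(divn_eq m k); move: n0 (ltn_pmod m (ltnW k1)); clear; move=> h1 h2.
  apply: leq_trans (leq_add (leq_mul h1 (leqnn k)) (ltnW h2)) _.
  by rewrite mulSn addnC.
have KB : 0 <= 2 * B + A / (1 - th) by rewrite addr_ge0 ?divr_ge0 ?subr_ge0 ?(ltW A0) ?(ltW th1) // mulr_ge0.
apply: (@le_trans _ _ (4 * m.+1%:R * expR (d1 * m%:R) * ((2 * B + A / (1 - th)) * (2 * expR (- (b * m%:R)))))).
  apply: ler_pM; rewrite ?invr_ge0 ?normc_ge0 ?(ltW Wm) //.
  apply: le_trans hS (le_trans hS2 _); exact: ler_wpM2l.
have -> : 4 * m.+1%:R * expR (d1 * m%:R) * ((2 * B + A / (1 - th)) * (2 * expR (- (b * m%:R))))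
  = K * m.+1%:R * (expR (d1 * m%:R) * expR (- (b * m%:R))) by rewrite /K; ring.
apply: (@le_trans _ _ (expR (b / 4 * m%:R) * (expR (d1 * m%:R) * expR (- (b * m%:R))))).
  by rewrite ler_wpM2r // mulr_ge0 ?expR_ge0.
rewrite -!expRD ler_expR.
have -> : - (b / 2) * m%:R = b / 4 * m%:R + (b / 4 * m%:R - b * m%:R) by field.
by rewrite lerD2l lerD2r ler_wpM2r.
Qed.

End ExpSumSmall.

(** * From exponential sums to polynomials *)

Section DFT.
Context {R : realType}.

(** [Al] are the discrete Fourier coefficients of [cc] up to unimodular factors, read off the
    samples of [S]. Dropping the samples on the arc changes each value by at most [e] and leaves
    degree below [d0]. *)
Lemma dft_poly (N d0 : nat) (cc : nat -> R[i]) (t len e E : R) :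
  (0 < N)%N -> (d0 <= N)%N -> 2 * pi * (N - d0)%:R <= len * N%:R ->
  (forall j, (j < N)%N -> normc (cc j) <= E) ->
  (forall s, t <= s <= t + len -> normc (\sum_(j < N) cc j * expi (j%:R * s)) <= e) ->
  exists P : {poly R[i]}, [/\ (size P <= d0)%N,
    forall xi, normc xi = 1 -> normc P.[xi] <= N%:R * E &
    forall j, (j < N)%N -> exists2 phi, normc phi = 1 &
       normc (P.[((om N ^+ j)^*)%C] - cc j * phi) <= e].
Proof.
move=> N0 dN hlen hcc hS.
have N0' : 0 < N%:R :> R by rewrite ltr0n.
have NC : (N%:R : R[i]) != 0 by rewrite pnatr_eq0 -lt0n.
pose T := t + len; pose S s := \sum_(j < N) cc j * expi (j%:R * s).
(* Sampling starts at the right end [T] of the arc and goes round once; by the length assumption the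
   samples with [l >= d0] are back on the arc modulo [2 pi]. The shift by [T] is the origin of the
   factor [phi]. *)
pose s l : R := T + 2 * pi * l%:R / N%:R.
pose Al (l : nat) := S (s l) / N%:R.
have es j l : expi (j%:R * s l) = expi (j%:R * T) * (om N ^+ l) ^+ j.
  rewrite /s omX expiX -expiD; congr expi; ring.
have Sle x : normc (S x) <= N%:R * E.
  apply: le_trans (normc_sum _ _ _) _.
  rewrite mulr_natl -[in leRHS](card_ord N) -sumr_const; apply: ler_sum => j _.
  by rewrite Normc.normcM normc_expi mulr1 hcc.
have small l : (d0 <= l < N)%N -> normc (S (s l)) <= e.
  move=> /andP[dl lN].
  have -> : S (s l) = S (s l - 2 * pi).
    apply: eq_bigr => j _; congr (_ * _).
    have -> : j%:R * s l = j%:R * (s l - 2 * pi) + j%:R * (2 * pi) by ring.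
    by rewrite expiD -[expi (j%:R * (2 * pi))]expiX expi2pi expr1n mulr1.
  apply: hS; rewrite /s /T.
  have h1 : 2 * pi * (N%:R - l%:R) <= len * N%:R.
    apply: le_trans hlen; rewrite ler_pM2l ?mulr_gt0 ?pi_gt0 // natrB // lerD2l lerN2 ler_nat //.
  have h2 : 2 * pi * l%:R / N%:R <= 2 * pi :> R.
    by rewrite ler_pdivrMr // ler_pM2l ?mulr_gt0 ?pi_gt0 // ler_nat ltnW.
  have h3 : 2 * pi - len <= 2 * pi * l%:R / N%:R.
    by rewrite ler_pdivlMr //; lra.
  by apply/andP; split; lra.
have inv j : (j < N)%N -> \sum_(l < N) Al l * (((om N ^+ j)^*)%C) ^+ l = cc j * expi (j%:R * T).
  move=> jN.
  transitivity (\sum_(i < N) cc i * expi (i%:R * T) / N%:R *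
     \sum_(l < N) (om N ^+ l) ^+ i * (((om N ^+ l)^*)%C) ^+ j).
    under [RHS]eq_bigr do rewrite mulr_sumr.
    rewrite [RHS]exchange_big /=; apply: eq_bigr => l _.
    rewrite /Al /S !mulr_suml; apply: eq_bigr => i _; rewrite es.
    have -> : ((om N ^+ j)^*)%C ^+ l = ((om N ^+ l)^*)%C ^+ j :> R[i].
      by rewrite !conj_om // -!exprM; congr (_ ^+ _); rewrite mulnAC mulnC mulnA [(l * _)%N]mulnC mulnC mulnCA mulnA.
    by ring.
  rewrite (bigD1 (Ordinal jN)) //= [X in _ + X]big1 ?addr0; last first.
    by move=> i ij; rewrite sum_om_conj // (negPf (_ : val i != j)) ?mulr0.
  by rewrite sum_om_conj // eqxx divfK.
exists (\poly_(l < d0) Al l); split.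
- exact: size_poly.
- move=> xi xi1; rewrite horner_poly; apply: le_trans (normc_sum _ _ _) _.
  apply: (@le_trans _ _ (\sum_(l < d0) E)).
    apply: ler_sum => l _; rewrite Normc.normcM normcXn xi1 expr1n mulr1 /Al normc_div normc_nat.
    by rewrite ler_pdivrMr // mulrC.
  rewrite sumr_const card_ord -[leLHS]mulr_natl ler_wpM2r ?ler_nat //.
  by apply: le_trans (hcc 0%N N0); exact: normc_ge0.
move=> j jN; exists (expi (j%:R * T)); first exact: normc_expi.
rewrite -inv // horner_poly -(big_mkord xpredT (fun l => Al l * _ ^+ l)).
rewrite -[X in _ - X](big_mkord xpredT (fun l => Al l * ((om N ^+ j)^*)%C ^+ l)).
rewrite (@big_cat_nat _ _ _ d0 0 N) //= opprD addrA subrr sub0r normcNE.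
apply: le_trans (normc_sum _ _ _) _.
have e0 : 0 <= e.
  have : t <= t <= t + len.
    rewrite lexx lerDl -(pmulr_lge0 _ N0'); apply: le_trans hlen.
    by rewrite !mulr_ge0 ?pi_ge0.
  by move=> /hS; apply: le_trans; exact: normc_ge0.
apply: (@le_trans _ _ (\sum_(d0 <= l < N) e / N%:R)).
  rewrite !big_nat; apply: ler_sum => l hl.
  rewrite Normc.normcM normcXn normc_conj normc_omX expr1n mulr1 /Al normc_div normc_nat.
  by rewrite ler_pM2r ?invr_gt0 // small.
rewrite sumr_const_nat -[leLHS]mulr_natl mulrCA ler_piMr //.
by rewrite ler_pdivrMr // mul1r ler_nat leq_subr.
Qed.

End DFT.

(** * Lagrange interpolation at consecutive roots of unity *)

Section Lagrange.
Context {R : realType}.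

Lemma prod_dist_fact n i : (i < n)%N ->
  (\prod_(k < n | k != i :> nat) ((i - k) + (k - i)) = i`! * (n - i.+1)`!)%N.
Proof.
have base j : (\prod_(k < j) (j - k) = j`!)%N.
  elim: j => [|j IH]; first by rewrite big_ord0.
  by rewrite big_ord_recl factS -IH subn0; congr (_ * _)%N; apply: eq_bigr.
elim: n => // n IH; rewrite ltnS leq_eqVlt => /predU1P[->|iN].
  rewrite subnn fact0 muln1 big_mkcond big_ord_recr /= eqxx muln1 -[RHS]base.
  apply: eq_bigr => k _; rewrite ltn_eqF // (eqP (_ : (k - n)%N == 0)) ?addn0 //.
  by rewrite subn_eq0 ltnW.
rewrite big_mkcond big_ord_recr /= gtn_eqF // -big_mkcond IH // -mulnA; congr (_ * _)%N.
rewrite (eqP (_ : (i - n)%N == 0)) ?subn_eq0 ?(ltnW iN) // add0n subSn // factS mulnC.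
by rewrite subnSK.
Qed.

(** The nodes are [om^1, ..., om^n]; the point 1 is left out because the value there is the one to
    be estimated. *)
Definition lagr (N n k : nat) : {poly R[i]} :=
  \prod_(j < n | j != k :> nat)
    ((om N ^+ k.+1 - om N ^+ j.+1)^-1 *: ('X - (om N ^+ j.+1)%:P)).

Lemma size_lagr N n k : (k < n)%N -> (size (lagr N n k) <= n)%N.
Proof.
move=> kn; rewrite /lagr; apply: leq_trans (size_poly_prod_leq _ _) _.
have h : (\sum_(j < n | j != k :> nat) size (((om N ^+ k.+1 - om N ^+ j.+1)^-1 *: ('X - (om N ^+ j.+1)%:P)) : {poly R[i]})%R
   <= \sum_(j < n | j != k :> nat) 2)%N.
  by apply: leq_sum => j _; apply: leq_trans (size_scale_leq _ _) _; rewrite size_XsubC.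
have c : #|[pred j : 'I_n | j != k :> nat]| = n.-1.
  have := cardC1 (Ordinal kn); rewrite card_ord => <-; exact: eq_card.
move: h; rewrite sum_nat_const c => h.
apply: (@leq_trans ((n.-1 * 2).+1 - n.-1)%N); first by rewrite leq_sub2r // ltnS.
by move: kn; clear; lia.
Qed.

Lemma lagr_node N n k j : (n < N)%N -> (k < n)%N -> (j < n)%N ->
  (lagr N n k).[om N ^+ j.+1] = (j == k)%:R.
Proof.
move=> nN kn jn; rewrite /lagr horner_prod.
under eq_bigr do rewrite !hornerE.
have [->|jk] := eqVneq j k; last first.
  by rewrite (bigD1 (Ordinal jn)) //= subrr mulr0 mul0r.
rewrite big1 // => i ik; rewrite mulVf // subr_eq0; apply: contra ik => /eqP h.
have iN : (i.+1 < N)%N by apply: leq_ltn_trans nN; apply: ltn_ord.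
by have [->] := om_inj (leq_ltn_trans kn nN) iN h.
Qed.

(** Each factor is at most [N / |k - j|], so the product is at most [N^(n-1) / (k! (n-1-k)!) <= (2
    N)^(n-1) / (n-1)!]. Using [x^i / i! <= expR x] at [x = 2 mu N] leaves [mu] free: a small [mu]
    tames the exponential, and [n] small against [N] then tames [mu^-n]. *)
Lemma normc_lagr_le N n k (mu : R) xi : (2 * n <= N)%N -> (k < n)%N -> 0 < mu <= 1 -> normc xi = 1 ->
  normc (lagr N n k).[xi] <= mu^-1 ^+ n * expR (2 * N%:R * mu).
Proof.
move=> nN kn /andP[mu0 mu1] xi1.
have N0 : (0 < N)%N by apply: leq_trans nN; rewrite muln_gt0 /= (leq_ltn_trans _ kn).
have N0' : 0 < N%:R :> R by rewrite ltr0n.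
case: n nN kn => // n nN kn.
rewrite /lagr horner_prod normc_prod.
apply: (@le_trans _ _ (\prod_(j < n.+1 | j != k :> nat) (N%:R / ((k - j) + (j - k))%:R))).
  apply: ler_prod => j jk; rewrite normc_ge0 /= !hornerE Normc.normcM Normc.normcV.
  have d0 : (0 < (k - j) + (j - k))%N by move: jk; clear; lia.
  have d : 2 * ((k - j) + (j - k))%:R / N%:R <= normc (om N ^+ k.+1 - om N ^+ j.+1) :> R.
    have jn := ltn_ord j; have [kj|/ltnW jk'] := leqP k j.
      have -> : ((k - j) + (j - k) = j.+1 - k.+1)%N by move: kj; clear; lia.
      by apply: om_dist => //; move: nN jn; clear; lia.
    have -> : ((k - j) + (j - k) = k.+1 - j.+1)%N by move: jk'; clear; lia.
    by rewrite normc_distC; apply: om_dist => //; move: nN kn; clear; lia.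
  have dp : 0 < 2 * ((k - j) + (j - k))%:R / N%:R :> R by rewrite divr_gt0 // mulr_gt0 // ltr0n.
  apply: (@le_trans _ _ ((2 * ((k - j) + (j - k))%:R / N%:R)^-1 * 2)).
    apply: ler_pM; rewrite ?invr_ge0 ?normc_ge0 //.
      by rewrite lef_pV2 ?posrE // (lt_le_trans dp).
    by apply: le_trans (normcB _ _) _; rewrite xi1 normc_omX.
  rewrite le_eqVlt; apply/orP; left; apply/eqP; field.
  by rewrite -natrD !pnatr_eq0 -!lt0n d0 N0.
rewrite big_split /= prodr_const prodfV -natr_prod prod_dist_fact // subSS.
have -> : #|[pred j : 'I_n.+1 | j != k :> nat]| = n.
  by transitivity #|predC1 (Ordinal kn)|; [exact: eq_card | rewrite cardC1 card_ord].
have f0 i : 0 < i`!%:R :> R by rewrite ltr0n fact_gt0.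
have kn' : (k <= n)%N by [].
have h1 : (2 * mu * N%:R) ^+ n / n`!%:R <= expR (2 * N%:R * mu).
  have e : 2 * N%:R * mu = 2 * mu * N%:R by ring.
  rewrite e; have p : 0 <= 2 * mu * N%:R by rewrite mulr_ge0 ?(ltW N0') // mulr_ge0 ?(ltW mu0).
  case: (n) => [|n']; first by rewrite expr0 fact0 divr1; apply: le_trans (expR_ge1Dx _); rewrite lerDl.
  by apply: le_trans (expR_ge1Dxn n' p); rewrite lerDr.
have h2 : N%:R ^+ n / (k`! * (n - k)`!)%:R <= (2 * N%:R) ^+ n / n`!%:R :> R.
  have bf : n`!%:R = 'C(n, k)%:R * (k`! * (n - k)`!)%:R :> R by rewrite -natrM bin_fact.
  have bl : 'C(n, k)%:R <= 2 ^+ n :> R.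
    have := @binom_term_le R 1 1 n k ler01 ler01; rewrite !expr1n !mulr1.
    by have -> : (1 + 1 : R) = 2 by [].
  have q0 : 0 < (k`! * (n - k)`!)%:R :> R by rewrite ltr0n muln_gt0 !fact_gt0.
  have c0 : 0 < 'C(n, k)%:R :> R by rewrite ltr0n bin_gt0.
  rewrite bf; move: q0; move: (_%:R) => q q0.
  have -> : (2 * N%:R) ^+ n / ('C(n, k)%:R * q) = 2 ^+ n / 'C(n, k)%:R * (N%:R ^+ n / q).
    by rewrite exprMn; field; rewrite !gt_eqF.
  rewrite ler_peMl ?divr_ge0 ?exprn_ge0 ?(ltW q0) //.
  by rewrite ler_pdivlMr // mul1r.
apply: le_trans h2 _.
have -> : (2 * N%:R) ^+ n / n`!%:R = mu^-1 ^+ n * ((2 * mu * N%:R) ^+ n / n`!%:R).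
  rewrite mulrA -exprMn; congr (_ ^+ _ / _); field; rewrite gt_eqF //.
apply: ler_pM => //.
- by rewrite exprn_ge0 // invr_ge0 ltW.
- by rewrite divr_ge0 ?exprn_ge0 ?(ltW (f0 _)) // !mulr_ge0 // ltW.
- by apply: ler_weXn2l => //; rewrite invf_ge1.
Qed.

End Lagrange.

Section VanishingPoly.
Context {R : realType}.

(** With [c] the conjugate of [om^m], evaluation at the conjugate of [om^(m - i)] or of [om^(m + i)]
    becomes evaluation at [om^i]; in the second case conjugating the coefficients keeps the result a
    polynomial. *)
Lemma rotated_poly (d0 : nat) (P : {poly R[i]}) (c : R[i]) (b : bool) : (size P <= d0)%N ->
  exists2 P1 : {poly R[i]}, (size P1 <= d0)%N &
    forall w, normc P1.[w] = normc P.[c * (if b then w^*%C else w)].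
Proof.
move=> sP; case: b.
  exists (\poly_(l < d0) ((P`_l * c ^+ l)^*)%C); first exact: size_poly.
  move=> w; rewrite -[RHS]normc_conj horner_poly (horner_coef_wide _ sP) rmorph_sum; congr normc.
  apply: eq_bigr => l _; rewrite exprMn mulrA [RHS]conjCM; congr (_ * _).
  by rewrite rmorphXn /= conjcK.
exists (\poly_(l < d0) (P`_l * c ^+ l)); first exact: size_poly.
move=> w; rewrite horner_poly (horner_coef_wide _ sP); congr normc.
by apply: eq_bigr => l _; rewrite exprMn; ring.
Qed.

(** Where [cc] vanishes the polynomial of [dft_poly] is at most [e] in modulus, so the interpolating
    polynomial that removes these values combines [n0] basis polynomials with coefficients at most
    [e]; [K] bounds it on the circle, in particular at 1. *)
Lemma vanishing_poly (N m n0 d0 : nat) (cc : nat -> R[i]) (t len e E mu : R) (b : bool)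
    (K := n0%:R * e * (mu^-1 ^+ n0 * expR (2 * N%:R * mu))) :
  (d0 <= N)%N -> 2 * pi * (N - d0)%:R <= len * N%:R ->
  (forall j, (j < N)%N -> normc (cc j) <= E) ->
  (forall s, t <= s <= t + len -> normc (\sum_(j < N) cc j * expi (j%:R * s)) <= e) ->
  (n0 <= m)%N -> (m + n0 < N)%N -> 0 < mu <= 1 ->
  exists Q : {poly R[i]}, [/\ (size Q <= d0 + n0)%N,
    forall xi, normc xi = 1 -> normc Q.[xi] <= N%:R * E + K,
    forall i, (0 < i <= n0)%N -> cc (if b then m + i else m - i)%N = 0 -> root Q (om N ^+ i) &
    normc (cc m) - e - K <= normc Q.[1]].
Proof.
move=> dN hlen hcc hS n0m mN mu01.
have N0 : (0 < N)%N by apply: leq_ltn_trans mN.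
have [P [sP PE Pc]] := dft_poly N0 dN hlen hcc hS.
have [P1 sP1 hP1] := rotated_poly ((om N ^+ m)^*)%C b sP.
pose z i := cc (if b then m + i else m - i)%N == 0.
pose V k : R[i] := if z k.+1 then P1.[om N ^+ k.+1] else 0.
have nN : (2 * n0 <= N)%N by apply: leq_trans (ltnW mN); rewrite mul2n -addnn leq_add2r.
have n0N : (n0 < N)%N by apply: leq_ltn_trans mN; rewrite leq_addl.
have e0 : 0 <= e.
  have [phi _ h] := Pc m (leq_ltn_trans (leq_addr _ _) mN).
  by apply: le_trans h; exact: normc_ge0.
have Ve k : (k < n0)%N -> normc (V k) <= e.
  move=> kn; rewrite /V; case: ifP => [/eqP zk|_]; last by rewrite Normc.normc0.
  rewrite hP1.
  have -> : ((om N ^+ m)^*)%C * (if b then ((om N ^+ k.+1)^*)%C else om N ^+ k.+1)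
     = ((om N ^+ (if b then m + k.+1 else m - k.+1)%N)^*)%C :> R[i].
    case: (b); first by rewrite -conjCM -exprD.
    have km : (k.+1 <= m)%N by apply: leq_trans n0m.
    rewrite -{1}(subnK km) exprD conjCM -mulrA [_ * om N ^+ _]mulrC mulC_conj normc_omX.
    by rewrite expr1n mulr1.
  have jN : ((if b then m + k.+1 else m - k.+1) < N)%N.
    by case: (b); move: mN kn; clear; lia.
  by have [phi _] := Pc _ jN; rewrite zk mul0r subr0.
pose L := \sum_(k < n0) V k *: lagr N n0 k.
have Lle xi : normc xi = 1 -> normc L.[xi] <= K.
  move=> xi1; rewrite horner_sum; apply: le_trans (normc_sum _ _ _) _.
  have -> : K = \sum_(k < n0) e * (mu^-1 ^+ n0 * expR (2 * N%:R * mu)).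
    by rewrite sumr_const card_ord -[RHS]mulr_natl mulrA.
  apply: ler_sum => k _.
  rewrite hornerZ Normc.normcM; apply: ler_pM; rewrite ?normc_ge0 ?(Ve _ (ltn_ord k)) //.
  exact: normc_lagr_le.
have sL : (size L <= n0)%N.
  apply: leq_trans (size_sum _ _ _) _; apply/bigmax_leqP => k _.
  by apply: leq_trans (size_scale_leq _ _) _; apply: size_lagr.
have n1 : normc (1 : R[i]) = 1 by exact: Normc.normc1.
exists (P1 - L); split.
- apply: leq_trans (size_polyD _ _) _; rewrite size_polyN geq_max.
  by rewrite (leq_trans sP1 (leq_addr _ _)) (leq_trans sL (leq_addl _ _)).
- move=> xi xi1; rewrite !hornerE; apply: le_trans (normcB _ _) _; apply: lerD; last exact: Lle.
  rewrite hP1; apply: PE; rewrite Normc.normcM normc_conj normc_omX mul1r.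
  by case: (b); rewrite ?normc_conj.
- move=> i /andP[i0 ilt] zi; rewrite /root !hornerE horner_sum.
  have ik : (i.-1 < n0)%N by rewrite prednK.
  rewrite (bigD1 (Ordinal ik)) //= [X in _ - (_ + X)]big1 ?addr0.
    rewrite hornerZ; have := @lagr_node R N n0 i.-1 i.-1 n0N ik ik; rewrite prednK // => ->.
    by rewrite eqxx mulr1 /V prednK // /z zi eqxx subrr.
  move=> k ki; rewrite hornerZ; have := @lagr_node R N n0 k i.-1 n0N (ltn_ord k) ik.
  rewrite prednK // => ->.
  by rewrite (negPf (_ : i.-1 != k)) ?mulr0 // eq_sym.
rewrite !hornerE; apply: le_trans (normcBge _ _).
have := Lle 1 n1.
have : normc (cc m) - e <= normc P1.[1].
  rewrite hP1 (_ : (if b then _ else _) = 1); last by case: (b) => //; rewrite conjc1.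
  rewrite mulr1; have [phi p1] := Pc m (leq_ltn_trans (leq_addr _ _) mN).
  move=> h; rewrite lerBlDr; have -> : normc (cc m) = normc (cc m * phi) by rewrite Normc.normcM p1 mulr1.
  have -> : cc m * phi = P.[((om N ^+ m)^*)%C] - (P.[((om N ^+ m)^*)%C] - cc m * phi) by ring.
  by apply: le_trans (normcB _ _) _; rewrite lerD2l.
lra.
Qed.

End VanishingPoly.

(** * Intervals of small slope from the divergent integral *)

Section LowerRegularization.
Context {R : realType}.

Lemma segment_derivative_is_derive (d : R) (phi g : R -> R) :
  (forall x, is_derive x (1 : R) phi (g x)) -> continuous g -> segment_derivative d phi g.
Proof.
move=> dphi cg x xd; apply/cvgrPdist_lt => e e0.
have /cvgrPdist_lt/(_ e e0)/nbhs_ballP[r r0 hr] := cg x.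
rewrite near_withinE /dnbhs near_withinE; apply/nbhs_ballP; exists r => // y xy yx _.
have cphi (u v : R) : {within `[u, v], continuous phi}.
  by apply: derivable_within_continuous => z _; have [] := dphi z.
have [c cb ->] : exists2 c, ball x r c & (phi y - phi x) / (y - x) = g c.
  have [lt|gt|eq] := ltgtP x y; last by move: yx; rewrite eq eqxx.
    have [c /[!in_itv]/= /andP[c1 c2] ->] := MVT lt (fun z _ => dphi z) (cphi x y).
    exists c; last by rewrite mulfK // subr_eq0 gt_eqF.
    move: xy; rewrite -!ball_normE /ball_ /= !ltr_norml; lra.
  have [c /[!in_itv]/= /andP[c1 c2] h] := MVT gt (fun z _ => dphi z) (cphi y x).
  exists c; last first.
    by rewrite -opprB h -mulrN opprB mulfK // subr_eq0 lt_eqF.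
  move: xy; rewrite -!ball_normE /ball_ /= !ltr_norml; lra.
exact: hr.
Qed.

(* The C^1 minorant used below is a smoothed corner: slope 1 to the left of
   [x0] and slope [a] to the right. *)
Lemma lower_reg_ge (a d e x0 : R) (n : R -> R) : 0 <= a <= 1 -> x0 \in `[0, d] ->
  (forall x y, 0 <= x -> x <= y -> y <= d -> n y - n x <= y - x) ->
  (forall y, x0 <= y <= d -> a * (y - x0) - e <= n y - n x0) ->
  (forall y, y \in `[0, d] -> 0 <= n y) ->
  n x0 - e <= lower_reg a d n x0.
Proof.
move=> /andP[a0 a1] x0d lip low n0.
have hx := x0d; move: hx; rewrite in_itv /= => /andP[x00 x01].
apply/ler_addgt0Pr => eta eta0.
(* [s] is a smooth function above [|u|], so [psi] lies below both [u] and [a u], and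
   [psi 0 >= - eta]. *)
pose s (u : R) := Num.sqrt (u ^+ 2 + eta ^+ 2).
pose psi (u : R) := ((1 + a) * u - (1 - a) * s u) / 2.
pose phi (y : R) := n x0 - e + psi (y - x0).
pose g (y : R) := ((1 + a) - (1 - a) * ((y - x0) / s (y - x0))) / 2.
have p0 (u : R) : 0 < u ^+ 2 + eta ^+ 2 by rewrite ltr_wpDl ?sqr_ge0 // exprn_gt0.
have s0 (u : R) : 0 < s u by rewrite sqrtr_gt0.
have su (u : R) : `|u| <= s u by rewrite -sqrtr_sqr; apply: ler_wsqrtr; rewrite lerDl sqr_ge0.
have dphi x : is_derive x (1 : R) phi (g x).
  have d1 : is_derive x (1 : R) (fun y : R => (y - x0) ^+ 2 + eta ^+ 2) (2 * (x - x0)).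
    apply: is_derive_eq; rewrite /GRing.scale /=; ring.
  have d3 : is_derive ((fun y : R => (y - x0) ^+ 2 + eta ^+ 2) x) (1 : R) (@Num.sqrt R) _ := is_derive1_sqrt (p0 (x - x0)).
  have d2 := @is_derive1_comp R (@Num.sqrt R) (fun y : R => (y - x0) ^+ 2 + eta ^+ 2) x _ _ d3 d1.
  have -> : phi = (fun y => (n x0 - e) + (2^-1 * (1 + a)) * (y - x0) - (2^-1 * (1 - a)) *
     ((Num.sqrt \o (fun y : R => (y - x0) ^+ 2 + eta ^+ 2)) y)).
    by apply/funext => y; rewrite /phi /psi /s /=; field.
  apply: is_derive_eq; rewrite /GRing.scale /= /g -/(s (x - x0)).
  by field; rewrite gt_eqF.
have cg : continuous g.
  move=> x; apply: cvgM; last exact: cvg_cst.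
  apply: cvgB; first exact: cvg_cst.
  apply: cvgM; first exact: cvg_cst.
  have cx : (y - x0) @[y --> x] --> x - x0 by apply: cvgB; [exact: cvg_id | exact: cvg_cst].
  apply: cvgM => //; apply: cvgV; first by rewrite gt_eqF.
  apply: (cvg_comp _ _ (_ : (y - x0) ^+ 2 + eta ^+ 2 @[y --> x] --> (x - x0) ^+ 2 + eta ^+ 2)).
    by apply: cvgD; [apply: cvgM | exact: cvg_cst].
  exact: sqrt_continuous.
have g01 x : a <= g x <= 1.
  have : `|(x - x0) / s (x - x0)| <= 1.
    by rewrite normrM normfV (gtr0_norm (s0 _)) ler_pdivrMr // mul1r.
  rewrite ler_norml /g; move: (_ / s _) => q /andP[q1 q2]; apply/andP; split; nra.
have phin y : y \in `[0, d] -> phi y <= n y.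
  rewrite in_itv /= => /andP[y0 y1]; rewrite /phi /psi.
  have [xy|yx] := leP x0 y.
    have := low y; rewrite xy y1 => /(_ isT); have := su (y - x0).
    rewrite ger0_norm ?subr_ge0 //; move: (s (y - x0)) => S; clear -a0 a1 xy; nra.
  have := lip y x0 y0 (ltW yx) x01; have := low x0; rewrite lexx x01 => /(_ isT).
  rewrite !subrr mulr0.
  have := su (y - x0); rewrite ltr0_norm ?subr_lt0 //; move: (s (y - x0)) => S; clear -a0 a1 yx; nra.
apply: (@le_trans _ _ (phi x0 + eta)).
  rewrite /phi /psi subrr mulr0 sub0r /s expr0n add0r sqrtr_sqr gtr0_norm //; nra.
rewrite lerD2r; apply: ub_le_sup.
  exists (n x0) => _ [f [h [_ _ hf _]] <-]; exact: hf.
exists phi => //; exists g; split => //.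
- exact: segment_derivative_is_derive.
- exact: continuous_subspaceT.
Qed.

Lemma lower_reg_le (a d x0 : R) (n : R -> R) : 0 <= a <= 1 -> x0 \in `[0, d] ->
  (forall x y, 0 <= x -> x <= y -> y <= d -> 0 <= n y - n x <= y - x) -> 0 <= n 0 ->
  lower_reg a d n x0 <= n x0.
Proof.
move=> a01 x0d lip n00; apply: ge_sup; last first.
  by move=> _ [f [h [_ _ hf _]] <-]; exact: hf.
(* A competitor of slope 1 that is nonpositive on [[0, d]]: the supremum is over a nonempty set. *)
pose phi (y : R) := y - d; exists (phi x0); exists phi => //; exists (fun=> 1); split => //.
- apply: segment_derivative_is_derive; last by move=> x; exact: cvg_cst.
  by move=> x; apply: is_derive_eq; rewrite subr0.
- by apply: continuous_subspaceT => x; exact: cvg_cst.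
- move=> y; rewrite in_itv /= => /andP[y0 y1]; rewrite /phi.
  have /andP[h _] := lip 0 y (lexx 0) y0 y1; lra.
- by move=> y _; have /andP[_ ->] := a01; rewrite lexx.
Qed.

End LowerRegularization.

Section Density.
Context {R : realType}.

(** The integral of a nonnegative function is a supremum over the simple functions below it, so
    monotonicity does not involve measurability. This spares a study of the measurability of
    [lower_reg]. *)
Lemma ge0_le_integral_nonmeasurable (A : set R) (f g : R -> \bar R) :
  (forall x, A x -> 0 <= f x)%E -> (forall x, 0 <= g x)%E -> (forall x, A x -> f x <= g x)%E ->
  (\int[lebesgue_measure]_(x in A) f x <= \int[lebesgue_measure]_x g x)%E.
Proof.
move=> f0 g0 fg; rewrite integral_mkcond.
have f'0 x : (0 <= (f \_ A) x)%E by rewrite patchE; case: ifPn => // /set_mem/f0.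
rewrite !ge0_integralTE //; apply: le_ereal_sup => _ [h /= hf <-]; exists h => // x /=.
apply: le_trans (hf x) _; rewrite patchE; case: ifPn => // /set_mem/fg //.
Qed.

(* For the nodes [x k = d / (k + 1)] the discretization errors
   [((x k - x k.+1) / x k.+1) ^ 2] are summable. *)
Lemma integral_le_harmonic_steps (d M : R) (f : R -> R) (b : nat -> R)
    (x := fun k => d / k.+1%:R : R) : 0 < d ->
  (forall r, r \in `]0, d] -> 0 <= f r) -> (forall k, 0 <= b k) ->
  (forall k r, x k.+1 <= r <= x k -> f r <= b k) ->
  (forall K, \sum_(k < K) b k * (x k - x k.+1) <= M) ->
  (\int[lebesgue_measure]_(r in `]0%R, d]) (f r)%:E <= M%:E)%E.
Proof.
move=> d0 f0 b0 fb hM.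
pose I k : set R := [set` `]x k.+1, x k]].
pose g k (r : R) : \bar R := (b k * \1_(I k) r)%:E.
have xlt k : x k.+1 < x k by rewrite ltr_pM2l // ltf_pV2 ?posrE ?ltr0n // ltr_nat.
have g0 k r : (0 <= g k r)%E by rewrite lee_fin mulr_ge0.
have mI k : measurable (I k) by exact: measurable_itv.
have intg k : (\int[lebesgue_measure]_r g k r = (b k * (x k - x k.+1))%:E)%E.
  have bI : b k < 0 -> I k = set0 by move=> h; have := b0 k; rewrite leNgt h.
  have := integralZl_indic (m := @lebesgue_measure R) measurableT (fun=> I k) _ bI (mI k).
  rewrite /g => ->; rewrite integral_indic; [|exact: measurableT|exact: mI].
  have -> : (I k `&` [set: R] = I k)%classic by rewrite setIT.
  have /= -> := lebesgue_measure_itv `]x k.+1, x k]; by rewrite lte_fin xlt -EFinD -EFinM.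
apply: (@le_trans _ _ (\int[lebesgue_measure]_r (\sum_(0 <= k <oo) g k r)%E)%E).
  apply: ge0_le_integral_nonmeasurable.
  - by move=> r /= /f0; rewrite lee_fin.
  - by move=> r; apply: nneseries_ge0.
  move=> r /=; rewrite in_itv /= => /andP[r0 rd].
  have [k hk] : exists k, x k.+1 < r <= x k.
    have ex : exists k, x k < r.
      exists (Num.truncn (d / r)); rewrite ltr_pdivrMr ?ltr0n // mulrC -ltr_pdivrMr //.
      exact: truncnS_gt.
    case: (ex_minnP ex) => -[|k] h1 h2; first by move: h1; rewrite /x divr1 ltNge rd.
    exists k; rewrite h1 /= leNgt; apply/negP => /h2; rewrite ltnn //.
  have rI : r \in I k by rewrite inE /I /= in_itv.
  apply: le_trans (nneseries_lim_ge k.+1 _) => //.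
  rewrite big_nat_recr //= -[leLHS]add0e; apply: leeD; first by apply: sume_ge0.
  rewrite /g indicE rI mulr1 lee_fin; apply: fb; case/andP: hk => /ltW -> -> //.
rewrite integral_nneseries //; last first.
  move=> k; apply/measurable_EFinP; apply: measurable_funM; first exact: measurable_cst.
  exact: (@measurable_indic _ (measurableTypeR R) R setT (I k) (mI k)).
apply: lime_le; first by apply: is_cvg_nneseries => n _ _; apply: integral_ge0 => r _; exact: g0.
apply: nearW => K; under eq_bigr do rewrite intg.
by rewrite sumEFin lee_fin big_mkord.
Qed.

End Density.

(** * Blocks of small slope by a greedy choice *)

Section Greedy.
Context {R : realType}.

Definition gap_family (n : R -> R) (a lo hi : R) (F : seq (R * R)) :=
  pairwise (fun p q => p.2 <= q.1) F /\ forall p, p \in F ->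
    [/\ lo <= p.1, p.1 < p.2, p.2 <= hi & n p.2 - n p.1 <= a * (p.2 - p.1)].

Definition family_weight (F : seq (R * R)) := \sum_(p <- F) ((p.2 - p.1) / p.2) ^+ 2.

Lemma gap_family_cat n a lo mi mi' hi F G : lo <= mi' -> mi <= mi' -> mi <= hi ->
  gap_family n a lo mi F -> gap_family n a mi' hi G -> gap_family n a lo hi (F ++ G).
Proof.
move=> lm mm mh [pF hF] [pG hG]; split.
  rewrite pairwise_cat pF pG !andbT; apply/allrelP => p q /hF[_ _ p2 _] /hG[q1 _ _ _].
  exact: le_trans p2 (le_trans mm q1).
move=> p; rewrite mem_cat => /orP[/hF[h1 h2 h3 h4]|/hG[h1 h2 h3 h4]]; split => //.
- exact: le_trans mh.
- exact: le_trans lm h1.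
Qed.

Lemma half_le_ratio (u w : R) : 0 < w -> 2 * u <= w -> 2^-1 <= (w - u) / w.
Proof. by move=> w0 h; rewrite ler_pdivlMr //; lra. Qed.

Section OneScale.
Variables (n v : R -> R) (a d : R).
Hypotheses (a01 : 0 <= a <= 1) (d0 : 0 < d).
Hypothesis lip : forall x y, 0 <= x -> x <= y -> y <= d -> 0 <= n y - n x <= y - x.
Let h y := n y - a * y.
Hypothesis vP : forall x, 0 <= x <= d ->
  x <= v x <= d /\ forall t, x <= t <= d -> h (v x) <= h t.
Let x k : R := d / k.+1%:R.

Let x_gt0 k : 0 < x k.
Proof. by rewrite divr_gt0. Qed.

Let x_le k l : (k <= l)%N -> x l <= x k.
Proof. by move=> kl; rewrite ler_pM2l // lef_pV2 ?posrE ?ltr0n // ler_nat. Qed.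

Let x_led k : x k <= d.
Proof. by have := x_le (leq0n k); rewrite [x 0]divr1. Qed.

Let step_sqr k : ((x k - x k.+1) / x k.+1) ^+ 2 = (k.+1%:R^-1) ^+ 2.
Proof.
congr (_ ^+ 2); rewrite /x -(natr1 k.+1).
have : (0 : R) < k.+1%:R by rewrite ltr0n.
move: (k.+1%:R) => q q0; field.
by rewrite !gt_eqF // addr_gt0.
Qed.

(** Main part of the contribution of [[x k.+1, x k]] to the integral: the drop of [h] from a point
    to its later minimum dominates [n - lower_reg] at that point. *)
Let cell k := (x k - x k.+1) * (h (x k.+1) - h (v (x k.+1))) / x k.+1 ^+ 2.

(** [v u] minimizes [h] over [[u, d]], so the drop at the node is at most [h (x k.+1) - h (v u)];
    moreover [n] is nondecreasing and [a <= 1]. *)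
Let cell_le k u : 0 < u -> u <= x k.+1 -> x k.+1 <= v u -> u <= d ->
  cell k <= (x k - x k.+1) * (v u - x k.+1) / x k.+1 ^+ 2.
Proof.
move=> u0 ux xv ud; rewrite /cell ler_pM2r ?invr_gt0 ?exprn_gt0 //.
apply: ler_wpM2l; first by rewrite subr_ge0 x_le.
have [|/andP[_ vd] hmin] := vP (x := u); first by rewrite (ltW u0).
have [|/andP[v1 v2] _] := vP (x := x k.+1); first by rewrite (ltW (x_gt0 _)) x_led.
have := hmin (v (x k.+1)); rewrite v2 (le_trans ux v1) => /(_ isT).
have /andP[hn _] := lip (ltW (x_gt0 k.+1)) xv vd.
have : a * (v u - x k.+1) <= v u - x k.+1.
  by apply: ler_piMl; rewrite ?subr_ge0 //; case/andP: a01.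
rewrite /h; lra.
Qed.

(* Move from left to right. From the current node [u] take the block [u, v u], on
   which the drop of [h] from any node [y] to its later minimum is at most
   [v u - y], and restart at the first node to the right of [v u]. *)
Lemma greedy_gap_family K : exists F, gap_family n a (x K) d F /\
  (4^-1 <= family_weight F \/
   \sum_(k < K) cell k <= 4 * family_weight F + \sum_(k < K) (k.+1%:R^-1) ^+ 2).
Proof.
elim/ltn_ind: K => -[|K] IH.
  by exists [::]; split => //; right; rewrite /family_weight big_nil !big_ord0 mulr0 addr0.
set u := x K.+1; have u0 : 0 < u := x_gt0 _.
have ud : u <= d := x_led _.
have [|/andP[uv vd] hmin] := vP (x := u); first by rewrite (ltW u0).
move: uv; rewrite le_eqVlt => /predU1P[uv|uv].
  have [F [[pF hF] HF]] := IH K (ltnSn K).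
  exists F; split.
    split=> // p /hF[h1 h2 h3 h4]; split=> //.
    by apply: le_trans h1; exact: x_le.
  case: HF => HF; [by left|right]; rewrite !big_ord_recr /=.
  have -> : cell K = 0 by rewrite /cell -/u -uv subrr mulr0 mul0r.
  rewrite addr0; apply: le_trans HF _; rewrite addrA lerDl; exact: sqr_ge0.
have bad : n (v u) - n u <= a * (v u - u).
  by have := hmin u; rewrite lexx ud => /(_ isT); rewrite /h; lra.
have wp : 0 <= ((v u - u) / v u) ^+ 2 by exact: sqr_ge0.
have v0 : 0 < v u := lt_trans u0 uv.
have one : gap_family n a u (v u) [:: (u, v u)].
  by split=> // p; rewrite inE => /eqP -> /=; split.
(* A block with [v u >= 2 u] has weight at least 1/4 and forms the family alone. *)
have [big|small] := leP (2 * u) (v u).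
  exists [:: (u, v u)]; split.
    by split=> // p; rewrite inE => /eqP -> /=; split.
  left; rewrite /family_weight big_seq1 /=.
  have -> : 4^-1 = (2^-1) ^+ 2 :> R by rewrite exprVn -natrX.
  have hb : 2^-1 <= (v u - u) / v u by exact: half_le_ratio.
  have h0 : 0 <= 2^-1 :> R by rewrite invr_ge0.
  by apply: lerXn2r => //; rewrite nnegrE; exact: le_trans h0 hb.
have ex : exists k, (k <= K)%N && (v u <= x k) by exists 0%N; rewrite [x 0]divr1.
have bnd k : (k <= K)%N && (v u <= x k) -> (k <= K)%N by case/andP.
(* [x k0] is the first node at or to the right of [v u]; the cell [k0] straddles the end of the
   block. *)
case: (ex_maxnP ex bnd) => k0 /andP[k0K vk0] hmax.
have [F [gF HF]] := IH k0 k0K.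
exists ([:: (u, v u)] ++ F); split.
  apply: (gap_family_cat _ _ _ one gF) => //; exact: x_le (leqW k0K).
have -> : family_weight ([:: (u, v u)] ++ F) = ((v u - u) / v u) ^+ 2 + family_weight F.
  by rewrite /family_weight big_cons.
case: HF => HF; [left; lra|right].
rewrite -!(big_mkord xpredT cell) -!(big_mkord xpredT (fun k => k.+1%:R^-1 ^+ 2)) in HF *.
have split_sum (f : nat -> R) : \sum_(0 <= k < K.+1) f k =
    \sum_(0 <= k < k0) f k + (f k0 + \sum_(k0.+1 <= k < K.+1) f k).
  by rewrite (big_cat_nat (n := k0)) ?leqW //= (big_ltn (m := k0)).
rewrite split_sum (split_sum (fun k => k.+1%:R^-1 ^+ 2)).
have xlv k : (k0 <= k)%N -> (k <= K)%N -> x k.+1 <= v u.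
  move=> k0k kK; rewrite leNgt; apply/negP => vx.
  move: kK; rewrite leq_eqVlt => /predU1P[kK|kK].
    by move: vx; rewrite kK -/u ltNge (ltW uv).
  by have := hmax k.+1; rewrite kK (ltW vx) => /(_ isT); rewrite ltnNge k0k.
(* In the straddling cell the drop is at most the length of the cell, so it is charged to the
   discretization error. *)
have c1 : cell k0 <= (k0.+1%:R^-1) ^+ 2.
  have xu : u <= x k0.+1 by exact: x_le.
  apply: le_trans (cell_le u0 xu (xlv _ (leqnn _) k0K) ud) _.
  rewrite -step_sqr (expr_div_n (x k0 - x k0.+1)) ler_pM2r ?invr_gt0 ?exprn_gt0 // expr2.
  by apply: ler_wpM2l; rewrite ?subr_ge0 ?x_le // lerD2r.
(* Inside the block the drops are at most [v u - u] and the lengths telescope. *)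
have c2 : \sum_(k0.+1 <= k < K.+1) cell k <= ((v u - u) / u) ^+ 2.
  apply: (@le_trans _ _ (\sum_(k0.+1 <= k < K.+1) (x k - x k.+1) * ((v u - u) / u ^+ 2))).
    apply: ler_sum_nat => k /andP[k1 k2].
    have xu : u <= x k.+1 by exact: x_le.
    apply: le_trans (cell_le u0 xu (xlv _ (ltnW k1) k2) ud) _.
    rewrite -mulrA; apply: ler_wpM2l; first by rewrite subr_ge0 x_le.
    apply: ler_pM; rewrite ?subr_ge0 ?invr_ge0 ?exprn_ge0 ?(ltW (x_gt0 _)) //.
    - exact: (xlv _ (ltnW k1) k2).
    - by rewrite lerD2l lerN2.
    - by rewrite lef_pV2 ?posrE ?exprn_gt0 // lerXn2r ?nnegrE ?(ltW (x_gt0 _)) // (ltW u0).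
  rewrite -big_distrl /= (expr_div_n (v u - u)) (expr2 (v u - u)) mulrA ler_pM2r ?invr_gt0 ?exprn_gt0 //.
  apply: ler_wpM2r; first by rewrite subr_ge0 ltW.
  rewrite (telescope_sumr_eq (fun k => - x k)) //; last by move=> k _; rewrite opprK addrC.
  by rewrite opprK addrC lerD2r xlv.
(* Here [v u < 2 u], whence the factor 4. *)
have c3 : ((v u - u) / u) ^+ 2 <= 4 * ((v u - u) / v u) ^+ 2.
  rewrite !(expr_div_n (v u - u)).
  rewrite mulrCA; apply: ler_wpM2l; first exact: sqr_ge0.
  rewrite -[leLHS]div1r ler_pdivrMr ?exprn_gt0 // mulrAC ler_pdivlMr ?exprn_gt0 // mul1r.
  by rewrite (_ : 4 = 2 ^+ 2) -?exprMn -?natrX // lerXn2r ?nnegrE ?mulr_ge0 ?(ltW small) // ltW.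
have c4 : 0 <= \sum_(k0.+1 <= k < K.+1) (k.+1%:R^-1 : R) ^+ 2.
  by apply: sumr_ge0 => k _; exact: sqr_ge0.
rewrite mulrDr (addrC (4 * _) (4 * _)) addrACA; apply: lerD => //.
rewrite [cell k0 + _]addrC; apply: lerD; last by rewrite -[leLHS]addr0; apply: lerD.
exact: le_trans c2 c3.
Qed.

End OneScale.

End Greedy.

Section DivergentDensity.
Context {R : realType}.

Lemma sum_inv_sqr_le2 K : \sum_(k < K) (k.+1%:R^-1 : R) ^+ 2 <= 2.
Proof.
suff h : \sum_(k < K.+1) (k.+1%:R^-1 : R) ^+ 2 <= 2 - K.+1%:R^-1.
  apply: le_trans (le_trans h _); first by rewrite big_ord_recr lerDl sqr_ge0.
  by rewrite lerBlDr lerDl invr_ge0.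
elim: K => [|K IH]; first by rewrite big_ord_recr big_ord0 /= invr1 expr1n; lra.
rewrite big_ord_recr /=; apply: le_trans (lerD IH (lexx _)) _.
have : (0 : R) < K.+1%:R by rewrite ltr0n.
rewrite -[K.+2%:R]natr1; move: (K.+1%:R) => q q0.
have -> : 2 - q^-1 + (q + 1)^-1 ^+ 2 = 2 - (q + 1)^-1 - (q * (q + 1) ^+ 2)^-1.
  by field; rewrite !gt_eqF // addr_gt0.
by rewrite lerBlDr lerDl invr_ge0 mulr_ge0 ?exprn_ge0 ?addr_ge0 // ltW.
Qed.

Lemma lipschitz2_continuous (f : R -> R) :
  (forall x y, x <= y -> `|f y - f x| <= 2 * (y - x)) -> continuous f.
Proof.
move=> lip x; apply/cvgrPdist_lt => e e0; near=> y.
have hy : `|x - y| < e / 2 by near: y; apply: cvgr_dist_lt; rewrite ?divr_gt0.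
have [xy|yx] := leP x y.
  apply: le_lt_trans (_ : 2 * (y - x) < e); first by rewrite distrC lip.
  by move: hy; rewrite distrC ger0_norm ?subr_ge0 //; lra.
apply: le_lt_trans (lip y x (ltW yx)) _.
by move: hy; rewrite gtr0_norm ?subr_gt0 //; lra.
Unshelve. all: by end_near. Qed.

Variables (n : R -> R) (a : R).
Hypotheses (a01 : 0 <= a <= 1) (n0 : 0 <= n 0).
Hypothesis lip : forall x y, 0 <= x -> x <= y -> y <= 1 -> 0 <= n y - n x <= y - x.

Lemma exists_argmin d : d <= 1 -> exists v : R -> R, forall x, 0 <= x <= d ->
  x <= v x <= d /\ forall t, x <= t <= d -> n (v x) - a * v x <= n t - a * t.
Proof.
move=> d1; suff /boolp.choice[v vP] : forall x, exists w, 0 <= x <= d -> x <= w <= d /\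
    forall t, x <= t <= d -> n w - a * w <= n t - a * t by exists v.
move=> x.
have [/andP[x0 xd]|] := boolP (0 <= x <= d); last by exists x.
(* Clamping to [[0, 1]]: nothing is known of [n] outside, and the extreme value theorem is applied
   to a function continuous on the whole line. *)
pose cl (y : R) := Num.max 0 (Num.min 1 y).
have clE t : x <= t <= d -> cl t = t.
  move=> /andP[xt td]; rewrite /cl min_r ?(le_trans td) // max_r //; exact: le_trans x0 xt.
have cf : continuous (fun y => n (cl y) - a * y).
  apply: lipschitz2_continuous => y z yz.
  have : [/\ 0 <= cl y, cl y <= cl z, cl z <= 1 & cl z - cl y <= z - y].
    have clP w : [\/ w <= 0 /\ cl w = 0, 0 <= w <= 1 /\ cl w = w | 1 <= w /\ cl w = 1].
      have [w1|w1] := leP 1 w; first by apply: Or33; split=> //; rewrite /cl min_l ?max_r.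
      have [w0|w0] := leP 0 w; first by apply: Or32; rewrite ltW // /cl min_r ?max_r ?(ltW w1).
      by apply: Or31; rewrite ltW // /cl min_r ?max_l ?(ltW w1) // ltW.
    by case: (clP y) => -[h1 ->]; case: (clP z) => -[h2 ->]; split; lra.
  move=> [h1 h2 h3 h4]; have /andP[h5 h6] := lip h1 h2 h3.
  case/andP: a01 => a0 a1; rewrite ler_norml; apply/andP; split; nra.
have [c + hc] := @EVT_min R _ x d xd (continuous_subspaceT cf).
rewrite in_itv /= => cxd; exists c => _; split=> // t xtd.
by have := hc t; rewrite in_itv /= xtd => /(_ isT); rewrite !clE.
Qed.

(** Otherwise every greedy family has weight below 1/4, and the integral is at most
    [4 / 4 + 2 + 2 = 5]; the two sums of [1 / k^2] are the discretization errors of the greedy bound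
    and of the integral. *)
Lemma gap_family_of_divergence d : 0 < d < 1 ->
  (\int[lebesgue_measure]_(r in `]0%R, d])
     ((n r - lower_reg a d n r) / r ^+ 2)%:E = +oo)%E ->
  exists lo F, [/\ 0 < lo, gap_family n a lo d F & 4^-1 <= family_weight F].
Proof.
move=> /andP[d0 d1] int_oo; have d1' := ltW d1.
have [//|none] := pselect (exists lo F,
  [/\ 0 < lo, gap_family n a lo d F & 4^-1 <= family_weight F]).
exfalso.
have [v vP] := exists_argmin d1'.
pose h y := n y - a * y; pose E y := h y - h (v y).
pose x k : R := d / k.+1%:R; pose b k := (E (x k.+1) + (x k - x k.+1)) / x k.+1 ^+ 2.
have lipd s t : 0 <= s -> s <= t -> t <= d -> 0 <= n t - n s <= t - s.
  by move=> s0 st td; apply: lip => //; exact: le_trans d1'.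
have x0 k : 0 < x k by rewrite divr_gt0.
have xle k l : (k <= l)%N -> x l <= x k.
  by move=> kl; rewrite ler_pM2l // lef_pV2 ?posrE ?ltr0n // ler_nat.
have xd k : x k <= d by have := xle _ _ (leq0n k); rewrite [x 0]divr1.
have E0 r : 0 <= r <= d -> 0 <= E r.
  move=> hr; have [h1 h2] := vP r hr; rewrite subr_ge0; apply: h2.
  by case/andP: hr => _ ->; rewrite lexx.
have b0 k : 0 <= b k.
  apply: divr_ge0; last by rewrite exprn_ge0 ?ltW.
  by apply: addr_ge0; [apply: E0; rewrite (ltW (x0 _)) xd | rewrite subr_ge0 xle].
suff : (\int[lebesgue_measure]_(r in `]0%R, d])
     ((n r - lower_reg a d n r) / r ^+ 2)%:E <= 5%:E)%E by rewrite int_oo.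
apply: (integral_le_harmonic_steps d0 _ b0).
- move=> r; rewrite in_itv /= => /andP[r0 rd]; rewrite divr_ge0 ?exprn_ge0 ?(ltW r0) //.
  by rewrite subr_ge0; apply: lower_reg_le => //; rewrite in_itv /= (ltW r0).
- move=> k r; rewrite -/(x k) -/(x k.+1) => /andP[r1 r2]; have r0 : 0 < r := lt_le_trans (x0 _) r1.
  have rd : r <= d := le_trans r2 (xd _).
  have [|/andP[v1 v2] v3] := vP r; first by rewrite (ltW r0).
  have [|/andP[u1 u2] u3] := vP (x k.+1); first by rewrite (ltW (x0 _)) xd.
  (* [E r] is admissible as [e] in [lower_reg_ge] because [v r] minimizes [h] over [[r, d]]. *)
  have le1 : n r - lower_reg a d n r <= E r.
    rewrite lerBlDr -lerBlDl; apply: lower_reg_ge => //.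
    + by rewrite in_itv /= (ltW r0).
    + by move=> s t s0 st td; case/andP: (lipd s t s0 st td).
    + by move=> y /v3; rewrite /E /h; lra.
    + move=> y; rewrite in_itv /= => /andP[y0 yd].
      by case/andP: (lipd 0 y (lexx 0) y0 yd); rewrite subr_ge0 => /(le_trans n0).
  have le2 : E r <= E (x k.+1) + (x k - x k.+1).
    have := u3 (v r); rewrite (le_trans r1 v1) v2 => /(_ isT).
    have /andP[_ ] := lipd (x k.+1) r (ltW (x0 _)) r1 rd.
    have : 0 <= a * (r - x k.+1) by rewrite mulr_ge0 ?subr_ge0 //; case/andP: a01.
    by rewrite /E /h; lra.
  have le3 : 0 <= E (x k.+1) + (x k - x k.+1) by apply: le_trans le2; apply: E0; rewrite (ltW r0).
  apply: (@le_trans _ _ ((E (x k.+1) + (x k - x k.+1)) / r ^+ 2)).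
    by rewrite ler_pM2r ?invr_gt0 ?exprn_gt0 //; exact: le_trans le2.
  apply: ler_wpM2l => //; rewrite lef_pV2 ?posrE ?exprn_gt0 //.
  by apply: lerXn2r; rewrite ?nnegrE ?(ltW r0) ?(ltW (x0 _)).
move=> K; have [F [gF HF]] := greedy_gap_family a01 d0 lipd vP K.
have small : family_weight F < 4^-1.
  by rewrite ltNge; apply/negP => big; apply: none; exists (x K), F.
case: HF => [big|HF]; first by move: small; rewrite ltNge big.
under eq_bigr do rewrite -/(x _) -/(x _.+1).
rewrite (eq_bigr (fun k : 'I_K => (x k - x k.+1) * (h (x k.+1) - h (v (x k.+1))) / x k.+1 ^+ 2
  + (k.+1%:R^-1) ^+ 2)).
  rewrite big_split /=; have := sum_inv_sqr_le2 K.
  move: HF small; rewrite -/x; move: (\sum_(k < K) k.+1%:R^-1 ^+ 2) (family_weight F) => S1 S2.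
  move: (\sum_(_ < K) _) => S3 *; lra.
move=> k _; rewrite /b -/(E (x k.+1)).
have -> : (k.+1%:R^-1 : R) = (x k - x k.+1) / x k.+1.
  rewrite /x -[k.+2%:R]natr1; have : (0 : R) < k.+1%:R by rewrite ltr0n.
  move: (k.+1%:R) => q q0; field.
  by rewrite !gt_eqF // addr_gt0.
have := gt_eqF (x0 k.+1); move: (x k) (x k.+1) (E _) => X Y Z Y0; field.
by rewrite Y0.
Qed.

(** Divergence holds for every [d], so it can be used again to the left of the blocks already found;
    each round adds 1/4 to the weight. *)
Lemma heavy_gap_family rho K : 0 < rho < 1 ->
  (forall d : R, d \in `]0, 1[ ->
    (\int[lebesgue_measure]_(r in `]0%R, d])
       ((n r - lower_reg a d n r) / r ^+ 2)%:E = +oo)%E) ->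
  exists lo F, [/\ 0 < lo, lo <= rho, gap_family n a lo rho F & K <= family_weight F].
Proof.
move=> /andP[r0 r1] hoo.
suff [k hk] : exists k : nat, K <= k%:R / 4.
  elim: k K hk => [|k IH] K' hk.
    exists rho, [::]; split => //; last by rewrite /family_weight big_nil (le_trans hk) ?mul0r.
  have [lo [F [l0 lr gF HF]]] := IH _ (lexx _).
  have ld : 0 < lo / 2 < 1 by lra.
  have [|lo' [G [l'0 gG HG]]] := gap_family_of_divergence ld.
    by apply: hoo; rewrite in_itv /=.
  have l'd : Num.min lo' (lo / 2) <= lo / 2 by rewrite ge_min lexx orbT.
  exists (Num.min lo' (lo / 2)), (G ++ F); split.
  - by rewrite lt_min l'0; lra.
  - by apply: le_trans l'd _; lra.
  - apply: (gap_family_cat (mi := lo / 2) (mi' := lo)) => //; try lra.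
    case: gG => pG gG; split=> // p /gG[h1 h2 h3 h4]; split=> //.
    by apply: le_trans h1; rewrite ge_min lexx.
  rewrite /family_weight big_cat /= -!/(family_weight _).
  by move: hk HF HG; rewrite -natr1; lra.
exists (Num.truncn (4 * K)).+1; have := truncnS_gt (4 * K); lra.
Qed.

End DivergentDensity.

(** * Counting functions and their limits *)

Section Counting.
Context {R : realType}.

Lemma card_fset_set_seq (T : choiceType) (A : set T) (s : seq T) :
  uniq s -> (forall x, A x <-> x \in s) -> #|` fset_set A| = size s.
Proof.
move=> us As; have -> : A = [set` [fset x in s]%fset].
  by apply/seteqP; split=> x /=; rewrite inE => /As.
by rewrite set_fsetK card_fseq undup_id.
Qed.

(** [true] stands for the right side of [m] and [false] for the left one, so that both densities are
    treated by one argument. *)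
Definition offset (b : bool) (m i : nat) : nat := if b then (m + i)%N else (m - i)%N.

Definition count_offset (b : bool) (a : nat -> R[i]) (m : nat) (r : R) : R :=
  (count (fun i => a (offset b m i) != 0) (iota 0 (trunc (r * m%:R)).+1))%:R / m%:R.

Lemma count_plusE (a : nat -> R[i]) (m : nat -> nat) k r : 0 <= r <= 1 ->
  count_plus m (Lambda_plus a m) k r = count_offset true a (m k) r.
Proof.
move=> /andP[r0 r1]; rewrite /count_plus /count_offset; congr (_%:R / _).
set M := m k; have rm : 0 <= r * M%:R by rewrite mulr_ge0.
rewrite -size_filter -(size_map (addn M)); set s := iota _ _.
have sP i : (i \in s) = (i%:R <= r * M%:R).
  by rewrite /s mem_iota /= add0n ltnS truncn_ge_nat.
have us : uniq s by exact: iota_uniq.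
move: s sP us => s sP us.
apply: card_fset_set_seq.
  by rewrite map_inj_uniq ?filter_uniq //; exact: addnI.
move=> j /=; split.
  move=> [[/andP[Mj _] aj] [_ jr]]; apply/mapP; exists (j - M)%N; last by rewrite subnKC.
  rewrite mem_filter sP /= subnKC // aj.
  by move: jr; rewrite natrB // mulrDl mul1r; lra.
case/mapP => i; rewrite mem_filter sP => /andP[ai ir] ->.
have iM : (i <= M)%N.
  by rewrite -(ler_nat R); apply: le_trans ir _; rewrite ler_piMl.
split; first by split=> //; rewrite leq_addr /= mul2n -addnn leq_add2l.
by rewrite ler_nat leq_addr natrD; split=> //; rewrite mulrDl mul1r lerD2l.
Qed.

Lemma count_minusE (a : nat -> R[i]) (m : nat -> nat) k r : 0 <= r <= 1 ->
  count_minus m (Lambda_minus a m) k r = count_offset false a (m k) r.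
Proof.
move=> /andP[r0 r1]; rewrite /count_minus /count_offset; congr (_%:R / _).
set M := m k; have rm : 0 <= r * M%:R by rewrite mulr_ge0.
have le_iM i : i%:R <= r * M%:R -> (i <= M)%N.
  by move=> ir; rewrite -(ler_nat R); apply: le_trans ir _; rewrite ler_piMl.
rewrite -size_filter -(size_map (subn M)); set s := iota _ _.
have sP i : (i \in s) = (i%:R <= r * M%:R).
  by rewrite /s mem_iota /= add0n ltnS truncn_ge_nat.
have us : uniq s by exact: iota_uniq.
move: s sP us => s sP us.
apply: card_fset_set_seq.
  rewrite map_inj_in_uniq ?filter_uniq // => i j.
  rewrite !mem_filter !sP.
  move=> /andP[_ /le_iM iM] /andP[_ /le_iM jM] e.
  by rewrite -(subKn iM) e subKn.
move=> j /=; split.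
  move=> [[/andP[_ jM] aj] [jr _]]; apply/mapP; exists (M - j)%N; last by rewrite subKn.
  rewrite mem_filter sP /= subKn // aj.
  by move: jr; rewrite natrB // mulrBl mul1r; lra.
case/mapP => i; rewrite mem_filter sP => /andP[ai ir] ->.
have iM := le_iM _ ir.
split; first by split=> //; rewrite leq_subr.
by rewrite ler_nat leq_subr natrB //; split=> //; rewrite mulrBl mul1r lerD2l lerN2.
Qed.

Lemma count_offsetB b a m r s : 0 <= r -> r <= s ->
  (count_offset b a m s - count_offset b a m r) * m%:R =
  (count (fun i => a (offset b m i) != 0)
     (iota (trunc (r * m%:R)).+1 (trunc (s * m%:R) - trunc (r * m%:R))))%:R.
Proof.
move=> r0 rs; have [->|m0] := posnP m; first by rewrite !mulr0 subnn.
have le : (trunc (r * m%:R) <= trunc (s * m%:R))%N by apply: le_truncn; rewrite ler_wpM2r.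
rewrite /count_offset -mulrBl mulfVK ?pnatr_eq0 -?lt0n //.
have -> : (trunc (s * m%:R)).+1 = ((trunc (r * m%:R)).+1 + (trunc (s * m%:R) - trunc (r * m%:R)))%N.
  by rewrite addSn subnKC.
by rewrite iotaD count_cat natrD add0n addrAC subrr add0r.
Qed.

Lemma truncB_le (x y : R) : 0 <= x -> x <= y ->
  `|(trunc y - trunc x)%:R - (y - x)| <= 1.
Proof.
move=> x0 xy; have /andP[h1 h2] := truncn_itv x0; have /andP[h3 h4] := truncn_itv (le_trans x0 xy).
rewrite natrB ?le_truncn //; move: h2 h4; rewrite -!natr1 ler_norml => h2 h4; lra.
Qed.

Lemma count_offset_lip b a m r s : (0 < m)%N -> 0 <= r -> r <= s ->
  0 <= count_offset b a m s - count_offset b a m r <= s - r + m%:R^-1.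
Proof.
move=> m0 r0 rs; have mR : 0 < m%:R :> R by rewrite ltr0n.
have e := count_offsetB b a m r0 rs.
apply/andP; split; first by rewrite -(pmulr_lge0 _ mR) e.
rewrite -(ler_pM2r mR) e mulrDl mulVf ?gt_eqF //.
apply: (@le_trans _ _ (trunc (s * m%:R) - trunc (r * m%:R))%:R).
  by rewrite ler_nat -[leqRHS](size_iota (trunc (r * m%:R)).+1) count_size.
have : `|_ - _| <= _ := truncB_le (mulr_ge0 r0 (ltW mR)) (ler_wpM2r (ltW mR) rs).
rewrite ler_norml mulrBl; lra.
Qed.

(** Zero coefficients are the complement of the counted ones. Rounding costs at most
    [1 <= g (y - x) m / 128], replacing counts by their limits at most
    [2 eta m <= g (y - x) m / 16]; together this is less than the fraction [g / 8] of the block. *)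
Lemma many_zeros b a m x y al g (n : R -> R) eta : (0 < m)%N -> 0 <= x -> x <= y ->
  128 <= g * ((y - x) * m%:R) -> 32 * eta <= g * (y - x) -> n y - n x <= al * (y - x) ->
  `|n x - count_offset b a m x| <= eta -> `|n y - count_offset b a m y| <= eta ->
  (1 - al - g / 8) * ((y - x) * m%:R) <=
  (size [seq i <- iota (trunc (x * m%:R)).+1 (trunc (y * m%:R) - trunc (x * m%:R)) |
           a (offset b m i) == 0])%:R.
Proof.
move=> m0 x0 xy hg heta hal; rewrite !ler_norml => hx hy.
have mR : 0 < m%:R :> R by rewrite ltr0n.
set T := (trunc (y * m%:R) - trunc (x * m%:R))%N; set s := iota _ T.
have e := count_offsetB b a m x0 xy; rewrite -/T -/s in e.
have cs := count_predC (fun i => a (offset b m i) == 0) s; rewrite size_iota in cs.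
rewrite size_filter; have : (count (fun i => a (offset b m i) == 0) s)%:R =
    T%:R - (count_offset b a m y - count_offset b a m x) * m%:R :> R.
  by rewrite e -cs natrD; exact: esym (addrK _ _).
have : `|T%:R - _| <= _ := truncB_le (mulr_ge0 x0 (ltW mR)) (ler_wpM2r (ltW mR) xy).
rewrite ler_norml => /andP[h1 _] ->.
have h2 : count_offset b a m y - count_offset b a m x <= al * (y - x) + 2 * eta by lra.
have h3 := ler_wpM2r (ltW mR) h2; have h4 := ler_wpM2r (ltW mR) heta.
move: h1 h3 h4 hg; rewrite !mulrBl !mulrDl !mulrBr !mulrBl.
move: (m%:R) (T%:R) (count_offset b a m y) (count_offset b a m x) => M Tr cy cx.
clear; lra.
Qed.

Variables (b : bool) (a : nat -> R[i]) (m : nat -> nat) (n : R -> R).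
Hypothesis m_ge : forall k, (k <= m k)%N.
Hypothesis cvg_count : forall r, 0 <= r <= 1 ->
  count_offset b a (m k) r @[k --> \oo] --> n r.

Lemma count_offset_near (s : seq R) eta : 0 < eta -> (forall r, r \in s -> 0 <= r <= 1) ->
  exists k0, forall k, (k0 <= k)%N -> forall r, r \in s -> `|n r - count_offset b a (m k) r| <= eta.
Proof.
move=> eta0; elim: s => [|r s IH] hs; first by exists 0%N.
have [k0 h0] := IH (fun q qs => hs q (mem_behead (s := r :: s) qs)).
have /cvgrPdist_le/(_ eta eta0)[k1 _ h1] := cvg_count (hs r (mem_head _ _)).
exists (maxn k0 k1) => k; rewrite geq_max => /andP[hk0 hk1] q.
by rewrite inE => /predU1P[->|/h0]; [exact: h1 | exact].
Qed.

Lemma limit_count_ge0 : 0 <= n 0.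
Proof.
apply/ler_addgt0Pl => e e0.
have [|k0 h] := count_offset_near (s := [:: 0]) e0.
  by move=> r; rewrite inE => /eqP->; rewrite lexx ler01.
have := h _ (leqnn _) 0 (mem_head _ _); rewrite ler_norml.
have : 0 <= count_offset b a (m k0) 0 by rewrite divr_ge0.
lra.
Qed.

Lemma limit_count_lip x y : 0 <= x -> x <= y -> y <= 1 -> 0 <= n y - n x <= y - x.
Proof.
move=> x0 xy y1; apply/andP; split.
  apply/ler_addgt0Pl => e e0; have e2 : 0 < e / 2 by rewrite divr_gt0.
  have [|k0 h] := count_offset_near (s := [:: x; y]) e2.
    by move=> r; rewrite !inE => /orP[/eqP->|/eqP->]; apply/andP; split; lra.
  have k1 := leq_maxl k0 1; have := h _ k1 x (mem_head _ _).
  have := h _ k1 y; rewrite !inE eqxx orbT => /(_ isT).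
  have m0 : (0 < m (maxn k0 1))%N by apply: leq_trans (m_ge _); rewrite leq_max orbT.
  have /andP[+ _] := count_offset_lip b a m0 x0 xy.
  rewrite !ler_norml; lra.
apply/ler_addgt0Pl => e e0; have e2 : 0 < e / 3 by rewrite divr_gt0.
have [|k0 h] := count_offset_near (s := [:: x; y]) e2.
  by move=> r; rewrite !inE => /orP[/eqP->|/eqP->]; apply/andP; split; lra.
pose k := maxn k0 (trunc (3 / e)).+1; have k1 : (k0 <= k)%N := leq_maxl _ _.
have := h _ k1 x (mem_head _ _); have := h _ k1 y; rewrite !inE eqxx orbT => /(_ isT).
have mk : ((trunc (3 / e)).+1 <= m k)%N by apply: leq_trans (m_ge _); rewrite leq_max leqnn orbT.
have m0 : (0 < m k)%N by apply: leq_trans mk.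
have me : (m k)%:R^-1 <= e / 3.
  rewrite -[e / 3]invrK invf_div lef_pV2 ?posrE ?divr_gt0 ?ltr0n //.
  by apply: le_trans (ltW (truncnS_gt _)) _; rewrite ler_nat.
have /andP[_ +] := count_offset_lip b a m0 x0 xy.
rewrite !ler_norml; lra.
Qed.

End Counting.

Section Infima.
Context {R : realType}.

(** On the empty set [inf01] is 1, so a value below [y <= 1] provides an element. *)
Lemma inf01_ltP (A : set R) (y : R) : inf01 A < y -> y <= 1 -> exists2 x, A x & x < y.
Proof.
rewrite /inf01; case: eqP => [_ y1 /(lt_le_trans y1)|/eqP/set0P A0 Ay _]; first by rewrite ltxx.
exact: inf_lt.
Qed.

Lemma inf01_itv (A : set R) : (forall x, A x -> 0 <= x <= 1) -> 0 <= inf01 A <= 1.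
Proof.
move=> hA; rewrite /inf01; case: eqP => [_|/eqP/set0P A0]; first by rewrite ler01 lexx.
apply/andP; split; first by apply: lb_le_inf => // x /hA/andP[].
have [x Ax] := A0; have /andP[_ x1] := hA x Ax; apply: le_trans x1; apply: ge_inf => //.
by exists 0 => z /hA/andP[].
Qed.

Lemma D3_itv (N : nat -> R -> R) : 0 <= D3 N <= 1.
Proof.
apply: inf01_itv => _ [n _ <-]; apply: inf01_itv => al [+ _].
by rewrite in_itv.
Qed.

Lemma coef_ge_near (a : nat -> R[i]) (m : nat -> nat) (beta : nat -> R) :
  (forall k, (0 < m k)%N) ->
  `|complex.Re (expi (- beta k) * a (m k))| `^ (m k)%:R^-1 @[k --> \oo] --> (1 : R) ->
  forall e : R, 0 < e -> exists k0, forall k, (k0 <= k)%N ->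
    expR (- e * (m k)%:R) <= normc (a (m k)).
Proof.
move=> m0 h e e0.
have e1 : expR (- e) < 1 by rewrite expR_lt1 oppr_lt0.
have [k0 _ hk] := cvgr_ge _ h _ e1.
exists k0 => k /hk; set x := `|_| => hx; have mR : (m k)%:R != 0 :> R by rewrite pnatr_eq0 -lt0n.
apply: (@le_trans _ _ x); last first.
  by apply: le_trans (normc_Re _) _; rewrite Normc.normcM normc_expi mul1r.
have x0 : 0 <= x by exact: normr_ge0.
rewrite expRM powR_mulrn ?expR_ge0 //.
apply: (@le_trans _ _ ((x `^ (m k)%:R^-1) ^+ m k)).
  by apply: lerXn2r; rewrite ?nnegrE ?expR_ge0 ?powR_ge0.
by rewrite -powR_mulrn ?powR_ge0 // -powRrM mulVf // powRr1.
Qed.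

End Infima.

(** * The final contradiction *)

Section Contradiction.
Context {R : realType}.

(** In powers of [p = expR (- (s / 8 * x))] the upper bound is at most [p^3 / 4 <= p / 4], and the
    lower one at least [p / 2]. *)
Lemma exp_conflict (s eps x X Q1 : R) : 0 <= x -> 0 < s -> eps <= s / 8 -> 0 <= X ->
  2 * X <= expR (s / 4 * x) -> 2^-1 * expR (- eps * x) <= Q1 ->
  Q1 <= X * (X * expR (eps * x)) * expR (- s * x) -> False.
Proof.
move=> x0 s0 es X0 hX h1 h2; have := le_trans h1 h2; apply/negP; rewrite -ltNge.
pose u := expR (s / 8 * x); pose p := expR (- (s / 8 * x)).
have u0 : 0 < u := expR_gt0 _.
have p0 : 0 < p := expR_gt0 _.
have p1 : p <= 1 by rewrite expR_le1 oppr_le0 mulr_ge0 ?divr_ge0 // ltW.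
have up : u * p = 1 by rewrite -expRD subrr expR0.
have e1 : expR (eps * x) <= u by rewrite ler_expR ler_wpM2r.
have e2 : p <= expR (- eps * x) by rewrite ler_expR mulNr lerN2 ler_wpM2r.
have e3 : expR (- s * x) = p ^+ 8 by rewrite /p expRXn; congr expR; lra.
have e4 : expR (s / 4 * x) = u ^+ 2 by rewrite /u expRXn; congr expR; lra.
rewrite e4 in hX; rewrite e3.
have X2 : X <= u ^+ 2 / 2 by lra.
have : X * (X * expR (eps * x)) * p ^+ 8 <= u ^+ 2 / 2 * (u ^+ 2 / 2 * u) * p ^+ 8.
  apply: ler_wpM2r; first by rewrite exprn_ge0 // ltW.
  by apply: ler_pM => //; rewrite ?mulr_ge0 ?expR_ge0 //; apply: ler_pM; rewrite ?expR_ge0.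
have -> : u ^+ 2 / 2 * (u ^+ 2 / 2 * u) * p ^+ 8 = (u * p) ^+ 5 * p ^+ 3 / 4 by field.
rewrite up expr1n mul1r.
have p3 : p ^+ 3 <= p by rewrite -[leRHS]expr1 ler_wiXn2l // ltW.
move=> h; apply: (le_lt_trans h); clear -p0 p3 e2; lra.
Qed.

(** Half of the decay [c] is spent, a quarter on each factor of the Lagrange bound: [mu] is fixed
    first, for the exponential, and [rho] after it, for [mu^-n0]. *)
Lemma correction_small (c mu rho : R) (C m n0 : nat) : 0 < mu -> mu <= 1 -> 0 < c ->
  2 * C%:R * mu <= c / 4 -> rho * ln mu^-1 <= c / 4 -> (n0 <= m)%N -> n0%:R <= rho * m%:R ->
  n0%:R * expR (- c * m%:R) * (mu^-1 ^+ n0 * expR (2 * (C * m)%:R * mu))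
    <= m%:R * expR (- (c / 2) * m%:R).
Proof.
move=> mu0 mu1 c0 h1 h2 h3 h4.
have L0 : 0 <= ln mu^-1 by rewrite ln_ge0 // invf_ge1.
have e1 : mu^-1 ^+ n0 <= expR (c / 4 * m%:R).
  rewrite -[mu^-1]lnK ?posrE ?invr_gt0 // expRXn ler_expR.
  apply: le_trans (ler_wpM2r L0 h4) _.
  by rewrite mulrAC; apply: ler_wpM2r.
have e2 : expR (2 * (C * m)%:R * mu) <= expR (c / 4 * m%:R).
  rewrite ler_expR natrM; have := ler_wpM2r (ler0n R m) h1; lra.
have -> : expR (- (c / 2) * m%:R) = expR (- c * m%:R) * (expR (c / 4 * m%:R) * expR (c / 4 * m%:R)).
  by rewrite -!expRD; congr expR; lra.
rewrite -mulrA; apply: ler_pM => //; first by rewrite !mulr_ge0 ?expR_ge0 ?exprn_ge0 ?invr_ge0 ?ltW.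
  by rewrite ler_nat.
apply: ler_wpM2l; first exact: expR_ge0.
by apply: ler_pM => //; rewrite ?expR_ge0 ?exprn_ge0 ?invr_ge0 // ltW.
Qed.

Lemma min_gap (F : seq (R * R)) : (forall p, p \in F -> p.1 < p.2) ->
  exists2 w : R, 0 < w & forall p, p \in F -> w <= p.2 - p.1.
Proof.
elim: F => [|p F IH] hF; first by exists 1.
have [w w0 hw] := IH (fun q qF => hF q (mem_behead (s := p :: F) qF)).
exists (Num.min w (p.2 - p.1)); first by rewrite lt_min w0 subr_gt0 hF ?mem_head.
move=> q; rewrite inE => /predU1P[->|/hw h]; first by rewrite ge_min lexx orbT.
by rewrite ge_min h.
Qed.

(** [c] and [C] are fixed before [eps]: in [gap_absurd] the rate [eps] is taken from a family of
    blocks that itself depends on [c] and [C]. *)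
Definition small_sums (a : nat -> R[i]) (t len c : R) (C : nat) :=
  forall eps : R, 0 < eps -> exists m1, forall m, (m1 <= m)%N ->
    exists cc : nat -> R[i], [/\ cc m = a m, forall j, a j = 0 -> cc j = 0,
      forall j, (j < C * m)%N -> normc (cc j) <= expR (eps * m%:R) &
      forall s, t <= s <= t + len ->
        normc (\sum_(j < C * m) cc j * expi (j%:R * s)) <= expR (- c * m%:R)].

(** When the arc covers the circle all samples are small: with [d0 = n0 = 0] the polynomial [Q] is
    0, whereas its value at 1 should be about [a m]. *)
Lemma full_circle_absurd (a : nat -> R[i]) (t len c : R) (C : nat) (mm : nat -> nat) :
  2 * pi <= len -> 0 < c -> (1 < C)%N -> small_sums a t len c C -> (forall k, (k <= mm k)%N) ->
  (forall e : R, 0 < e -> exists k0, forall k, (k0 <= k)%N ->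
     expR (- e * (mm k)%:R) <= normc (a (mm k))) -> False.
Proof.
move=> hlen c0 C1 hS hmm ha.
have [m1 hm1] := hS 1 ltr01; have [k1 hk1] := ha (c / 2) ltac:(lra).
pose k := (m1 + k1).+1; set m := mm k; have km : (k <= m)%N := hmm k.
have m0 : (0 < m)%N by apply: leq_trans km.
have [|cc [ccm _ hE hs]] := hm1 m; first by apply: leq_trans km; rewrite /k; lia.
have mN : (m + 0 < C * m)%N by rewrite addn0 -{1}[m]mul1n ltn_pmul2r.
have len' : 2 * pi * (C * m - 0)%:R <= len * (C * m)%:R by rewrite subn0 ler_wpM2r.
have mu01 : 0 < (1 : R) <= 1 by rewrite ltr01 lexx.
have [Q [szQ _ _]] := vanishing_poly true (leq0n _) len' hE hs (leq0n _) mN mu01.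
have /eqP -> : Q == 0 by rewrite -size_poly_leq0.
rewrite horner0 Normc.normc0 !mul0r subr0 ccm subr_le0 => h.
have : expR (- (c / 2) * m%:R) <= expR (- c * m%:R).
  by apply: le_trans h; apply: hk1; rewrite /k; lia.
by rewrite ler_expR ler_pM2r ?ltr0n //; lra.
Qed.

Lemma gap_absurd (a : nat -> R[i]) (t sg al c : R) (C : nat) (b : bool) (mm : nat -> nat)
    (n : R -> R) :
  0 <= al <= 1 -> al < sg -> sg < 1 -> 0 < c -> (1 < C)%N ->
  small_sums a t (2 * pi * sg) c C -> (forall k, (k <= mm k)%N) ->
  (forall e : R, 0 < e -> exists k0, forall k, (k0 <= k)%N ->
     expR (- e * (mm k)%:R) <= normc (a (mm k))) ->
  (forall r : R, 0 <= r <= 1 -> count_offset b a (mm k) r @[k --> \oo] --> n r) ->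
  (forall d : R, d \in `]0, 1[ ->
    (\int[lebesgue_measure]_(r in `]0%R, d])
       ((n r - lower_reg al d n r) / r ^+ 2)%:E = +oo)%E) -> False.
Proof.
move=> al01 alsg sg1 c0 C1 hS hmm ha hn hoo; have /andP[al0 al1] := al01.
have C1R : 1 <= C%:R :> R by rewrite ler1n ltnW.
(* [e = 1 - al] is the proportion of zero coefficients on the blocks, in the limit at least;
   [e - g = 1 - sg] is the proportion that the degree accounts for. *)
pose g := sg - al; pose e := 1 - al.
have g0 : 0 < g by rewrite subr_gt0.
have ge : g <= e by rewrite /g /e; lra.
have e1 : e <= 1 by rewrite /e; lra.
pose kap := g / 64 * (g / 48).
have kap0 : 0 < kap by rewrite mulr_gt0 ?divr_gt0.
pose mu := Num.min 1 (c / (8 * C%:R)).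
have mu0 : 0 < mu by rewrite lt_min ltr01 divr_gt0 // mulr_gt0 // ltr0n ltnW.
have mu1 : mu <= 1 by rewrite ge_min lexx.
have hmu : 2 * C%:R * mu <= c / 4.
  have C0 : 0 < C%:R :> R by lra.
  apply: (@le_trans _ _ (2 * C%:R * (c / (8 * C%:R)))).
    by rewrite ler_pM2l ?mulr_gt0 // ge_min lexx orbT.
  by rewrite le_eqVlt; apply/orP; left; apply/eqP; field; rewrite gt_eqF.
pose L := ln mu^-1; have L0 : 0 <= L by rewrite ln_ge0 // invf_ge1.
(* [1/2] ensures [m + n0' < N], [g / 16] limits the degree added by the correction, and the last
   bound makes [mu^-n0'] at most [expR (c / 4 * m)]; [L + 1] avoids a division by 0. *)
pose rho := Num.min 2^-1 (Num.min (g / 16) (c / (4 * (L + 1)))).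
have L1 : 0 < L + 1 by rewrite ltr_wpDl.
have rho0 : 0 < rho by rewrite !lt_min invr_gt0 ltr0n !divr_gt0 // mulr_gt0.
have rho2 : rho <= 2^-1 by rewrite ge_min lexx.
have rhog : rho <= g / 16 by rewrite !ge_min lexx orbT.
have rhoL : rho * L <= c / 4.
  apply: (@le_trans _ _ (c / (4 * (L + 1)) * (L + 1))).
    by apply: ler_pM => //; rewrite ?(ltW rho0) ?lerDl // !ge_min lexx !orbT.
  by rewrite le_eqVlt; apply/orP; left; apply/eqP; field; rewrite gt_eqF.
have rho1 : 0 < rho < 1 by rewrite rho0; lra.
have n0 := limit_count_ge0 hn; have nlip := limit_count_lip hmm hn.
have [lo [F [lo0 lorho [pF hF] HF]]] :=
  heavy_gap_family al01 n0 nlip (16 * (8 * 100) / (g * kap ^+ 2)) rho1 hoo.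
have [|w w0 hw] := @min_gap F; first by move=> p /hF[].
have rho_1 : rho <= 1 by case/andP: rho1 => _ /ltW.
(* All blocks lie to the right of [lo], which gives the condition [s <= p.2] of [gap_estimate]. *)
pose s := Num.min 2^-1 lo.
have s0 : 0 < s by rewrite lt_min invr_gt0 ltr0n.
pose eps := Num.min (c / 4) (s / 8).
have eps0 : 0 < eps by rewrite lt_min !divr_gt0.
have epsc : eps <= c / 4 by rewrite ge_min lexx.
have epss : eps <= s / 8 by rewrite ge_min lexx orbT.
pose pts := [seq p.1 | p <- F] ++ [seq p.2 | p <- F].
have hpts r : r \in pts -> 0 <= r <= 1.
  rewrite mem_cat => /orP[/mapP[p /hF[h1 h2 h3 _] ->]|/mapP[p /hF[h1 h2 h3 _] ->]].
    by rewrite (ltW (lt_le_trans lo0 h1)) (le_trans (ltW h2) (le_trans h3 rho_1)).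
  by rewrite (le_trans (ltW lo0) (le_trans h1 (ltW h2))) (le_trans h3 rho_1).
(* The accuracy asked for by [many_zeros] on the shortest block; pointwise convergence is uniform on
   the finitely many endpoints. *)
have eta0 : 0 < g * w / 32 by rewrite divr_gt0 ?mulr_gt0.
have [k2 hk2] := count_offset_near hn eta0 hpts.
have [m1 hm1] := hS eps eps0; have [k1 hk1] := ha eps eps0.
have c4 : 0 < c / 4 by rewrite divr_gt0.
have s4 : 0 < s / 4 by rewrite divr_gt0.
have [m3 hm3] := linear_le_expR 2 c4.
have [m4 hm4] := linear_le_expR (2 * (C%:R + 1)) s4.
pose k := (m1 + k1 + k2 + m3 + m4 + trunc (128 / (g * w)) + trunc (16 / g)).+1.
have [hk_m1 hk_k1 hk_k2 hk_m3] : [/\ (m1 <= k)%N, (k1 <= k)%N, (k2 <= k)%N & (m3 <= k)%N].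
  by rewrite /k; clear; split; lia.
have [hk_m4 hk_w hk_g hk_0] : [/\ (m4 <= k)%N, (trunc (128 / (g * w)) < k)%N,
    (trunc (16 / g) < k)%N & (0 < k)%N].
  by rewrite /k; clear; split; lia.
set m := mm k; have km : (k <= m)%N := hmm k.
have m0 : (0 < m)%N := leq_trans hk_0 km.
have mR : 0 < m%:R :> R by rewrite ltr0n.
have [cc [ccm cc0 hE hs]] := hm1 m (leq_trans hk_m1 km).
have hm128 : 128 <= g * (w * m%:R).
  have : 128 / (g * w) <= m%:R.
    apply: le_trans (ltW (truncnS_gt _)) _; rewrite ler_nat; exact: leq_trans km.
  by rewrite ler_pdivrMr ?mulr_gt0 // mulrC mulrA.
have hm16 : 1 <= g / 16 * m%:R.
  have : 16 / g <= m%:R.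
    apply: le_trans (ltW (truncnS_gt _)) _; rewrite ler_nat; exact: leq_trans km.
  by rewrite ler_pdivrMr //; clear; lra.
pose N := (C * m)%N; pose n0' := trunc (rho * m%:R).
(* The [trunc (sg N)] samples to be dropped fit on the arc of length [2 pi sg]. *)
pose d0 := (N - trunc (sg * N%:R))%N.
have rm0 : 0 <= rho * m%:R by rewrite mulr_ge0 // ltW.
have n0R : n0'%:R <= rho * m%:R by case/andP: (truncn_itv rm0).
have mN : m%:R <= N%:R :> R by rewrite natrM ler_peMl //.
have n0m : (n0' <= m)%N.
  by rewrite -(ler_nat R); apply: le_trans n0R _; rewrite ler_piMl // ltW //; lra.
have n0m2 : (m + n0' < N)%N.
  rewrite -(ltr_nat R) natrD natrM.
  have : 2 * m%:R <= C%:R * m%:R :> R by rewrite ler_wpM2r ?ler_nat // ltW.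
  have : rho * m%:R <= 2^-1 * m%:R by rewrite ler_wpM2r // ltW.
  by move: n0R mR; clear; lra.
have sgN0 : 0 <= sg * N%:R by rewrite mulr_ge0 // ltW // (le_lt_trans al0).
have /andP[tN1 tN2] := truncn_itv sgN0.
have tNN : (trunc (sg * N%:R) <= N)%N.
  by rewrite -(ler_nat R); apply: le_trans tN1 _; rewrite ler_piMl // ltW.
have d0N : (d0 <= N)%N by exact: leq_subr.
have hlen : 2 * pi * (N - d0)%:R <= 2 * pi * sg * N%:R.
  rewrite subKn // -[leRHS]mulrA; apply: ler_wpM2l => //.
  by rewrite mulr_ge0 // pi_ge0.
have mu01 : 0 < mu <= 1 by rewrite mu0.
have [Q [szQ bdQ rtQ Q1]] := vanishing_poly b d0N hlen hE hs n0m n0m2 mu01.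
set K := (K in _ - K) in Q1.
have K_le : K <= m%:R * expR (- (c / 2) * m%:R).
  exact: (correction_small (rho := rho)).
have mexp : (m%:R + 1) * expR (- (c / 2) * m%:R) <= 2^-1 * expR (- (c / 4) * m%:R).
  have -> : expR (- (c / 2) * m%:R) = expR (- (c / 4) * m%:R) * expR (- (c / 4) * m%:R).
    by rewrite -expRD; congr expR; clear; field.
  rewrite mulrA; apply: ler_wpM2r; first exact: expR_ge0.
  rewrite mulNr expRN ler_pdivrMr ?expR_gt0 //.
  by have := hm3 m (leq_trans hk_m3 km); rewrite -[m.+1%:R]natr1; clear; lra.
have ec : expR (- c * m%:R) <= expR (- (c / 2) * m%:R).
  by rewrite ler_expR ler_wpM2r ?(ltW mR) //; clear -c0 epsc; lra.
have e4 : expR (- (c / 4) * m%:R) <= expR (- eps * m%:R).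
  by rewrite ler_expR ler_wpM2r ?(ltW mR) //; clear -c0 epsc; lra.
have e5 : expR (- (c / 4) * m%:R) <= 1.
  by rewrite expR_le1 mulNr oppr_le0 mulr_ge0 // ltW.
have am : expR (- eps * m%:R) <= normc (cc m) by rewrite ccm; exact: hk1.
have Q1_ge : 2^-1 * expR (- eps * m%:R) <= normc Q.[1].
  by move: Q1 am K_le mexp ec e4; clear; lra.
have K1 : K <= 1.
  have : 0 <= expR (- (c / 2) * m%:R) by exact: expR_ge0.
  by move: K_le mexp e5; clear; lra.
have Q10 : 0 < normc Q.[1] by apply: lt_le_trans Q1_ge; rewrite mulr_gt0 ?expR_gt0 // invr_gt0.
pose d := (d0 + n0')%N.
(* The degree bound is [N - sg N] plus a rounding error of at most 1 plus [n0'], and each of the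
   last two is at most [g N / 16]. *)
have dle : d%:R <= (e - 7 * g / 8) * N%:R.
  rewrite natrD natrB //.
  have h1 : rho * m%:R <= g / 16 * m%:R by rewrite ler_wpM2r // ltW.
  have h2 : g / 8 * m%:R <= g / 8 * N%:R by rewrite ler_wpM2l // divr_ge0 // ltW.
  have -> : (e - 7 * g / 8) * N%:R = N%:R - sg * N%:R + g / 8 * N%:R.
    by rewrite /e /g; field.
  move: tN2; rewrite -[(trunc _).+1%:R]natr1; move: n0R hm16 h1 h2; clear; lra.
have dN : d%:R <= N%:R :> R.
  apply: le_trans dle _; rewrite ler_piMl //; move: g0 e1 al0 ge; clear; lra.
have hFm p : p \in F -> [/\ 0 < p.1, p.1 < p.2, p.2 <= 1, s <= p.2 &
    [/\ (trunc (p.2 * m%:R) <= n0')%N, 128 <= g * ((p.2 - p.1) * m%:R) &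
     (e - g / 8) * ((p.2 - p.1) * m%:R)
      <= (size [seq i <- iota (trunc (p.1 * m%:R)).+1 (trunc (p.2 * m%:R) - trunc (p.1 * m%:R)) |
            a (offset b m i) == 0])%:R]].
  move=> pin; have [h1 h2 h3 h4] := hF p pin; have hwp := hw p pin.
  have h128 : 128 <= g * ((p.2 - p.1) * m%:R).
    apply: le_trans hm128 _; apply: ler_wpM2l; first exact: ltW.
    by apply: ler_wpM2r; first exact: ltW.
  have p10 := lt_le_trans lo0 h1.
  split; [exact: p10|exact: h2|exact: le_trans h3 rho_1|by rewrite ge_min (le_trans h1 (ltW h2)) orbT|split=> //].
    by apply: le_truncn; rewrite ler_wpM2r // ltW.
  apply: (many_zeros m0 (ltW p10) (ltW h2) h128 (eta := g * w / 32) _ h4).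
  - by rewrite mulrC divfK // ler_pM2l.
  - by apply: hk2 => //; rewrite mem_cat map_f.
  - by apply: hk2 => //; rewrite mem_cat map_f ?orbT.
have weight : 16 * (8 * 100) <= g * kap ^+ 2 * \sum_(p <- F) ((p.2 - p.1) / p.2) ^+ 2.
  by rewrite [leRHS]mulrC -ler_pdivrMr ?mulr_gt0 ?exprn_gt0.
have s2 : 0 < s <= 2^-1 by rewrite s0 ge_min lexx.
have n0N : (n0' < N)%N by apply: leq_ltn_trans n0m2; exact: leq_addl.
have Qn0 : Q.[1] != 0 by rewrite -normc_gt0.
have rt i : (0 < i <= n0')%N -> a (offset b m i) == 0 -> root Q (om N ^+ i).
  by move=> hi /eqP az; apply: rtQ => //; apply: cc0.
have := gap_estimate C1 g0 ge e1 s2 n0N hFm pF weight rt Qn0 (leqW szQ) dle bdQ.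
set X := N%:R + 1 : R; set E := expR (eps * m%:R).
have E1 : 1 <= E by rewrite -expR0 ler_expR mulr_ge0 // ltW.
have K0 : 0 <= K.
  by rewrite /K !mulr_ge0 ?expR_ge0 ?exprn_ge0 ?invr_ge0 // ltW.
move=> hgap.
have X0 : 0 <= X by rewrite addr_ge0.
apply: (@exp_conflict s eps m%:R X (normc Q.[1])) => //.
  have := hm4 m (leq_trans hk_m4 km); apply: le_trans.
  rewrite -mulrA ler_pM2l // /X natrM -[m.+1%:R]natr1; move: C1R mR; clear; nra.
have pos : 0 < d.+1%:R * (N%:R * E + K).
  rewrite mulr_gt0 ?ltr0n // ltr_wpDr // mulr_gt0 ?expR_gt0 //.
  by apply: lt_le_trans mN.
have : normc Q.[1] <= d.+1%:R * (N%:R * E + K) * expR (- s * m%:R).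
  rewrite -[leLHS]lnK ?posrE // -[X in X * expR _]lnK ?posrE // -expRD ler_expR.
  by rewrite mulNr.
move/le_trans; apply; apply: ler_wpM2r; first exact: expR_ge0.
apply: ler_pM => //.
- by rewrite addr_ge0 // mulr_ge0 // ltW // expR_gt0.
- by rewrite -[d.+1%:R]natr1 /X lerD2r.
- by rewrite /X mulrDl mul1r lerD2l (le_trans K1).
Qed.

End Contradiction.

Theorem mainTheorem3 (R : realType) (a : nat -> R[i]) (f : R[i] -> R[i])
    (m : nat -> nat) (beta : nat -> R)
    (hf : forall z, unit_disc R z -> [series a n * z ^+ n]_n @ \oo --> f z)
    (ha : limn_esup (fun n => (Normc.normc (a n) `^ n%:R^-1)%:E) = 1%:E)
    (m_gt0 : forall k, (0 < m k)%N)
    (m_incr : {homo m : i j / (i < j)%N})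
    (hbeta : `|complex.Re (expi (- beta k) * a (m k))| `^ (m k)%:R^-1
               @[k --> \oo] --> (1 : R)) :
  let Delta := Num.min (D3 (@count_plus R m (Lambda_plus a m)))
                       (D3 (@count_minus R m (Lambda_minus a m))) in
  forall t : R, has_singularity_on f (closed_arc t (2 * pi * Delta)).
Proof.
move=> Delta t; apply: contrapT => hsing.
have pi0 : 0 < 2 * pi :> R by rewrite mulr_gt0 // pi_gt0.
have Delta01 : 0 <= Delta <= 1.
  by rewrite le_min ge_min; have /andP[-> ->] := D3_itv (@count_plus R m (Lambda_plus a m));
    have /andP[-> _] := D3_itv (@count_minus R m (Lambda_minus a m)).
have [D0 D1] := andP Delta01.
have [q [B [d [q01 d0 hgood]]]] := arc_continues_at (mulr_ge0 (ltW pi0) D0) hsing.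
(* The continuation reaches beyond the arc, so [sg] exceeds [Delta] strictly. *)
pose sg := Delta + d / (2 * pi).
have Dsg : Delta < sg by rewrite ltrDl divr_gt0.
have lenE : 2 * pi * sg = 2 * pi * Delta + d.
  by rewrite /sg mulrDr [2 * pi * (d / _)]mulrCA divff ?gt_eqF // mulr1.
have [c [C [c0 C1 hS]]] : exists (c : R) (C : nat), [/\ 0 < c, (1 < C)%N &
    small_sums a t (2 * pi * sg) c C].
  apply: (exp_sum_small hf q01 (B := B)) => s; rewrite lenE addrA; exact: hgood.
have low := coef_ge_near m_gt0 hbeta.
have m_ge (s : nat -> nat) : {homo s : i j / (i < j)%N} -> forall k, (k <= s k)%N.
  by move=> hs; elim=> // k /leq_ltn_trans; apply; exact: hs.
(* The case [1 <= sg] contains [Delta = 1], where no slope below 1 need exist. *)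
have [sg1|sg1] := leP 1 sg.
  by apply: (full_circle_absurd _ c0 C1 hS (m_ge _ m_incr) low); rewrite ler_peMr // ltW.
have contra b (Ncount : nat -> R -> R) : D3 Ncount < sg ->
    (forall k r, 0 <= r <= 1 -> Ncount k r = count_offset b a (m k) r) -> False.
  (* As [sg < 1], neither infimum is the default value 1, so there are a limit function [n] and a
     slope [al < sg] with divergent integrals. *)
  move=> /inf01_ltP/(_ (ltW sg1))[_ [n [s s_incr hs] <-]] /inf01_ltP/(_ (ltW sg1))[al [al01 hoo] alsg] hN.
  have ms_ge k : (k <= m (s k))%N by apply: leq_trans (m_ge _ s_incr k) (m_ge _ m_incr _).
  rewrite in_itv /= in al01.
  apply: (gap_absurd (mm := m \o s) (b := b) al01 alsg sg1 c0 C1 hS ms_ge _ _ hoo).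
  - move=> e /low[k0 hk0]; exists k0 => k kk0; apply: hk0.
    exact: leq_trans kk0 (m_ge _ s_incr k).
  - move=> r r01; have := hs r; rewrite in_itv /= => /(_ r01).
    by under eq_cvg do rewrite hN //.
have [/contra h|/contra h] : D3 (@count_plus R m (Lambda_plus a m)) < sg \/
    D3 (@count_minus R m (Lambda_minus a m)) < sg.
- by apply/orP; rewrite -gt_min.
- by apply: (h true) => k r; exact: count_plusE.
- by apply: (h false) => k r; exact: count_minusE.
Qed.
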